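(* Let $(M,\eta)$ be a pre-contact manifold. There exist a contact manifold $(\widetilde M,\widetilde\eta)$ and an embedding $\mathfrak i\colon M\hookrightarrow\widetilde M$ with $\mathfrak i^*\widetilde\eta=\eta$ such that $\mathfrak i(M)$ is a coisotropic submanifold of $(\widetilde M,\widetilde\eta)$.
   Context: All manifolds, forms and maps are smooth. A pre-contact manifold is a pair $(M,\eta)$ with $M$ a manifold of dimension $2d+1$ and $\eta\in\Omega^1(M)$. Standing assumptions: $\eta$ is nowhere vanishing (so $\ker\eta$ is a subbundle of rank $2d$), and the restriction of $d\eta$ to $\ker\eta$ has constant rank. A contact manifold is a pair $(\widetilde M,\widetilde\eta)$ with $\dim\widetilde M=2n+1$ and $\widetilde\eta$ a 1-form such that $\widetilde\eta\wedge(d\widetilde\eta)^n$ is nowhere zero. For a subspace $W\subseteq T_m\widetilde M$ the contact orthogonal is $W^{\perp}=\{X\in\ker\widetilde\eta_m: d\widetilde\eta(X,Y)=0\ \forall Y\in W\}$. A submanifold $N$ of $\widetilde M$ is coisotropic if $(T_nN)^\perp\subseteq T_nN$ for every $n\in N$. *)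

(* Defs.v *)
From HB Require Import structures.
From mathcomp Require Import all_boot all_order all_algebra all_fingroup.
From mathcomp Require Import all_classical all_reals all_analysis.

Set Implicit Arguments.
Unset Strict Implicit.
Unset Printing Implicit Defensive.

Import Order.TTheory GRing.Theory Num.Theory.
Import numFieldNormedType.Exports.

Local Open Scope classical_set_scope.
Local Open Scope ring_scope.

(** * Smooth maps between open subsets of normed spaces *)

(* [U] is meant to be open. *)
Fixpoint Ck_on (R : realType) (V W : normedModType R) (k : nat) (U : set V)
    (f : V -> W) : Prop :=
  match k with
  | 0 => forall x, U x -> {for x, continuous f}
  | k'.+1 => (forall x, U x -> differentiable f x) /\
             (forall v, Ck_on k' U (fun x => 'D_v f x))
  end.

Definition smooth_on (R : realType) (V W : normedModType R) (U : set V)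
  (f : V -> W) : Prop := forall k, Ck_on k U f.

(** * Manifolds *)

(* A homeomorphism between open sets [dom] and [cod]; the values of [phi]
   outside [dom] and of [psi] outside [cod] are irrelevant. *)
Record chart (R : realType) (T : topologicalType) (n : nat) := Chart {
  dom : set T;
  cod : set 'rV[R]_n;
  phi : T -> 'rV[R]_n;
  psi : 'rV[R]_n -> T;
  dom_open : open dom;
  cod_open : open cod;
  phi_cod : forall m, dom m -> cod (phi m);
  psi_dom : forall x, cod x -> dom (psi x);
  phiK : forall m, dom m -> psi (phi m) = m;
  psiK : forall x, cod x -> phi (psi x) = x;
  phi_cont : forall m, dom m -> {for m, continuous phi};
  psi_cont : forall x, cod x -> {for x, continuous psi} }.

Definition local_rep (R : realType) (T T' : topologicalType) (n n' : nat)
    (f : T -> T') (c : chart R T n) (c' : chart R T' n') :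
    'rV[R]_n -> 'rV[R]_n' :=
  fun x => phi c' (f (psi c x)).

Definition local_dom (R : realType) (T T' : topologicalType) (n n' : nat)
    (f : T -> T') (c : chart R T n) (c' : chart R T' n') : set 'rV[R]_n :=
  [set x | cod c x /\ dom c' (f (psi c x))].

(* The transition map from [c] to [c'] is [local_rep id c c'].  The atlas is
   not required to be maximal. *)
Record manifold (R : realType) (n : nat) := Manifold {
  carrier :> topologicalType;
  manifold_hausdorff : hausdorff_space carrier;
  manifold_second_countable : @second_countable carrier;
  atlas : set (chart R carrier n);
  atlas_cover : forall m : carrier, exists2 c, atlas c & dom c m;
  atlas_compat : forall c c', atlas c -> atlas c' ->
    smooth_on (local_dom id c c') (local_rep id c c') }.
Arguments atlas {R n} M : rename.

Definition smooth_map (R : realType) (n n' : nat) (M : manifold R n)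
    (N : manifold R n') (f : M -> N) : Prop :=
  continuous f /\
  forall c c', atlas M c -> atlas N c' ->
    smooth_on (local_dom f c c') (local_rep f c c').

(* A smooth injective immersion which is a homeomorphism onto its image, i.e.
   such that the topology of [M] is the one induced from [N]. *)
Definition embedding (R : realType) (n n' : nat) (M : manifold R n)
    (N : manifold R n') (f : M -> N) : Prop :=
  [/\ smooth_map f,
      injective f,
      forall U : set M, open U -> exists2 V : set N, open V & U = f @^-1` V &
      forall c c' x, atlas M c -> atlas N c' ->
        local_dom f c c' x -> injective ('d (local_rep f c c') x)].

(** * Differential forms *)

Definition local_pullback (R : realType) (T T' : topologicalType) (n n' : nat)
    (f : T -> T') (c : chart R T n) (c' : chart R T' n')
    (w : 'rV[R]_n' -> 'rV[R]_n' -> R) : 'rV[R]_n -> 'rV[R]_n -> R :=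
  fun x v => w (local_rep f c c' x) ('d (local_rep f c c') x v).

(* A smooth 1-form, given by its expressions [w c x : v |-> w_x(v)] in the
   charts [c] of the atlas, which agree under pullback by the transition
   maps; here [v] is the coordinate expression of a tangent vector. *)
Record one_form (R : realType) (n : nat) (M : manifold R n) := OneForm {
  form_at :> chart R M n -> 'rV[R]_n -> 'rV[R]_n -> R;
  form_linear : forall c x, atlas M c -> cod c x -> scalar (form_at c x);
  form_smooth : forall c, atlas M c ->
    forall v, smooth_on (cod c) (fun x => form_at c x v);
  form_compat : forall c c', atlas M c -> atlas M c' ->
    forall x, local_dom id c c' x ->
    forall v, form_at c x v = local_pullback id c c' (form_at c') x v }.

(* For constant vector fields [u], [v] on a chart, [u, v] = 0, so that
   d w (u, v) = u (w v) - v (w u). *)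
Definition ext_d (R : realType) (n : nat) (M : manifold R n) (w : one_form M)
    (c : chart R M n) (x u v : 'rV[R]_n) : R :=
  'D_u (fun y => w c y v) x - 'D_v (fun y => w c y u) x.

(* f^* w' = w *)
Definition is_pullback (R : realType) (n n' : nat) (M : manifold R n)
    (N : manifold R n') (f : M -> N) (w' : one_form N) (w : one_form M) : Prop :=
  forall c c', atlas M c -> atlas N c' -> forall x, local_dom f c c' x ->
    forall v, local_pullback f c c' (w' c') x v = w c x v.

Section Wedge.
Variables (R : realType) (V : lmodType R).

(* Alternating k-forms on [V] are represented as functions of k-tuples. *)
Definition wedge (p q : nat) (a : ('I_p -> V) -> R) (b : ('I_q -> V) -> R) :
    ('I_(p + q) -> V) -> R :=
  fun v => ((p`! * q`!)%N)%:R^-1 *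
    \sum_(s : 'S_(p + q)) (-1) ^+ s *
      a (fun i => v (s (lshift q i))) * b (fun j => v (s (rshift p j))).

Fixpoint wedge_pow2 (b : ('I_2 -> V) -> R) (k : nat) : ('I_(k * 2) -> V) -> R :=
  match k return ('I_(k * 2) -> V) -> R with
  | 0 => fun=> 1
  | k'.+1 => wedge (q := k' * 2) b (@wedge_pow2 b k')
  end.

Definition form1 (a : V -> R) : ('I_1 -> V) -> R := fun v => a (v ord0).

Definition form2 (b : V -> V -> R) : ('I_2 -> V) -> R :=
  fun v => b (v ord0) (v ord_max).

End Wedge.

(** * Pre-contact and contact manifolds *)

Definition nowhere_vanishing (R : realType) (n : nat) (M : manifold R n)
    (w : one_form M) : Prop :=
  forall c x, atlas M c -> cod c x -> exists v, w c x v != 0.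

(* The rank of the restriction of the bilinear form [b] to ker [a]: the rows
   of [K] span ker [a], hence [K *m B *m K^T] is a Gram matrix of the
   restriction. *)
Definition rank_on_ker (R : realType) (n : nat) (a : 'rV[R]_n -> R)
    (b : 'rV[R]_n -> 'rV[R]_n -> R) : nat :=
  let K := kermx (\col_(i < n) a (delta_mx 0 i)) in
  let B := \matrix_(i < n, j < n) b (delta_mx 0 i) (delta_mx 0 j) in
  \rank (K *m B *m K^T).

Definition precontact (R : realType) (d : nat) (M : manifold R (d * 2).+1)
    (eta : one_form M) : Prop :=
  nowhere_vanishing eta /\
  exists r : nat, forall c x, atlas M c -> cod c x ->
    rank_on_ker (eta c x) (ext_d eta c x) = r.

(* eta /\ (d eta)^n is nowhere zero; note that [(n * 2).+1] and [1 + n * 2]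
   are convertible. *)
Definition contact (R : realType) (n : nat) (M : manifold R (n * 2).+1)
    (eta : one_form M) : Prop :=
  forall c x, atlas M c -> cod c x ->
    exists v : 'I_(1 + n * 2) -> 'rV[R]_(n * 2).+1,
      wedge (form1 (eta c x)) (wedge_pow2 (form2 (ext_d eta c x)) (k := n)) v
        != 0.

Definition contact_orth (R : realType) (n : nat) (M : manifold R n)
    (eta : one_form M) (c : chart R M n) (x : 'rV[R]_n) (W : set 'rV[R]_n) :
    set 'rV[R]_n :=
  [set X | eta c x X = 0 /\ forall Y, W Y -> ext_d eta c x X Y = 0].

(* The submanifold i(M) of N is coisotropic, for an embedding i; its tangent
   space at i(m) is the image of the differential of i at m. *)
Definition coisotropic_image (R : realType) (n n' : nat) (M : manifold R n)
    (N : manifold R n') (eta : one_form N) (i : M -> N) : Prop :=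
  forall c c', atlas M c -> atlas N c' ->
  forall x, local_dom i c c' x ->
    let T := range ('d (local_rep i c c') x) in
    contact_orth eta c' (local_rep i c c' x) T `<=` T.

(* Main.v *)
(* Let V be the characteristic distribution of M, the radical of d eta on
   ker eta: a subbundle of TM of rank k = 2d - r, where r is the rank of d eta on
   ker eta.  The contact manifold is an
   open neighbourhood of the zero section in the total space of the dual of V,
   with the form pi^* eta + p^* lambda, where p : TM -> V is a smooth projection,
   obtained by gluing local projections with a partition of unity, and lambda is
   the tautological form, (p^* lambda)_alpha (X) = alpha (p (pi_* X)).  On the zero
   section the Gram matrix of its differential in T M + V^* is
   [[d eta, - theta], [theta^T, 0]], theta being the matrix of p; a vector of
   ker eta which is orthogonal to T M or in the kernel has no component along
   V^*, as is seen by pairing with V.  This gives both the contact condition,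
   which is open, and coisotropy.  The dimension is odd because the rank r of a
   skew form is even. *)

Require Import Defs.
From HB Require Import structures.
From mathcomp Require Import all_boot all_order all_algebra all_fingroup.
From mathcomp Require Import all_classical all_reals all_analysis.
From mathcomp Require Import ring lra zify.
(* Again, since the MathComp libraries shadow [dom]. *)
Require Import Defs.

Set Implicit Arguments.
Unset Strict Implicit.
Unset Printing Implicit Defensive.

Import Order.TTheory GRing.Theory Num.Theory.
Import numFieldNormedType.Exports.

Local Open Scope classical_set_scope.
Local Open Scope ring_scope.

(** * Smooth calculus *)

(** The dual bundle is not formed as a quotient of glued pieces. It is realized inside the product
    of [M] with a countable power of R^k: a covector is recorded by its coordinates in all local
    frames at once, each multiplied by a cut-off. Separation is then inherited from the product, and
    the countability of the frames, a Lindelöf argument, gives the countable basis. The same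
    cut-offs [f_j] yield the partition of unity [f_j * prod_(i < j) (1 - f_i)]: since near every
    point some [f_j] is 1, the sum is locally finite and telescopes to 1. No radius is chosen for
    the neighbourhood of the zero section. It consists of all points where a bordered skew matrix,
    made of the form and its exterior derivative, is invertible; this condition is open and
    independent of the trivialization. The passage from this matrix to the top exterior power goes
    through a symplectic basis of the kernel, on which all terms of the sum defining the wedge power
    are nonnegative and the term of the identity is positive. *)

Section SmoothCalculus.
Variable R : realType.
Implicit Types V W : normedModType R.

Lemma near0_differentiable V W (h : V -> W) x :
  (\near x, h x = 0) -> differentiable h x.
Proof.
move=> hn.
have E : h \o shift x = cst (h x) + (\0 : {linear V -> W}) +o_ 0 id.
  apply/eqaddoP => e e0; rewrite (nbhs_singleton hn).
  have : \forall y \near 0, h (y + x) = 0.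
    by move: hn; rewrite (near_shift 0 x); apply: filterS => y /=; rewrite subr0.
  by apply: filterS => y hy; rewrite !fctE /= hy addr0 subrr normr0 mulr_ge0 // ltW.
have c0 : continuous (\0 : {linear V -> W}) by move=> y; exact: cvg_cst.
by apply/diff_locallyP; rewrite (diff_unique c0 E); split.
Qed.

Lemma near_eq_differentiable V W (f g : V -> W) x :
  (\near x, f x = g x) -> differentiable f x -> differentiable g x.
Proof.
move=> fg df; have -> : g = f + (g - f) by rewrite funeqE => y; rewrite !fctE addrC subrK.
apply: differentiableD => //; apply: near0_differentiable.
by apply: filterS fg => y; rewrite !fctE => ->; rewrite subrr.
Qed.

Lemma Ck_on_sub V W k (U U' : set V) (f : V -> W) :
  U' `<=` U -> Ck_on k U f -> Ck_on k U' f.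
Proof.
move=> sU; elim: k f => [|k IH] f /=; first by move=> cf x /sU; exact: cf.
by move=> [df cf]; split=> [x /sU|v]; [exact: df | exact: IH].
Qed.

Lemma Ck_on_eq V W k (U : set V) (f g : V -> W) :
  open U -> (forall x, U x -> f x = g x) -> Ck_on k U f -> Ck_on k U g.
Proof.
move=> oU; have nfg h h' x : (forall x, U x -> h x = h' x) -> U x -> 
    \near x, h x = h' x :> W.
  by move=> E Ux; apply: filterS (open_nbhs_nbhs (conj oU Ux)) => y /E.
elim: k f g => [|k IH] f g fg /=.
  move=> cf x Ux; have := cf x Ux; rewrite /prop_for /continuous_at -(fg x Ux).
  by apply: cvg_trans; apply: near_eq_cvg; exact: nfg.
move=> [df cf]; split=> [x Ux|v].
  by apply: near_eq_differentiable (df x Ux); exact: nfg.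
by apply: IH (cf v) => x Ux; apply: near_eq_derive; exact: nfg.
Qed.

(** [Ck_on] only collects conditions at the points of the set, with derivatives taken in the whole
    space; hence it can be checked point by point, with a set [O] that depends on the point. *)
Lemma Ck_on_local V W k (U : set V) (f : V -> W) :
  (forall x, U x -> exists2 O, O x & Ck_on k O f) -> Ck_on k U f.
Proof.
elim: k f => [|k IH] f H /=.
  by move=> x /H [B Bx] H'; exact: H'.
split=> [x /H [B Bx [df _]]|v]; first exact: df.
by apply: IH => x /H [B Bx [_ cf]]; exists B => //; exact: cf.
Qed.

Lemma Ck_onW V W k (U : set V) (f : V -> W) : Ck_on k.+1 U f -> Ck_on k U f.
Proof.
elim: k f => [|k IH] f.
  by move=> [df _] x Ux; apply: differentiable_continuous; exact: df.
by move=> [df cf]; split=> // v; apply: IH; exact: cf.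
Qed.

Lemma Ck_on_cst V W k (U : set V) (a : W) : Ck_on k U (fun=> a).
Proof.
elim: k a => [|k IH] a /=; first by move=> x _; exact: cvg_cst.
split=> [x _|v]; first exact: differentiable_cst.
have -> : (fun x : V => 'D_v (fun=> a) x) = (fun=> 0 : W); last exact: IH.
by apply/funext => x; rewrite derive_cst.
Qed.

Lemma Ck_onD V W k (U : set V) (f g : V -> W) : open U ->
  Ck_on k U f -> Ck_on k U g -> Ck_on k U (fun x => f x + g x).
Proof.
move=> oU; elim: k f g => [|k IH] f g /=.
  by move=> cf cg x Ux; apply: cvgD; [exact: cf|exact: cg].
move=> [df cf] [dg cg]; split=> [x Ux|v].
  by apply: differentiableD; [exact: df|exact: dg].
apply: (Ck_on_eq oU) (IH _ _ (cf v) (cg v)) => x Ux.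
rewrite -deriveD //; apply: diff_derivable; [exact: df|exact: dg].
Qed.

Lemma Ck_on_sum V W (I : Type) (r : seq I) (P : pred I) k (U : set V)
    (f : I -> V -> W) : open U ->
  (forall i, P i -> Ck_on k U (f i)) ->
  Ck_on k U (fun x => \sum_(i <- r | P i) f i x).
Proof.
move=> oU H; elim: r => [|i r IH].
  by apply: Ck_on_eq oU _ (Ck_on_cst k U 0) => x _; rewrite big_nil.
have [Pi|/negPf Pi] := boolP (P i).
  by apply: Ck_on_eq oU _ (Ck_onD oU (H i Pi) IH) => x _; rewrite big_cons Pi.
by apply: Ck_on_eq oU _ IH => x _; rewrite big_cons Pi.
Qed.

Lemma Ck_on_lin V W (W' : normedModType R) k (U : set V) (l : {linear W -> W'})
    (f : V -> W) : open U -> continuous l ->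
  Ck_on k U f -> Ck_on k U (fun x => l (f x)).
Proof.
move=> oU cl; elim: k f => [|k IH] f /=.
  by move=> cf x Ux; apply: (@cvg_comp _ _ _ f l _ (nbhs (f x))); [exact: cf|exact: cl].
have dl := linear_differentiable _ cl.
move=> [df cf]; split=> [x Ux|v].
  by apply: (@differentiable_comp _ _ _ _ f l); [exact: df|exact: dl].
apply: (Ck_on_eq oU) (IH _ (cf v)) => x Ux.
have dc : differentiable (l \o f) x by apply: differentiable_comp; [exact: df|exact: dl].
rewrite (deriveE v dc) diff_comp //; last exact: df.
by rewrite /= diff_lin // deriveE //; exact: df.
Qed.

Lemma Ck_onM V k (U : set V) (f g : V -> R) : open U ->
  Ck_on k U f -> Ck_on k U g -> Ck_on k U (fun x => f x * g x).
Proof.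
move=> oU; elim: k f g => [|k IH] f g.
  by move=> cf cg x Ux; apply: cvgM; [exact: cf|exact: cg].
move=> cf1 cg1; have cf0 := Ck_onW cf1; have cg0 := Ck_onW cg1.
move: cf1 cg1 => [df cf] [dg cg]; split=> [x Ux|v].
  by apply: differentiableM; [exact: df|exact: dg].
apply: (Ck_on_eq oU) (Ck_onD oU (IH _ _ cf0 (cg v)) (IH _ _ cg0 (cf v))) => x Ux.
rewrite -[LHS]/(f x *: 'D_v g x + g x *: 'D_v f x) -deriveM //.
- by apply: diff_derivable; exact: df.
- by apply: diff_derivable; exact: dg.
Qed.

Lemma Ck_onZl V W k (U : set V) (f : V -> R) (w : W) : open U ->
  Ck_on k U f -> Ck_on k U (fun x => f x *: w).
Proof.
move=> oU; elim: k f => [|k IH] f.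
  by move=> cf x Ux; apply: cvgZr_tmp; exact: cf.
move=> [df cf]; split=> [x Ux|v].
  by apply: differentiableZl; exact: df.
apply: (Ck_on_eq oU) (IH _ (cf v)) => x Ux.
have dZ : differentiable (fun y => f y *: w) x by apply: differentiableZl; exact: df.
by rewrite (deriveE _ (df x Ux)) (deriveE _ dZ) diffZl //; exact: df.
Qed.

Definition coord (p q : nat) (i : 'I_p) (j : 'I_q) (M : 'M[R]_(p, q)) : R := M i j.

Lemma coord_is_linear p q i j : linear (@coord p q i j).
Proof. by move=> a u v; rewrite /coord !mxE. Qed.
HB.instance Definition _ p q i j := GRing.isLinear.Build R 'M[R]_(p, q) R *:%R
  (@coord p q i j) (@coord_is_linear p q i j).

Lemma Ck_on_coord V k (U : set V) p q (f : V -> 'M[R]_(p, q)) i j : open U ->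
  Ck_on k U f -> Ck_on k U (fun x => f x i j).
Proof.
move=> oU cf; apply: (@Ck_on_lin _ _ _ k U (@coord p q i j) f oU _ cf).
exact: coord_continuous.
Qed.

Lemma Ck_on_mx V k (U : set V) p q (f : V -> 'M[R]_(p, q)) : open U ->
  (forall i j, Ck_on k U (fun x => f x i j)) -> Ck_on k U f.
Proof.
move=> oU cf; apply: (Ck_on_eq oU (f := fun x => \sum_i \sum_j f x i j *: delta_mx i j)).
  by move=> x _; rewrite -matrix_sum_delta.
apply: Ck_on_sum => // i _; apply: Ck_on_sum => // j _.
exact: Ck_onZl.
Qed.

(* The domain of [h] is finite-dimensional: [l] are the coordinates in the
   basis [e]. *)
Lemma Ck_on_comp V W k (U : set V) (O : set W) (f : V -> W) (h : W -> R)
    p (e : 'I_p -> W) (l : 'I_p -> {linear W -> R}) :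
  (forall i, continuous (l i)) -> (forall w, w = \sum_i l i w *: e i) ->
  open U -> (forall x, U x -> O (f x)) ->
  Ck_on k U f -> Ck_on k O h -> Ck_on k U (fun x => h (f x)).
Proof.
move=> cl eE oU UO; elim: k f h UO => [|k IH] f h UO.
  move=> cf ch x Ux; apply: (@cvg_comp _ _ _ f h _ (nbhs (f x))); first exact: cf.
  by apply: ch; exact: UO.
move=> cf1 ch1; have cf0 := Ck_onW cf1.
move: cf1 ch1 => [df cf] [dh ch].
have dc x : U x -> differentiable (h \o f) x.
  by move=> Ux; apply: differentiable_comp; [exact: df|apply: dh; exact: UO].
split=> [x Ux|v]; first exact: dc.
(* In the chain rule the direction ['D_v f x] varies with [x], while [Ck_on] controls derivatives in
   fixed directions; expanding it in the basis separates the two dependences. *)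
apply: (Ck_on_eq oU (f := fun x => \sum_i l i ('D_v f x) * 'D_(e i) h (f x))).
  move=> x Ux.
  have dfx := df x Ux; have dhx := dh _ (UO x Ux).
  rewrite (deriveE v (dc x Ux)) diff_comp //= -(deriveE v dfx).
  rewrite [in RHS](eE ('D_v f x)) linear_sum; apply: eq_bigr => i _.
  by rewrite linearZ /= (deriveE _ dhx).
apply: Ck_on_sum => // i _; apply: Ck_onM => //; last first.
  by apply: (IH f (fun y => 'D_(e i) h y)) => //; exact: ch.
apply: (@Ck_on_lin V W R k U (l i) (fun x => 'D_v f x) oU (cl i)); exact: cf.
Qed.

Lemma smooth_on_continuous V W (U : set V) (f : V -> W) :
  smooth_on U f -> forall x, U x -> {for x, continuous f}.
Proof. by move=> /(_ 0%N). Qed.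

Lemma smooth_on_differentiable V W (U : set V) (f : V -> W) :
  smooth_on U f -> forall x, U x -> differentiable f x.
Proof. by move=> /(_ 1%N) []. Qed.

Lemma smooth_on_derive V W (U : set V) (f : V -> W) v :
  smooth_on U f -> smooth_on U (fun x => 'D_v f x).
Proof. by move=> sf k; have [_ H] := sf k.+1; exact: H. Qed.

Lemma smooth_on_sub V W (U U' : set V) (f : V -> W) :
  U' `<=` U -> smooth_on U f -> smooth_on U' f.
Proof. by move=> sU sf k; exact: Ck_on_sub sU (sf k). Qed.

Lemma smooth_on_eq V W (U : set V) (f g : V -> W) :
  open U -> (forall x, U x -> f x = g x) -> smooth_on U f -> smooth_on U g.
Proof. by move=> oU fg sf k; exact: Ck_on_eq oU fg (sf k). Qed.

Lemma smooth_on_local V W (U : set V) (f : V -> W) :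
  (forall x, U x -> exists2 O, O x & smooth_on O f) -> smooth_on U f.
Proof. by move=> H k; apply: Ck_on_local => x /H [B Bx sf]; exists B. Qed.

Lemma smooth_on_cst V W (U : set V) (a : W) : smooth_on U (fun=> a).
Proof. by move=> k; exact: Ck_on_cst. Qed.

Lemma smooth_onD V W (U : set V) (f g : V -> W) : open U ->
  smooth_on U f -> smooth_on U g -> smooth_on U (fun x => f x + g x).
Proof. by move=> oU sf sg k; exact: Ck_onD. Qed.

Lemma smooth_on_sum V W (I : Type) (r : seq I) (P : pred I) (U : set V)
    (f : I -> V -> W) : open U ->
  (forall i, P i -> smooth_on U (f i)) ->
  smooth_on U (fun x => \sum_(i <- r | P i) f i x).
Proof. by move=> oU sf k; apply: Ck_on_sum => // i /sf. Qed.

Lemma smooth_onM V (U : set V) (f g : V -> R) : open U ->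
  smooth_on U f -> smooth_on U g -> smooth_on U (fun x => f x * g x).
Proof. by move=> oU sf sg k; exact: Ck_onM. Qed.

Lemma smooth_onN V (U : set V) (f : V -> R) : open U ->
  smooth_on U f -> smooth_on U (fun x => - f x).
Proof.
move=> oU sf; apply: (smooth_on_eq oU (f := fun x => -1 * f x)); last first.
  by apply: smooth_onM => //; exact: smooth_on_cst.
by move=> x _; rewrite mulN1r.
Qed.

Lemma smooth_onB V (U : set V) (f g : V -> R) : open U ->
  smooth_on U f -> smooth_on U g -> smooth_on U (fun x => f x - g x).
Proof. by move=> oU sf sg; apply: smooth_onD => //; exact: smooth_onN. Qed.

Lemma smooth_on_prod V (I : Type) (r : seq I) (P : pred I) (U : set V)
    (f : I -> V -> R) : open U ->
  (forall i, P i -> smooth_on U (f i)) ->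
  smooth_on U (fun x => \prod_(i <- r | P i) f i x).
Proof.
move=> oU H; elim: r => [|i r IH].
  apply: (smooth_on_eq (W := R) oU (f := fun=> 1)); last exact: smooth_on_cst.
  by move=> x _; rewrite big_nil.
have [Pi|/negPf Pi] := boolP (P i).
  apply: (smooth_on_eq oU (f := fun x => f i x * \prod_(i <- r | P i) f i x)).
    by move=> x _; rewrite big_cons Pi.
  by apply: smooth_onM => //; exact: H.
apply: (smooth_on_eq oU (f := fun x => \prod_(i <- r | P i) f i x)) => //.
by move=> x _; rewrite big_cons Pi.
Qed.

Lemma smooth_on_lin V W (W' : normedModType R) (U : set V)
    (l : {linear W -> W'}) (f : V -> W) : open U -> continuous l ->
  smooth_on U f -> smooth_on U (fun x => l (f x)).
Proof. by move=> oU cl sf k; exact: Ck_on_lin. Qed.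

Lemma smooth_on_coord V (U : set V) p q (f : V -> 'M[R]_(p, q)) i j : open U ->
  smooth_on U f -> smooth_on U (fun x => f x i j).
Proof. by move=> oU sf k; exact: Ck_on_coord. Qed.

Lemma smooth_on_mx V (U : set V) p q (f : V -> 'M[R]_(p, q)) : open U ->
  (forall i j, smooth_on U (fun x => f x i j)) -> smooth_on U f.
Proof. by move=> oU sf k; apply: Ck_on_mx => // i j; exact: sf. Qed.

Lemma smooth_on_comp V (U : set V) p (O : set 'rV[R]_p) (f : V -> 'rV[R]_p)
    (h : 'rV[R]_p -> R) : open U -> (forall x, U x -> O (f x)) ->
  smooth_on U f -> smooth_on O h -> smooth_on U (fun x => h (f x)).
Proof.
move=> oU UO sf sh k.
apply: (@Ck_on_comp _ _ k U O f h p (fun i => delta_mx 0 i) (fun i => @coord 1 p 0 i)) => //.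
- by move=> i; exact: coord_continuous.
- by move=> w; rewrite [w in LHS]row_sum_delta.
Qed.

Lemma smooth_on_comp_mx V (U : set V) p q r (O : set 'rV[R]_p) (f : V -> 'rV[R]_p)
    (h : 'rV[R]_p -> 'M[R]_(q, r)) : open U -> open O -> (forall x, U x -> O (f x)) ->
  smooth_on U f -> smooth_on O h -> smooth_on U (fun x => h (f x)).
Proof.
move=> oU oO UO sf sh; apply: smooth_on_mx => // i j.
apply: (@smooth_on_comp _ U p O f (fun y => h y i j)) => //.
exact: smooth_on_coord.
Qed.

Lemma smooth_on_compR V (U : set V) (O : set R) (f : V -> R) (h : R -> R) :
  open U -> (forall x, U x -> O (f x)) ->
  smooth_on U f -> smooth_on O h -> smooth_on U (fun x => h (f x)).
Proof.
move=> oU UO sf sh k.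
apply: (@Ck_on_comp _ _ k U O f h 1%N (fun=> 1) (fun=> idfun)) => //.
  by move=> _ x; exact: cvg_id.
by move=> w; rewrite big_ord1 /= /GRing.scale /= mulr1.
Qed.

Lemma smooth_on_id V (U : set V) : smooth_on U (fun x => x).
Proof.
move=> [|k]; first by move=> x _; exact: cvg_id.
split=> [x _|v]; first by apply: (@linear_differentiable _ _ _ idfun) => y; exact: cvg_id.
have -> : (fun x : V => 'D_v (fun y => y) x) = (fun=> v : V); last exact: Ck_on_cst.
by apply/funext => x; rewrite derive_id.
Qed.

(** The derivative of 1/f is -f'/f^2: it costs one more derivative of [f], which is smooth to all
    orders, but contains 1/f only to the order already treated. *)
Lemma smooth_onV V (U : set V) (f : V -> R) : open U ->
  (forall x, U x -> f x != 0) ->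
  smooth_on U f -> smooth_on U (fun x => (f x)^-1).
Proof.
move=> oU f0 sf; elim=> [|k IH].
  move=> x Ux; apply: cvgV; first exact: f0.
  by have := sf 0%N; apply.
have df := smooth_on_differentiable sf.
split=> [x Ux|v]; first by apply: differentiableV; [exact: df|exact: f0].
apply: (Ck_on_eq oU (f := fun x => (-1) * ('D_v f x * ((f x)^-1 * (f x)^-1)))).
  move=> x Ux; rewrite deriveV; [|exact: f0|by apply: diff_derivable; exact: df].
  by rewrite mulN1r [RHS]/GRing.scale /= mulNr -exprVn expr2 mulrC.
apply: Ck_onM => //; first exact: Ck_on_cst.
apply: Ck_onM => //; last exact: Ck_onM.
exact: smooth_on_derive.
Qed.

Lemma smooth_on_mulmx V (U : set V) p q r (A : V -> 'M[R]_(p, q))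
    (B : V -> 'M[R]_(q, r)) : open U ->
  smooth_on U A -> smooth_on U B -> smooth_on U (fun x => A x *m B x).
Proof.
move=> oU sA sB; apply: smooth_on_mx => // i j.
apply: (smooth_on_eq oU (f := fun x => \sum_k A x i k * B x k j)).
  by move=> x _; rewrite mxE.
by apply: smooth_on_sum => // k _; apply: smooth_onM => //; exact: smooth_on_coord.
Qed.

Lemma smooth_on_trmx V (U : set V) p q (A : V -> 'M[R]_(p, q)) : open U ->
  smooth_on U A -> smooth_on U (fun x => (A x)^T).
Proof.
move=> oU sA; apply: smooth_on_mx => // i j.
apply: (smooth_on_eq oU (f := fun x => A x j i)); last exact: smooth_on_coord.
by move=> x _; rewrite mxE.
Qed.

Lemma smooth_on_det V (U : set V) p (A : V -> 'M[R]_p) : open U ->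
  smooth_on U A -> smooth_on U (fun x => \det (A x)).
Proof.
move=> oU sA; apply: smooth_on_sum => // s _.
apply: smooth_onM => //; first exact: smooth_on_cst.
by apply: smooth_on_prod => // i _; exact: smooth_on_coord.
Qed.

(** By Cramer's rule the entries of the inverse are cofactors divided by the determinant. *)
Lemma smooth_on_invmx V (U : set V) p (A : V -> 'M[R]_p) : open U ->
  (forall x, U x -> A x \in unitmx) ->
  smooth_on U A -> smooth_on U (fun x => invmx (A x)).
Proof.
move=> oU uA sA; apply: smooth_on_mx => // i j.
apply: (smooth_on_eq oU (f := fun x => (\det (A x))^-1 * ((-1) ^+ (j + i) *
    \det (row' j (col' i (A x)))))).
  by move=> x Ux; rewrite /invmx uA // !mxE.
apply: smooth_onM => //.
  apply: smooth_onV => //; last exact: smooth_on_det.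
  by move=> x /uA; rewrite unitmxE unitfE.
apply: smooth_onM => //; first exact: smooth_on_cst.
apply: smooth_on_det => //; apply: smooth_on_mx => // a b.
apply: (smooth_on_eq oU (f := fun x => A x (lift j a) (lift i b))).
  by move=> x _; rewrite !mxE.
exact: smooth_on_coord.
Qed.

Lemma smooth_on_row_mx V (U : set V) p q r (A : V -> 'M[R]_(p, q))
    (B : V -> 'M[R]_(p, r)) : open U ->
  smooth_on U A -> smooth_on U B -> smooth_on U (fun x => row_mx (A x) (B x)).
Proof.
move=> oU sA sB; apply: smooth_on_mx => // i j.
case: (split_ordP j) => a ->.
  apply: (smooth_on_eq oU (f := fun x => A x i a)); last exact: smooth_on_coord.
  by move=> x _; rewrite row_mxEl.
apply: (smooth_on_eq oU (f := fun x => B x i a)); last exact: smooth_on_coord.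
by move=> x _; rewrite row_mxEr.
Qed.

Lemma smooth_on_col_mx V (U : set V) p q r (A : V -> 'M[R]_(p, q))
    (B : V -> 'M[R]_(r, q)) : open U ->
  smooth_on U A -> smooth_on U B -> smooth_on U (fun x => col_mx (A x) (B x)).
Proof.
move=> oU sA sB.
apply: (smooth_on_eq oU (f := fun x => (row_mx (A x)^T (B x)^T)^T)).
  by move=> x _; rewrite tr_row_mx !trmxK.
apply: smooth_on_trmx => //; apply: smooth_on_row_mx => //; exact: smooth_on_trmx.
Qed.

Lemma smooth_on_lsubmx V (U : set V) p q r (A : V -> 'M[R]_(p, q + r)) : open U ->
  smooth_on U A -> smooth_on U (fun x => lsubmx (A x)).
Proof.
move=> oU sA; apply: smooth_on_mx => // i j.
apply: (smooth_on_eq oU (f := fun x => A x i (lshift r j))).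
  by move=> x _; rewrite mxE.
exact: smooth_on_coord.
Qed.

End SmoothCalculus.

(** * Symmetry of second derivatives and pullback of exterior derivatives *)

Section Schwarz.
Variable R : realType.

Lemma derive_along_line (V : normedModType R) (f : V -> R) (x u : V) (s : R) :
  differentiable f (x + s *: u) ->
  is_derive s 1 (fun r : R => f (x + r *: u)) ('D_u f (x + s *: u)).
Proof.
move=> df; have E : (fun h : R => h^-1 *: (f (x + (h *: 1 + s) *: u) - f (x + s *: u))) =
    (fun h : R => h^-1 *: (f (h *: u + (x + s *: u)) - f (x + s *: u))).
  apply/funext => h; congr (_ *: (f _ - _)).
  by rewrite scalerDl [h *: 1]mulr1 addrCA.
have dd : derivable f (x + s *: u) u by exact: diff_derivable.
apply: DeriveDef; first by move: dd; rewrite /derivable E.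
by rewrite /derive E.
Qed.

Lemma MVT_closed (g dg : R -> R) (h : R) : 0 < h ->
  (forall s, 0 <= s <= h -> is_derive s 1 g (dg s)) ->
  exists2 s, 0 <= s <= h & g h - g 0 = dg s * h.
Proof.
move=> h0 H; have [||s sI] := @MVT R g dg 0 h h0.
- by move=> s; rewrite in_itv /= => /andP[s0 sh]; apply: H; rewrite !ltW.
- apply: derivable_within_continuous => s; rewrite in_itv /= => /H [].
  by [].
rewrite subr0 => E; exists s => //.
by move: sI; rewrite in_itv /= => /andP[s0 sh]; rewrite !ltW.
Qed.

(** The mean value theorem is used twice: along [u] for the difference of [f] on two parallel
    segments, then along [v] for ['D_u f]. *)
Lemma second_difference (V : normedModType R) (f : V -> R) (U : set V) (x u v : V) (h : R) :
  open U -> smooth_on U f -> 0 < h ->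
  (forall s t, 0 <= s <= h -> 0 <= t <= h -> U (x + s *: u + t *: v)) ->
  exists s t, [/\ 0 <= s <= h, 0 <= t <= h &
    f (x + h *: u + h *: v) - f (x + h *: u) - (f (x + h *: v) - f x) =
    'D_v (fun y => 'D_u f y) (x + s *: u + t *: v) * h * h].
Proof.
move=> oU sf h0 HU.
have hh : 0 <= h <= h by rewrite lexx ltW.
have h00 : 0 <= (0 : R) <= h by rewrite lexx ltW.
have HU0 s : 0 <= s <= h -> U (x + s *: u).
  by move=> sh; have := HU s 0 sh h00; rewrite scale0r addr0.
have df := smooth_on_differentiable sf.
pose g s := f (x + h *: v + s *: u) - f (x + s *: u).
pose dg s := 'D_u f (x + h *: v + s *: u) - 'D_u f (x + s *: u).
have [s sh] : exists2 s, 0 <= s <= h & g h - g 0 = dg s * h.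
  apply: MVT_closed => // s sh.
  by apply: is_deriveB; apply: derive_along_line; apply: df; rewrite 1?addrAC;
    [exact: HU | exact: HU0].
have [t th] : exists2 t, 0 <= t <= h & 'D_u f (x + s *: u + h *: v) -
    'D_u f (x + s *: u + 0 *: v) = 'D_v (fun y => 'D_u f y) (x + s *: u + t *: v) * h.
  apply: (MVT_closed (g := fun t => 'D_u f (x + s *: u + t *: v))
    (dg := fun t => 'D_v (fun y => 'D_u f y) (x + s *: u + t *: v))); first exact: h0.
  move=> t th.
  apply: (derive_along_line (f := fun y => 'D_u f y)).
  by apply: (smooth_on_differentiable (smooth_on_derive u sf)); exact: HU.
rewrite scale0r addr0 => E1 E2.
exists s, t; split => //; rewrite -E1.
move: E2; rewrite /g /dg !scale0r !addr0 [x + h *: v + h *: u]addrAC.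
by rewrite [x + h *: v + s *: u]addrAC => ->.
Qed.

(** The second difference is symmetric in [u] and [v], so on every small parallelogram at [x] some
    value of one mixed derivative equals some value of the other. If they differed at [x],
    continuity would keep these values apart. *)
Lemma derive_sym (V : normedModType R) (f : V -> R) (U : set V) (x u v : V) :
  open U -> smooth_on U f -> U x ->
  'D_u (fun y => 'D_v f y) x = 'D_v (fun y => 'D_u f y) x.
Proof.
move=> oU sf Ux; apply/eqP/negPn/negP => ne.
have [A defA] : exists A : V -> R, A = (fun y => 'D_u (fun y => 'D_v f y) y) by eexists; reflexivity.
have [B defB] : exists B : V -> R, B = (fun y => 'D_v (fun y => 'D_u f y) y) by eexists; reflexivity.
have {}ne : A x != B x by rewrite defA defB.
have cA : A y @[y --> x] --> A x.
  rewrite defA.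
  exact: (smooth_on_continuous (smooth_on_derive u (smooth_on_derive v sf))).
have cB : B y @[y --> x] --> B x.
  rewrite defB.
  exact: (smooth_on_continuous (smooth_on_derive v (smooth_on_derive u sf))).
pose e := `|A x - B x| / 2.
have e0 : 0 < e by rewrite divr_gt0 // normr_gt0 subr_eq0.
have /cvgrPdist_lt /(_ e e0) nA := cA.
have /cvgrPdist_lt /(_ e e0) nB := cB.
have nU : \near x, U x by exact: open_nbhs_nbhs.
have : nbhs x [set y | [/\ U y, `|A x - A y| < e & `|B x - B y| < e]].
  by apply: filterS (filterI nU (filterI nA nB)) => y [? [? ?]].
move=> /nbhs_ballP [r r0 Hr].
(* At this scale the whole parallelogram stays within distance [r] of [x]; the summand 1 keeps the
   denominator positive. *)
pose h := r / (`|u| + `|v| + 1).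
have c0 : 0 < `|u| + `|v| + 1 by rewrite ltr_pwDr // addr_ge0.
have h0 : 0 < h by rewrite divr_gt0.
have Hb s t : 0 <= s <= h -> 0 <= t <= h -> ball x r (x + s *: u + t *: v).
  move=> /andP[s0 sh] /andP[t0 th].
  rewrite -ball_normE /= opprD addrA opprD addrA subrr add0r -opprD normrN.
  apply: (le_lt_trans (ler_normD _ _)).
  rewrite !normrZ (ger0_norm s0) (ger0_norm t0).
  apply: (@le_lt_trans _ _ (h * (`|u| + `|v|))).
    by rewrite mulrDr lerD // ler_wpM2r.
  rewrite -[ltRHS](divfK (lt0r_neq0 c0)) -/h ltr_pM2l // ltrDl //.
have [s [t [sh th E1]]] : exists s t, [/\ 0 <= s <= h, 0 <= t <= h &
    f (x + h *: u + h *: v) - f (x + h *: u) - (f (x + h *: v) - f x) =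
    B (x + s *: u + t *: v) * h * h].
  rewrite defB; apply: (second_difference oU) => // s t sh th.
  by have [] := Hr _ (Hb s t sh th).
have [t' [s' [th' sh' E2]]] : exists s t, [/\ 0 <= s <= h, 0 <= t <= h &
    f (x + h *: v + h *: u) - f (x + h *: v) - (f (x + h *: u) - f x) =
    A (x + s *: v + t *: u) * h * h].
  rewrite defA; apply: (second_difference oU) => // s' t' sh' th'.
  by rewrite addrAC; have [] := Hr _ (Hb _ _ th' sh').
have E : A (x + t' *: v + s' *: u) = B (x + s *: u + t *: v).
  apply: (mulIf (lt0r_neq0 h0)); apply: (mulIf (lt0r_neq0 h0)).
  rewrite -E1 -E2 [x + h *: v + h *: u]addrAC.
  move: (f (x + h *: u + h *: v)) (f (x + h *: u)) (f (x + h *: v)) (f x).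
  by move=> a b c d; ring.
have [_ _ HB] := Hr _ (Hb s t sh th).
have [_ HA _] := Hr _ (Hb s' t' sh' th').
move: HA HB; rewrite /= [x + s' *: u + _]addrAC E => HA HB.
have : `|A x - B x| < e + e.
  rewrite -(subrKA (B (x + s *: u + t *: v))).
  by apply: (le_lt_trans (ler_normD _ _)); rewrite ltrD // distrC.
by rewrite -splitr ltxx.
Qed.

End Schwarz.

Section ExteriorDerivative.
Variable R : realType.

(** [ext_d eta c] unfolds to [extd (eta c)]; here the form is a bare family on coordinate space, so
    that pullbacks can be inserted. *)
Definition extd n (w : 'rV[R]_n -> 'rV[R]_n -> R) (x u v : 'rV[R]_n) : R :=
  'D_u (fun y => w y v) x - 'D_v (fun y => w y u) x.

Lemma extd_eq n (U : set 'rV[R]_n) (w w' : 'rV[R]_n -> 'rV[R]_n -> R) x u v :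
  open U -> U x -> (forall y v, U y -> w y v = w' y v) ->
  extd w x u v = extd w' x u v.
Proof.
move=> oU Ux E; have N v' : \near x, w x v' = w' x v'.
  by apply: filterS (open_nbhs_nbhs (conj oU Ux)) => y /E.
by rewrite /extd; congr (_ - _); apply: near_eq_derive; exact: N.
Qed.

Lemma derive_coord n p (f : 'rV[R]_n -> 'rV[R]_p) x v i :
  differentiable f x -> 'D_v f x 0 i = 'D_v (fun y => f y 0 i) x.
Proof. by move=> df; rewrite derive_mx ?mxE //; exact: diff_derivable. Qed.

Section Pullback.
Variables (n p : nat) (U : set 'rV[R]_n) (O : set 'rV[R]_p).
Variables (tau : 'rV[R]_n -> 'rV[R]_p) (w : 'rV[R]_p -> 'rV[R]_p -> R).
Hypotheses (oU : open U) (oO : open O) (tauU : forall x, U x -> O (tau x)).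
Hypotheses (stau : smooth_on U tau) (linw : forall y, O y -> scalar (w y)).
Hypothesis sw : forall v, smooth_on O (fun y => w y v).

Let w_sum y v : O y -> w y v = \sum_i v 0 i * w y (delta_mx 0 i).
Proof.
move=> Oy; pose wl : {linear 'rV[R]_p -> R} :=
  HB.pack (w y) (GRing.isLinear.Build R 'rV[R]_p R *%R (w y) (linw Oy)).
rewrite -[LHS]/(wl v) [in LHS](row_sum_delta v) linear_sum.
by apply: eq_bigr => i _; rewrite linearZ.
Qed.

Let derive_pullback x u v : U x ->
  'D_u (fun y => w (tau y) ('d tau y v)) x =
  \sum_i w (tau x) (delta_mx 0 i) * 'D_u (fun y => 'D_v (fun z => tau z 0 i) y) x
  + 'D_('d tau x u) (fun z => w z ('d tau x v)) (tau x).
Proof.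
move=> Ux; have dtau := smooth_on_differentiable stau.
have Ox := tauU Ux.
have stc i : smooth_on U (fun z => tau z 0 i) by exact: smooth_on_coord.
have swt i : smooth_on U (fun y => w (tau y) (delta_mx 0 i)).
  by apply: (smooth_on_comp oU tauU stau (h := fun z => w z (delta_mx 0 i))).
pose F i y := 'D_v (fun z => tau z 0 i) y * w (tau y) (delta_mx 0 i).
have -> : 'D_u (fun y => w (tau y) ('d tau y v)) x = 'D_u (\sum_i F i) x.
  apply: near_eq_derive; apply: filterS (open_nbhs_nbhs (conj oU Ux)) => y Uy.
  rewrite w_sum; last exact: tauU.
  rewrite fct_sumE; apply: eq_bigr => i _; rewrite /F -deriveE; last exact: dtau.
  by rewrite derive_coord //; exact: dtau.
have -> : 'D_('d tau x u) (fun z => w z ('d tau x v)) (tau x) =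
    'D_('d tau x u) (\sum_i (fun z => ('d tau x v) 0 i * w z (delta_mx 0 i))) (tau x).
  apply: near_eq_derive; apply: filterS (open_nbhs_nbhs (conj oO Ox)) => y Oy.
  by rewrite w_sum // fct_sumE.
have dw i : differentiable (fun z => w z (delta_mx 0 i)) (tau x).
  by apply: smooth_on_differentiable (sw _) _ Ox.
have dsv i : differentiable (fun y => 'D_v (fun z => tau z 0 i) y) x.
  exact: smooth_on_differentiable (smooth_on_derive v (stc i)) _ Ux.
have dwt i : differentiable (fun y => w (tau y) (delta_mx 0 i)) x.
  exact: smooth_on_differentiable (swt i) _ Ux.
rewrite !derive_sum; last 2 first.
- by move=> i; apply: derivableM; [exact: derivable_cst|exact: diff_derivable].
- by move=> i; apply: derivableM; exact: diff_derivable.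
rewrite -big_split /=; apply: eq_bigr => i _.
rewrite deriveM; [|exact: diff_derivable|exact: diff_derivable].
rewrite deriveM; [|exact: derivable_cst|exact: diff_derivable].
rewrite derive_cst scaler0 addr0 addrC; congr (_ + _).
have -> : 'D_u (fun y => w (tau y) (delta_mx 0 i)) x =
    'D_('d tau x u) (fun z => w z (delta_mx 0 i)) (tau x).
  rewrite !deriveE //.
  by rewrite (diff_comp (f := tau) (g := fun z => w z (delta_mx 0 i))) //; exact: dtau.
by congr (_ *: _); rewrite -derive_coord ?deriveE //; exact: dtau.
Qed.

(** The second derivatives of [tau] enter through a term symmetric in [u] and [v], which cancels in
    the antisymmetrization; the chain rule accounts for the rest. *)
Lemma extd_pullback x u v : U x ->
  extd (fun y v => w (tau y) ('d tau y v)) x u v =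
  extd w (tau x) ('d tau x u) ('d tau x v).
Proof.
move=> Ux; rewrite /extd !derive_pullback // opprD addrACA -sumrB big1 ?add0r //.
move=> i _; rewrite -mulrBr (derive_sym u v oU _ Ux) ?subrr ?mulr0 //.
exact: smooth_on_coord.
Qed.

End Pullback.
End ExteriorDerivative.

(** * Bump functions *)

Section Bump.
Variable R : realType.

(** The powers of 1/x in front of exp(-1/x) make the linear span of this family closed under
    differentiation, so smoothness follows by induction for all [n] together. *)
Definition flat (n : nat) (x : R) : R :=
  if 0 < x then x^-1 ^+ n * expR (- x^-1) else 0.

(** This is e^t >= t^(n+2)/(n+2)! at t = 1/x. The exponent n+2 leaves a factor x^2, which makes the
    difference quotient at 0 tend to 0. *)
Lemma flat_bound n x : `|flat n x| <= n.+2`!%:R * x ^+ 2.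
Proof.
rewrite /flat; case: ifP => [x0|_]; last first.
  by rewrite normr0 mulr_ge0 // sqr_ge0.
have i0 : 0 < x^-1 by rewrite invr_gt0.
rewrite ger0_norm; last by rewrite mulr_ge0 ?expR_ge0 // exprn_ge0 // ltW.
have := expR_ge1Dxn n.+1 (ltW i0).
rewrite expRN -ler_pdivlMr ?invr_gt0 ?expR_gt0 // invrK => E.
have f0 : 0 < n.+2`!%:R :> R by rewrite ltr0n fact_gt0.
apply: (@le_trans _ _ (n.+2`!%:R * x ^+ 2 * (x^-1 ^+ n.+2 / n.+2`!%:R))); last first.
  rewrite ler_pM2l; first by apply: le_trans E; rewrite ler_wpDl.
  by rewrite mulr_gt0 // exprn_gt0.
rewrite le_eqVlt; apply/orP; left; apply/eqP; rewrite !exprS expr0.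
move: f0 (x^-1 ^+ n) => /lt0r_neq0; move: n.+2`!%:R => N N0 t.
by field; rewrite N0 gt_eqF.
Qed.

Lemma is_derive_inv (x : R) : x != 0 -> is_derive x 1 (fun y : R => y^-1) (- x^-1 ^+ 2).
Proof.
move=> x0; have did : derivable (@id R) x 1 by exact: derivable_id.
apply: DeriveDef; first exact: (derivableV (f := id)).
by rewrite (deriveV (f := id)) // derive_id -exprVn; exact: mulr1.
Qed.

Lemma flat_derive n (x : R) : is_derive x 1 (flat n) (flat n.+2 x - n%:R * flat n.+1 x).
Proof.
have [x0|x0|x0] := ltgtP 0 x; last first.
- rewrite -{x}x0. have -> : flat n.+2 0 - n%:R * flat n.+1 0 = 0 by rewrite /flat ltxx mulr0 subrr.
  have L : h^-1 *: (flat n (h *: 1 + 0) - flat n 0) @[h --> 0^'] --> (0 : R).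
    apply/cvgrPdist_le => e e0.
    have c0 : 0 < n.+2`!%:R :> R by rewrite ltr0n fact_gt0.
    have d0 : 0 < e / n.+2`!%:R by rewrite divr_gt0.
    near=> h.
    rewrite sub0r normrN normrM normfV {2}/flat ltxx subr0 addr0 [h *: 1]mulr1.
    have h0 : h != 0 by near: h; exact: nbhs_dnbhs_neq.
    have hs : `|h| <= e / n.+2`!%:R by apply: ltW; near: h; exact: dnbhs0_lt.
    rewrite mulrC ler_pdivrMr ?normr_gt0 //.
    apply: (le_trans (flat_bound n h)).
    rewrite -(ger0_norm (sqr_ge0 h)) normrX expr2 mulrA ler_wpM2r //.
    by rewrite mulrC -ler_pdivlMr.
  apply: DeriveDef; first by apply/cvg_ex; exists 0.
  exact: (cvg_lim _ L).
- have -> : flat n.+2 x - n%:R * flat n.+1 x = 0.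
    by rewrite /flat ltNge (ltW x0) /= mulr0 subrr.
  apply: (near_eq_is_derive (f := cst (0 : R))).
  near=> y; rewrite /flat ltNge; have -> : y <= 0; last by [].
  by apply: ltW; near: y; apply: lt_nbhsl.
- have xn : x != 0 by rewrite gt_eqF.
  have Di := is_derive_inv xn.
  have De : is_derive x 1 (fun y => expR (- y^-1)) (expR (- x^-1) * x^-1 ^+ 2).
    have dn : derivable (fun y : R => - y^-1) x 1.
      by apply: derivableN; exact: ex_derive.
    have dnv : derive1 (fun y : R => - y^-1) x = x^-1 ^+ 2.
      have [_ E] : is_derive x 1 (fun y : R => - y^-1) (- (- x^-1 ^+ 2)).
        exact: is_deriveN.
      by rewrite derive1E E opprK.
    have E := derive1_comp dn (@derivable_expR R (- x^-1)).
    apply: DeriveDef.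
      apply/derivable1_diffP; apply: (differentiable_comp (f := fun y : R => - y^-1)).
        exact/derivable1_diffP.
      apply/derivable1_diffP; exact: derivable_expR.
    rewrite -derive1E; move: E; rewrite dnv /comp => ->.
    by rewrite derive1E; have [_ ->] := is_derive_expR (- x^-1).
  have Dx : is_derive x 1 ((fun y => y^-1) ^+ n) (n%:R * x^-1 ^+ n.-1 *: (- x^-1 ^+ 2)).
    exact: is_deriveX.
  apply: (near_eq_is_derive (f := ((fun y => y^-1) ^+ n) * (fun y => expR (- y^-1)))).
    near=> y; rewrite /flat; have -> : 0 < y by near: y; exact: lt_nbhsr.
    by rewrite fctE exprfctE.
  apply: is_derive_eq; rewrite /flat x0 exprfctE.
  rewrite /GRing.scale /=; case: (n) => [|m] /=.
    by rewrite !mul0r mulr0 addr0 subr0 !expr0 mul1r mulrC.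
  by rewrite !exprS; ring.
Unshelve. all: by end_near. Qed.

Lemma flat_smooth n : smooth_on setT (flat n).
Proof.
move=> k; have oT : open [set: R] by exact: openT.
elim: k n => [|k IH] n.
  move=> x _; apply: differentiable_continuous; apply/derivable1_diffP.
  by have [] := flat_derive n x.
have df x : differentiable (flat n) x.
  by apply/derivable1_diffP; have [] := flat_derive n x.
split=> [x _|v]; first exact: df.
apply: (Ck_on_eq oT (f := fun x => v * (flat n.+2 x + (- n%:R) * flat n.+1 x))).
  move=> x _; rewrite (deriveE _ (df x)) -[v in RHS]mulr1 -[v * 1]/(v *: 1) linearZ /=.
  rewrite -(deriveE _ (df x)); have [_ ->] := flat_derive n x.
  by rewrite mulNr.
apply: Ck_onM => //; first exact: Ck_on_cst.
by apply: Ck_onD => //; apply: Ck_onM => //; exact: Ck_on_cst.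
Qed.

Lemma flat_gt0 x : 0 < x -> 0 < flat 0 x.
Proof. by move=> x0; rewrite /flat x0 expr0 mul1r expR_gt0. Qed.

Lemma flat_le0 n x : x <= 0 -> flat n x = 0.
Proof. by move=> x0; rewrite /flat ltNge x0. Qed.

Lemma flat_ge0 x : 0 <= flat 0 x.
Proof. by rewrite /flat; case: ifP => // _; rewrite expr0 mul1r expR_ge0. Qed.

Lemma smooth_step (a b : R) : a < b -> exists h : R -> R,
  [/\ smooth_on setT h, forall t, t <= a -> h t = 1 & forall t, b <= t -> h t = 0].
Proof.
move=> ab; have oT : open [set: R] by exact: openT.
(* Since [a < b], every [t] satisfies [t < b] or [a < t], so one of the two summands is positive. *)
have d0 t : flat 0 (b - t) + flat 0 (t - a) != 0.
  rewrite gt_eqF //; have [tb|bt] := ltP t b.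
    by rewrite ltr_pwDl ?flat_ge0 // flat_gt0 // subr_gt0.
  by rewrite ltr_wpDl ?flat_ge0 // flat_gt0 // subr_gt0 (lt_le_trans ab).
exists (fun t => flat 0 (b - t) * (flat 0 (b - t) + flat 0 (t - a))^-1); split.
- have s1 : smooth_on setT (fun t => flat 0 (b - t)).
    apply: (smooth_on_compR (O := setT)) => //; last exact: flat_smooth.
    by apply: smooth_onB => //; [exact: smooth_on_cst|exact: smooth_on_id].
  have s2 : smooth_on setT (fun t => flat 0 (t - a)).
    apply: (smooth_on_compR (O := setT)) => //; last exact: flat_smooth.
    by apply: smooth_onB => //; [exact: smooth_on_id|exact: smooth_on_cst].
  apply: smooth_onM => //; apply: smooth_onV => //.
  exact: smooth_onD.
- move=> t ta; move: (d0 t); rewrite (flat_le0 _ (x := t - a)) ?subr_le0 //.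
  by rewrite addr0 => ?; rewrite mulfV.
- by move=> t bt; rewrite flat_le0 ?mul0r // subr_le0.
Qed.

Lemma ler_mx_norm p q (A : 'M[R]_(p, q)) i j : `|A i j| <= `|A|.
Proof.
by rewrite [leRHS]/Num.Def.normr /= mx_normrE; exact: (le_bigmax _ (fun k => `|A k.1 k.2|) (i, j)).
Qed.

Lemma mx_norm_attained p q (A : 'M[R]_(p, q)) r : 0 < r -> r <= `|A| ->
  exists i j, r <= `|A i j|.
Proof.
move=> r0 rA; have n0 : mx_norm A != 0 by rewrite gt_eqF // (lt_le_trans r0).
have [[i j] E] := mx_norm_neq0 n0.
by exists i, j; apply: le_trans rA _; rewrite [leLHS]/Num.Def.normr /= E.
Qed.

(** The norm of row vectors is the maximum norm: balls are cubes, and a product of one-variable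
    steps does. The steps are applied to squares, as the absolute value is not smooth. *)
Lemma smooth_bump n (x0 : 'rV[R]_n) (r : R) : 0 < r -> exists B : 'rV[R]_n -> R,
  [/\ smooth_on setT B, forall x, `|x - x0| <= r -> B x = 1 &
      forall x, 2 * r <= `|x - x0| -> B x = 0].
Proof.
move=> r0; have oT : open [set: 'rV[R]_n] by exact: openT.
have [|h [sh h1 h0]] := @smooth_step (r ^+ 2) ((2 * r) ^+ 2).
  by rewrite ltr_sqr ?nnegrE ?mulr_ge0 ?ltW // ltr_pMl // ltr1n.
exists (fun x => \prod_i h ((x 0 i - x0 0 i) ^+ 2)); split.
- apply: smooth_on_prod => // i _.
  have sx : smooth_on setT (fun x : 'rV[R]_n => x 0 i - x0 0 i).
    apply: smooth_onB => //; last exact: smooth_on_cst.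
    by apply: smooth_on_coord => //; exact: smooth_on_id.
  by apply: (smooth_on_compR (O := setT)) => //; exact: smooth_onM.
- move=> x xr; apply: big1 => i _; apply: h1.
  rewrite -(real_normK (num_real _)) ler_sqr ?nnegrE ?(ltW r0) //.
  by apply: le_trans xr; have := ler_mx_norm (x - x0) 0 i; rewrite !mxE.
- move=> x rx; have [|i [j]] := mx_norm_attained _ rx; first by rewrite mulr_gt0.
  rewrite !mxE ord1 => rj; apply/eqP; rewrite prodf_seq_eq0; apply/hasP.
  exists j; rewrite ?mem_index_enum //=; apply/eqP; apply: h0.
  by rewrite -[leRHS](real_normK (num_real _)) ler_sqr ?nnegrE ?mulr_ge0 ?(ltW r0).
Qed.

End Bump.

(** * Top exterior powers of a symplectic form *)

Section WedgeNonzero.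
Variables (R : realType) (V : lmodType R).

(** The equality of signs is an equality of determinants: the permutation matrix of [s] is block
    diagonal with an identity block. *)
Lemma perm_block_sign p q (s : 'S_(p + q)) :
  (forall i, s (lshift q i) = lshift q i) ->
  exists t : 'S_q, (forall j, s (rshift p j) = rshift p (t j)) /\
    (-1) ^+ s = (-1) ^+ t :> R.
Proof.
move=> sl; have H j : {t | s (rshift p j) = rshift p t}.
  case: (split_ordP (s (rshift p j))) => [i E|t E]; last by exists t.
  by move: E; rewrite -[lshift q i]sl => /perm_inj /eqP; rewrite eq_rlshift.
have tinj : injective (fun j => sval (H j)).
  move=> j j' E; apply: (@rshift_inj p q); apply: (@perm_inj _ s).
  by rewrite (svalP (H j)) (svalP (H j')) E.
have sr j : s (rshift p j) = rshift p (perm tinj j).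
  by rewrite permE; exact: svalP (H j).
exists (perm tinj); split=> //.
rewrite -!det_perm.
suff -> : perm_mx s = block_mx 1%:M 0 0 (perm_mx (perm tinj)) :> 'M[R]_(p + q).
  by rewrite det_ublock det1 mul1r.
apply/matrixP => i j; rewrite !mxE.
case: (split_ordP i) => a ->; rewrite ?(unsplitK (inl a)) ?(unsplitK (inr a)) /=
  ?sl ?sr !mxE; case: (split_ordP j) => b ->;
  rewrite ?(unsplitK (inl b)) ?(unsplitK (inr b)) /= !mxE.
- by rewrite eq_lshift.
- by rewrite eq_lrshift.
- by rewrite eq_rlshift.
- by rewrite eq_rshift.
Qed.

Lemma wedge_alt p q (a : ('I_p -> V) -> R) (b : ('I_q -> V) -> R)
    (v : 'I_(p + q) -> V) (t : 'S_(p + q)) :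
  wedge a b (v \o t) = (-1) ^+ t * wedge a b v.
Proof.
rewrite /wedge mulrCA; congr (_ * _); rewrite mulr_sumr.
rewrite (reindex_inj (mulIg (t^-1)%g)) /=; apply: eq_bigr => s _.
have E1 i : (s * t^-1 * t)%g i = s i by rewrite mulgKV.
have -> : (fun i => v (t ((s * t^-1)%g (lshift q i)))) = (fun i => v (s (lshift q i))).
  by apply/funext => i; rewrite -permM E1.
have -> : (fun i => v (t ((s * t^-1)%g (rshift p i)))) = (fun i => v (s (rshift p i))).
  by apply/funext => i; rewrite -permM E1.
rewrite odd_permM odd_permV signr_addb.
by move: ((-1) ^+ s) ((-1) ^+ t) (a _) (b _) => *; ring.
Qed.

Lemma wedge_pow2_alt (b : ('I_2 -> V) -> R) k (v : 'I_(k * 2) -> V) (t : 'S_(k * 2)) :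
  wedge_pow2 b (v \o t) = (-1) ^+ t * wedge_pow2 b v.
Proof.
case: k v t => [|k] v t /=; last exact: (wedge_alt (p := 2) (q := k * 2)).
by rewrite (_ : t = 1%g) ?odd_perm1 ?mul1r //; apply/permP => -[].
Qed.

(* The Gram matrix of a symplectic basis e_1, f_1, e_2, f_2, ... *)
Definition symp (i j : nat) : R :=
  if odd i then - (i == j.+1)%:R else (j == i.+1)%:R.

(** Exchanges 0 with 2i and 1 with 2i+1. It respects the pairing of each even number with its
    successor and therefore leaves [symp] invariant. *)
Definition swap_pair (i m : nat) : nat :=
  if m == 0 then i.*2 else if m == i.*2 then 0
  else if m == 1 then i.*2.+1 else if m == i.*2.+1 then 1 else m.

Lemma swap_pair_odd i m : odd (swap_pair i m) = odd m.
Proof. by rewrite /swap_pair; do !case: eqP => [->|_] //; rewrite /= odd_double. Qed.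

Lemma swap_pair_succ i m m' : ~~ odd m ->
  (swap_pair i m' == (swap_pair i m).+1) = (m' == m.+1).
Proof.
move=> /even_halfK <-; move: m./2 => q; rewrite /swap_pair.
by do !(case: ifP => ?); lia.
Qed.

(** Every term of the sum over permutations is nonnegative and that of the identity is positive, so
    nothing cancels. A nonzero term puts a pair e_i, f_i, in some order, into the first two slots;
    both order and position of this pair can be normalized without changing the term. The statement
    is for any family with Gram matrix [symp], so that it applies to reordered families. *)
Lemma wedge_pow2_symp (b : V -> V -> R) k (v : 'I_(k * 2) -> V) :
  (forall i j, b (v i) (v j) = symp i j) -> 0 < wedge_pow2 (form2 b) v.
Proof.
elim: k v => [|k IH] v std /=; first exact: ltr01.
have term_ge0 (w : 'I_(2 + k * 2) -> V) (s : 'S_(2 + k * 2)) :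
    (forall i j, b (w i) (w j) = symp i j) ->
    (forall i, s (lshift (k * 2) i) = lshift (k * 2) i) ->
    0 < (-1) ^+ s * form2 b (fun i => w (s (lshift (k * 2) i))) *
      wedge_pow2 (form2 b) (fun j => w (s (rshift 2 j))).
  move=> stdw sl; have [t [st ->]] := perm_block_sign sl.
  have -> : (fun j => w (s (rshift 2 j))) = (fun j => w (rshift 2 j)) \o t.
    by apply/funext => j; rewrite /= st.
  rewrite wedge_pow2_alt /form2 !sl stdw /symp /= mulr1 mulrA -expr2 sqrr_sign mul1r.
  apply: IH => i j; rewrite stdw /symp /= !negbK /=.
  by [].
have H2 (w : 'I_(2 + k * 2) -> V) (s : 'S_(2 + k * 2)) :
    (forall i j, b (w i) (w j) = symp i j) ->
    (s (lshift (k * 2) ord0) < 2)%N -> (s (lshift (k * 2) ord_max) < 2)%N ->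
    0 < (-1) ^+ s * form2 b (fun i => w (s (lshift (k * 2) i))) *
      wedge_pow2 (form2 b) (fun j => w (s (rshift 2 j))).
  move=> stdw s0 s1.
  set x0 := lshift (k * 2) (ord0 : 'I_2) in s0 *.
  set x1 := lshift (k * 2) (ord_max : 'I_2) in s1 *.
  have ne : s x0 != s x1 by rewrite (inj_eq (@perm_inj _ s)).
  have I2 (P : 'I_2 -> Prop) : P ord0 -> P ord_max -> forall i, P i.
    move=> P0 P1 [[|[|//]] Hi]; [rewrite (_ : Ordinal Hi = ord0)|rewrite (_ : Ordinal Hi = ord_max)] => //;
    exact/val_inj.
  have [E0|N0] := eqVneq (s x0) x0.
    apply: term_ge0 => //; apply: I2 => //; apply/val_inj => /=.
    by move: s1 ne; rewrite E0 -val_eqE /=; case: (nat_of_ord _) => [|[|]].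
  have E0 : s x0 = x1.
    by apply/val_inj => /=; move: s0 N0; rewrite -val_eqE /=; case: (nat_of_ord _) => [|[|]].
  have E1 : s x1 = x0.
    by apply/val_inj => /=; move: s1 ne; rewrite E0 -val_eqE /=; case: (nat_of_ord _) => [|[|]].
  (* If [s] exchanges the first two vectors, undoing this reverses both the sign of the permutation
     and the value of [b]. *)
  pose u := (tperm x0 x1 * s)%g.
  have u0 : u x0 = x0 by rewrite permM tpermL.
  have u1 : u x1 = x1 by rewrite permM tpermR.
  have ur j : u (rshift 2 j) = s (rshift 2 j).
    by rewrite permM tpermD // -val_eqE.
  have ul i : u (lshift (k * 2) i) = lshift (k * 2) i by move: i; exact: I2.
  have := term_ge0 w u stdw ul.
  have -> : (fun j => w (u (rshift 2 j))) = (fun j => w (s (rshift 2 j))).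
    by apply/funext => j; rewrite ur.
  rewrite odd_mul_tperm -val_eqE /= /form2 u0 u1 E0 E1 !stdw /symp /=.
  by rewrite signrN mulr1 mulrN1.
have H (s : 'S_(2 + k * 2)) :
    0 <= (-1) ^+ s * form2 b (fun i => v (s (lshift (k * 2) i))) *
      wedge_pow2 (form2 b) (fun j => v (s (rshift 2 j))).
  set x := s (lshift (k * 2) ord0); set y := s (lshift (k * 2) ord_max).
  have bE : form2 b (fun i => v (s (lshift (k * 2) i))) = symp x y.
    by rewrite /form2 std.
  have [b0|] := eqVneq (symp x y) 0; first by rewrite bE b0 mulr0 mul0r.
  rewrite /symp => xy.
  have [i [xi yi]] : exists i, [/\ (x == i.*2 :> nat) || (x == i.*2.+1 :> nat) &
      (y == i.*2 :> nat) || (y == i.*2.+1 :> nat)].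
    exists (x./2); have := odd_double_half x; case: (odd x) xy => /=.
      rewrite oppr_eq0; case: (nat_of_ord x =P y.+1) => [E _ E'|_]; last by rewrite eqxx.
      by move: E E'; move: (nat_of_ord x) (nat_of_ord y) => m m' ? ?; split; lia.
    case: (nat_of_ord y =P x.+1) => [E _ E'|_]; last by rewrite eqxx.
    by move: E E'; move: (nat_of_ord x) (nat_of_ord y) => m m' ? ?; split; lia.
  have lti : (i.*2.+1 < 2 + k * 2)%N.
    have : x != y by rewrite (inj_eq (@perm_inj _ s)) -val_eqE.
    have := ltn_ord x; have := ltn_ord y.
    move: xi yi; rewrite -val_eqE /=.
    move: (nat_of_ord x) (nat_of_ord y) => m m'.
    move=> /orP[] /eqP -> /orP[] /eqP ->; rewrite ?eqxx //= => *; lia.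
  pose z0 : 'I_(2 + k * 2) := Ordinal (ltnW lti).
  pose z1 : 'I_(2 + k * 2) := Ordinal lti.
  pose x0 : 'I_(2 + k * 2) := lshift (k * 2) (ord0 : 'I_2).
  pose x1 : 'I_(2 + k * 2) := lshift (k * 2) (ord_max : 'I_2).
  (* [t] brings the pair of [x] and [y] to the front. It is even, an involution, and preserves the
     Gram matrix, so [s] on [v] may be replaced by [s * t] on [v \o t]. *)
  pose t := (tperm x0 z0 * tperm x1 z1)%g.
  have tE j : val (t j) = swap_pair i j.
    rewrite /swap_pair.
    rewrite permM; case: (tpermP x0 z0 j) => [->|->|/eqP + /eqP +].
    - by rewrite tpermD -?val_eqE //=; lia.
    - by rewrite tpermD -?val_eqE //= eqxx; case: eqP => //; lia.
    - rewrite -!val_eqE /= => /negPf -> /negPf ->.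
      case: (tpermP x1 z1 j) => [->|->|/eqP + /eqP +] //=; last first.
        by rewrite -!val_eqE /= => /negPf -> /negPf ->.
      by rewrite eqxx; case: eqP => //; lia.
  have tt : (t * t = 1)%g.
    apply/permP => j; apply/val_inj; rewrite permM perm1 !tE /swap_pair.
    by do !case: eqP => //=; lia.
  have st : (-1) ^+ t = 1 :> R.
    rewrite odd_permM !odd_tperm -!val_eqE /=.
    by case: i {xi yi lti z0 z1 t tE tt} => //=.
  pose r := (s * t)%g.
  have sr : s = (r * t)%g by rewrite /r -mulgA tt mulg1.
  have rl : (-1) ^+ s = (-1) ^+ r :> R.
    by rewrite sr odd_permM signr_addb st mulr1.
  have := H2 (v \o t) r _ _ _; rewrite rl.
  have E j : (v \o t) (r j) = v (s j) by rewrite /= -permM -sr.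
  have -> : (fun i => (v \o t) (r (lshift (k * 2) i))) = (fun i => v (s (lshift (k * 2) i))).
    by apply/funext => j; rewrite E.
  have -> : (fun i => (v \o t) (r (rshift 2 i))) = (fun i => v (s (rshift 2 i))).
    by apply/funext => j; rewrite E.
  move=> HH; apply: ltW; apply: HH.
  - move=> j j'; rewrite /= std /symp !tE.
    move: (nat_of_ord j) (nat_of_ord j') => m m'.
    rewrite swap_pair_odd; case: ifPn => om; last by rewrite swap_pair_succ.
    have [om'|om'] := boolP (odd m'); last by rewrite swap_pair_succ.
    have -> : (swap_pair i m == (swap_pair i m').+1) = false.
      by apply/negP => /eqP E'; have := swap_pair_odd i m; rewrite E' /= swap_pair_odd om' om.
    by case: eqP => // E'; move: om; rewrite E' /= om'.
  - rewrite permM tE -/x /swap_pair; case/orP: xi => /eqP ->; rewrite ?eqxx; do !case: eqP => //; lia.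
  - rewrite permM tE -/y /swap_pair; case/orP: yi => /eqP ->; rewrite ?eqxx; do !case: eqP => //; lia.
rewrite /wedge mulr_gt0 ?invr_gt0 ?ltr0n ?muln_gt0 ?fact_gt0 //.
rewrite (bigD1 1%g) //= ltr_pwDl //; last by apply: sumr_ge0.
by apply: H2 => //; rewrite perm1.
Qed.

(** All vectors but the first lie in the kernel of [a], so only permutations fixing the first index
    contribute, and they reproduce the positive wedge power of [b]. *)
Lemma wedge_form1_symp (a : V -> R) (b : V -> V -> R) k (v : 'I_(1 + k * 2) -> V) :
  a (v ord0) = 1 -> (forall j, a (v (rshift 1 j)) = 0) ->
  (forall i j, b (v (rshift 1 i)) (v (rshift 1 j)) = symp i j) ->
  0 < wedge (form1 a) (wedge_pow2 (form2 b) (k := k)) v.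
Proof.
move=> a0 ar std; have W := wedge_pow2_symp std.
have E0 : lshift (k * 2) (ord0 : 'I_1) = ord0 by exact/val_inj.
have H1 (s : 'S_(1 + k * 2)) : s ord0 = ord0 ->
    0 < (-1) ^+ s * form1 a (fun i => v (s (lshift (k * 2) i))) *
      wedge_pow2 (form2 b) (fun j => v (s (rshift 1 j))).
  move=> s0; have [i|t [st ->]] := @perm_block_sign 1 (k * 2) s.
    by rewrite ord1 E0.
  have -> : (fun j => v (s (rshift 1 j))) = (fun j => v (rshift 1 j)) \o t.
    by apply/funext => j; rewrite /= st.
  by rewrite wedge_pow2_alt /form1 E0 s0 a0 mulr1 mulrA -expr2 sqrr_sign mul1r.
rewrite /wedge mulr_gt0 ?invr_gt0 ?ltr0n ?muln_gt0 ?fact_gt0 //.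
rewrite (bigD1 1%g) //= ltr_pwDl //; first by apply: H1; rewrite perm1.
apply: sumr_ge0 => s _; have [s0|s0] := eqVneq (s ord0) ord0; first exact/ltW/H1.
suff -> : form1 a (fun i => v (s (lshift (k * 2) i))) = 0 by rewrite mulr0 mul0r.
rewrite /form1 E0; case: (split_ordP (s ord0)) => j E; last by rewrite E.
by move: s0; rewrite E ord1 E0 eqxx.
Qed.

End WedgeNonzero.

(** * Linear algebra of skew forms and local frames *)

Section LinearAlgebra.
Variable R : realType.

Lemma skew_unit_even n (A : 'M[R]_n) : A^T = - A -> A \in unitmx -> ~~ odd n.
Proof.
move=> sA; rewrite unitmxE unitfE => dA; apply/negP => on.
have : \det A = - \det A.
  by rewrite -{1}det_tr sA -scaleN1r detZ -signr_odd on expr1 mulN1r.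
by move=> E; move/eqP: dA; apply; lra.
Qed.

(** With [P] a right inverse of a basis [B] of the row space, A = B^T S B for the skew matrix S =
    P^T A P. Its size is the rank of [A], so it is invertible, and the parity follows from the
    determinant. *)
Lemma skew_rank_even n (A : 'M[R]_n) : A^T = - A -> ~~ odd (\rank A).
Proof.
move=> sA; pose B := row_base A; 
have fB : row_free B by exact: row_base_free.
have [P BP] : exists P, B *m P = 1%:M by exists (pinvmx B); rewrite mulmxVp.
have AP : A *m P *m B = A.
  have /submxP [Y EY] : (A <= B)%MS by rewrite eq_row_base.
  have : (Y *m B) *m P *m B = Y *m B by rewrite -(mulmxA Y) BP mulmx1.
  by rewrite -EY.
pose S := P^T *m A *m P.
have sS : S^T = - S.
  rewrite /S !trmx_mul trmxK sA mulNmx mulmxN mulmxA.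
  by [].
apply: (skew_unit_even sS).
have E : A = B^T *m (S *m B).
  have E1 : B^T *m P^T *m A = A.
    by apply: oppr_inj; rewrite -mulmxN -sA -mulmxA -!trmx_mul AP.
  transitivity (B^T *m P^T *m (A *m P *m B)); first by rewrite AP E1.
  by rewrite /S !mulmxA.
rewrite -row_free_unit -[row_free _]/(_ == _) eqn_leq rank_leq_row /=.
by rewrite {1}E (leq_trans (mxrankM_maxr _ _)) // mxrankM_maxl.
Qed.

Definition sympmx k : 'M[R]_(k * 2) := \matrix_(i, j) symp R i j.

Lemma skew_diag n (A : 'M[R]_n) i : A^T = - A -> A i i = 0.
Proof.
by move=> /matrixP /(_ i i); rewrite !mxE => E; lra.
Qed.

Lemma symp_mx22 (X : 'M[R]_2) : X^T = - X -> X ord0 ord_max != 0 ->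
  exists D : 'M[R]_2, D *m X *m D^T = \matrix_(a, b) symp R a b.
Proof.
set g := X ord0 ord_max => sX g0.
have X00 : X ord0 ord0 = 0 by rewrite skew_diag.
have X11 : X ord_max ord_max = 0 by rewrite skew_diag.
have X10 : X ord_max ord0 = - g.
  by move/matrixP: sX => /(_ ord0 ord_max); rewrite !mxE.
exists (\matrix_(a, b) (if a == b then (if a == ord0 then g^-1 else 1) else 0)).
have I2 (P : 'I_2 -> Prop) : P ord0 -> P ord_max -> forall i, P i.
  by move=> P0 P1 [[|[|//]] Hi]; [have -> : Ordinal Hi = ord0|have -> : Ordinal Hi = ord_max] => //;
    exact/val_inj.
have L : lift ord0 ord0 = ord_max :> 'I_2 by exact/val_inj.
apply/matrixP; apply: (I2 _); apply: (I2 _);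
  rewrite !mxE !big_ord_recl !big_ord0 !mxE !big_ord_recl !big_ord0 !mxE /= !L
    ?X00 ?X11 ?X10 /symp /= -?/g; by field.
Qed.

(** Symplectic elimination: a vector not orthogonal to the first one is moved to the second place,
    and the orthogonal complement of their span carries the Schur complement [W] of the block [X],
    again skew and invertible. *)
Lemma symplectic_basis k (G : 'M[R]_(k * 2)) : G^T = - G -> G \in unitmx ->
  exists P : 'M[R]_(k * 2), P *m G *m P^T = sympmx k.
Proof.
elim: k G => [|k IH] G sG uG.
  by exists 1%:M; apply/matrixP => -[].
pose i0 : 'I_(2 + k * 2) := lshift (k * 2) (ord0 : 'I_2).
pose i1 : 'I_(2 + k * 2) := lshift (k * 2) (ord_max : 'I_2).
have [j Gj] : exists j, G i0 j != 0.
  apply/existsP; apply: contraTT uG; rewrite negb_exists => /forallP H.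
  rewrite unitmxE unitfE negbK (expand_det_row _ i0) big1 // => j _.
  by move: (H j); rewrite negbK => /eqP ->; rewrite mul0r.
have ji0 : j != i0 by apply: contraNneq Gj => ->; rewrite skew_diag.
pose s := tperm i1 j.
have s0 : s i0 = i0 by rewrite tpermD // -val_eqE.
pose Q : 'M[R]_(2 + k * 2) := perm_mx s.
pose G1 : 'M[R]_(2 + k * 2) := Q *m G *m Q^T.
have uQ : Q \in unitmx by exact: unitmx_perm.
have sG1 : G1^T = - G1 by rewrite /G1 !trmx_mul trmxK sG mulNmx mulmxN mulmxA.
have uG1 : G1 \in unitmx by rewrite !unitmx_mul uQ unitmx_tr uQ uG.
have G1E a b : G1 a b = G (s a) (s b).
  by rewrite /G1 tr_perm_mx -row_permE -col_permE !mxE.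
pose g := G1 i0 i1; have g0 : g != 0 by rewrite /g G1E s0 tpermL.
pose X := ulsubmx G1; pose Y := ursubmx G1; pose Z := drsubmx G1.
have EG1 : G1 = block_mx X Y (- Y^T) Z.
  rewrite -[LHS]submxK /X /Y /Z; congr block_mx.
  apply/matrixP => a b; move/matrixP: sG1 => /(_ (lshift (k * 2) b) (rshift 2 a)).
  by rewrite mxE [in RHS]mxE => E; rewrite [LHS]mxE [LHS]mxE E !mxE.
have sX : X^T = - X by rewrite /X trmx_ulsub sG1; apply/matrixP => a b; rewrite !mxE.
have sZ : Z^T = - Z by rewrite /Z trmx_drsub sG1; apply/matrixP => a b; rewrite !mxE.
have [D XE] : exists D : 'M[R]_2, D *m X *m D^T = \matrix_(a, b) symp R a b.
  apply: symp_mx22 => //.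
  by have -> : X ord0 ord_max = g by rewrite [LHS]mxE [LHS]mxE.
have uX : X \in unitmx.
  have : D *m X *m D^T \in unitmx.
    rewrite XE unitmxE (expand_det_row _ ord0) !big_ord_recl big_ord0 /cofactor !det_mx11 !mxE /symp /=.
    by rewrite mul0r add0r addr0 mul1r /= expr1 mulN1r opprK unitr1.
  by rewrite !unitmx_mul => /andP[/andP[]].
have iN : invmx (- X) = - invmx X.
  have uN : - X \in unitmx by rewrite -scaleN1r unitmxZ ?unitrN1.
  rewrite -[LHS]mulmx1 -(mulmxV uX) mulmxA -[X in _ *m X *m _]opprK mulmxN.
  by rewrite mulVmx // mulNmx mul1mx.
pose W := Z + Y^T *m invmx X *m Y.
have sW : W^T = - W.
  rewrite /W raddfD /= sZ !trmx_mul trmxK trmx_inv sX opprD; congr (_ + _).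
  by rewrite iN mulNmx mulmxN mulmxA.
pose L : 'M[R]_(2 + k * 2) := block_mx 1%:M 0 (Y^T *m invmx X) 1%:M.
have LG : L *m G1 *m L^T = block_mx X 0 0 W.
  rewrite EG1 /L tr_block_mx !trmx0 !trmx1 !mulmx_block.
  rewrite !mul1mx !mul0mx !mulmx1 !mulmx0 !addr0.
  rewrite trmx_mul trmxK trmx_inv sX iN mulNmx mulmxN mulmxA mulmxV // mul1mx addNr.
  by rewrite -mulmxA mulVmx // mulmx1 addrN mul0mx add0r addrC.
have uL : L \in unitmx by rewrite unitmxE det_lblock !det1 mulr1 unitr1.
have uW : W \in unitmx.
  have : L *m G1 *m L^T \in unitmx by rewrite unitmx_mul unitmx_mul uL uG1 unitmx_tr uL.
  by rewrite LG !unitmxE det_ublock unitrM => /andP[].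
have [P PW] := IH W sW uW.
exists ((block_mx D 0 0 P : 'M[R]_(2 + k * 2)) *m L *m Q).
set T : 'M[R]_(2 + k * 2) := block_mx D 0 0 P.
have -> : T *m L *m Q *m G *m (T *m L *m Q)^T = T *m (L *m G1 *m L^T) *m T^T.
  by rewrite /G1 !trmx_mul !mulmxA.
rewrite LG tr_block_mx !mulmx_block !trmx0 !mul0mx !mulmx0 !addr0 !add0r ?mul0mx ?mulmx0 ?addr0 ?add0r XE PW.
apply/matrixP => a b; rewrite !mxE.
case: (split_ordP a) => a' ->; rewrite ?(unsplitK (inl a')) ?(unsplitK (inr a')) /= !mxE;
case: (split_ordP b) => b' ->; rewrite ?(unsplitK (inl b')) ?(unsplitK (inr b')) /= !mxE //.
- by case: a' => [[|[|//]] Ha]; rewrite /symp /= ?oppr0.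
- rewrite /symp /=; have := ltn_ord b'.
  move: (nat_of_ord a') (nat_of_ord b') => x y y2; case: ifPn => ox; case: eqP => E; rewrite ?oppr0 //; last lia.
  have x0 : x = 0%N by lia.
  by move: ox; rewrite x0.
- by rewrite /symp /= !negbK.
Qed.

(** The rows orthogonal to n - 1 independent rows form a line, and [a^T] is a nonzero element of
    it. *)
Lemma row_full_kernel n m (K : 'M[R]_(m, n)) (a : 'cV[R]_n) (u : 'rV[R]_n) :
  row_free K -> n = m.+1 -> a != 0 -> K *m a = 0 -> u *m K^T = 0 ->
  exists c, u = c *: a^T.
Proof.
move=> fK nm a0 Ka uK.
have aK : (a^T <= kermx K^T)%MS.
  by apply/sub_kermxP; rewrite -trmx_mul Ka trmx0.
have ra : \rank a^T = 1%N by rewrite rank_rV trmx_eq0 a0.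
have rk : \rank (kermx K^T) = 1%N.
  by rewrite mxrank_ker mxrank_tr (eqP fK) nm subSnn.
have E : (kermx K^T <= a^T)%MS.
  by move: (mxrank_leqif_sup aK) => [_]; rewrite ra rk eqxx => <-.
have /submxP [c ->] : (u <= a^T)%MS by apply: submx_trans E; apply/sub_kermxP.
by exists (c 0 0); rewrite [c in LHS]mx11_scalar mul_scalar_mx.
Qed.

(* In terms of the coordinates of a 1-form [a] and of [b = d a], this skew
   matrix is invertible iff [b] is nondegenerate on ker [a] and [a] is nonzero. *)
Definition augmx n (a : 'cV[R]_n) (B : 'M[R]_n) : 'M[R]_(n + 1) :=
  block_mx B a (- a^T) 0.

Lemma augmx_congr n (J B : 'M[R]_n) (a : 'cV[R]_n) : J \in unitmx ->
  (augmx (J *m a) (J *m B *m J^T) \in unitmx) = (augmx a B \in unitmx).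
Proof.
move=> uJ; pose L : 'M[R]_(n + 1) := block_mx J 0 0 1%:M.
have -> : augmx (J *m a) (J *m B *m J^T) = L *m augmx a B *m L^T.
  rewrite /augmx tr_block_mx !trmx0 !trmx1 !mulmx_block.
  by rewrite !mul1mx !mul0mx !mulmx0 !mulmx1 !addr0 !add0r trmx_mul mulNmx.
have uL : L \in unitmx by rewrite unitmxE det_ublock det1 mulr1 -unitmxE.
by rewrite !unitmx_mul unitmx_tr uL andbT.
Qed.

(** The pairs [(u, s)] with these two equations are exactly the elements of the left kernel of
    [augmx a B]. *)
Lemma augmx_unitP n (a : 'cV[R]_n) (B : 'M[R]_n) :
  (forall (u : 'rV[R]_n) (s : R), u *m B = s *: a^T -> u *m a = 0 -> u = 0 /\ s = 0) <->
  augmx a B \in unitmx.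
Proof.
rewrite -row_free_unit; split=> [H|fA u s uB ua].
  rewrite -kermx_eq0; apply/eqP/row_matrixP => i; rewrite row0.
  have : row i (kermx (augmx a B)) *m augmx a B = 0 by rewrite -row_mul mulmx_ker row0.
  move: (row i _) => w; rewrite -[w]hsubmxK; move: (lsubmx w) (rsubmx w) => u t.
  rewrite /augmx mul_row_block mulmx0 addr0 -(row_mx0 _ 1 n 1) => /eq_row_mx [E1 E2].
  have [|//|-> t0] := H u (t 0 0); last by rewrite [t]mx11_scalar t0 raddf0 row_mx0.
  rewrite -mul_scalar_mx -mx11_scalar; apply/eqP; rewrite -subr_eq0 -mulmxN.
  by rewrite E1.
have : row_mx u s%:M *m augmx a B = 0.
  rewrite /augmx mul_row_block mulmx0 addr0 ua uB mulmxN mul_scalar_mx addrN.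
  by rewrite row_mx0.
rewrite -(mul0mx _ (augmx a B)) => /(row_free_inj fA).
rewrite -(row_mx0 _ 1 n 1) => /eq_row_mx [-> /matrixP /(_ 0 0)].
by rewrite !mxE eqxx mulr1n.
Qed.

Lemma exists_row_free_kermx n m (a : 'cV[R]_n) : n = m.+1 -> a != 0 ->
  exists2 K : 'M[R]_(m, n), row_free K & (K :=: kermx a)%MS.
Proof.
move=> nm a0; have : \rank (kermx a) = m.
  by rewrite mxrank_ker -mxrank_tr rank_rV trmx_eq0 a0 nm subn1.
move=> <-; exists (row_base (kermx a)); first exact: row_base_free.
exact: eq_row_base.
Qed.

Lemma contact_augmx m (a : 'rV[R]_(m * 2).+1 -> R)
    (b : 'rV[R]_(m * 2).+1 -> 'rV[R]_(m * 2).+1 -> R)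
    (A : 'cV[R]_(m * 2).+1) (B : 'M[R]_((m * 2).+1)) :
  (forall v, a v = (v *m A) 0 0) -> (forall u v, b u v = (u *m B *m v^T) 0 0) ->
  B^T = - B -> augmx A B \in unitmx ->
  exists v, wedge (form1 a) (wedge_pow2 (form2 b) (k := m)) v != 0.
Proof.
move=> aE bE sB /augmx_unitP uA.
have A0 : A != 0.
  apply/eqP => A0; have [||_ /eqP] := uA 0 1.
  - by rewrite mul0mx A0 trmx0 scaler0.
  - by rewrite mul0mx.
  by rewrite oner_eq0.
have [K fK EK] := exists_row_free_kermx (erefl _) A0.
have KA : K *m A = 0 by apply/sub_kermxP; rewrite EK.
pose G := K *m B *m K^T.
have sG : G^T = - G by rewrite /G !trmx_mul trmxK sB mulNmx mulmxN mulmxA.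
have uG : G \in unitmx.
  rewrite -row_free_unit -kermx_eq0; apply/eqP/row_matrixP => i; rewrite row0.
  have : row i (kermx G) *m G = 0 by rewrite -row_mul mulmx_ker row0.
  move: (row i _) => y; rewrite /G !mulmxA => yG.
  (* A vector [y *m K] in the radical of the Gram matrix has [y *m K *m B] orthogonal to ker [A],
     hence proportional to [A^T]; this is an element of the left kernel of [augmx A B]. *)
  have [c yB] := row_full_kernel fK (erefl _) A0 KA yG.
  have [] := uA (y *m K) c yB; first by rewrite -mulmxA KA mulmx0.
  by rewrite -(mul0mx _ K) => /(row_free_inj fK).
have [P PG] := symplectic_basis sG uG.
have [i Ai] : exists i, A i 0 != 0.
  apply/existsP; apply: contraNT A0; rewrite negb_exists => /forallP H.
  by apply/eqP/colP => i; rewrite !mxE; move: (H i); rewrite negbK => /eqP.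
(* The first vector is normalized by a = 1; the others form a symplectic basis of the kernel of
   [a]. *)
exists (fun j : 'I_(1 + m * 2) => match fintype.split j with
  | inl _ => (A i 0)^-1 *: delta_mx 0 i | inr j => row j (P *m K) end).
apply: lt0r_neq0; apply: wedge_form1_symp.
- have -> : fintype.split (ord0 : 'I_(1 + m * 2)) = inl ord0.
    by rewrite -(unsplitK (inl ord0)); congr fintype.split; exact/val_inj.
  by rewrite aE -scalemxAl -rowE !mxE mulVf.
- move=> j; rewrite (unsplitK (inr j)) aE -row_mul -mulmxA KA mulmx0.
  by rewrite !mxE.
- move=> j j'; rewrite (unsplitK (inr j)) (unsplitK (inr j')) bE.
  have : (P *m G *m P^T) j j' = symp R j j' by rewrite PG !mxE.
  have -> : P *m G *m P^T = (P *m K) *m B *m (P *m K)^T.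
    by rewrite /G trmx_mul !mulmxA.
  move=> <-; rewrite -row_mul [LHS]mxE [RHS]mxE; apply: eq_bigr => l _.
  by rewrite [in LHS]mxE; congr (_ * _); rewrite 2![in LHS]mxE [in RHS]mxE.
Qed.

(* The left kernel of this matrix is the radical of the restriction of [B] to
   ker [a]: the second factor of [B] is |a|^2 times the orthogonal projection
   onto ker [a]. *)
Definition charmx n (a : 'cV[R]_n) (B : 'M[R]_n) : 'M[R]_(n, 1 + n) :=
  row_mx a (B *m ((a^T *m a) 0 0 *: 1%:M - a *m a^T)).

Lemma sqnorm_neq0 n (a : 'cV[R]_n) : a != 0 -> (a^T *m a) 0 0 != 0.
Proof.
apply: contraNneq; rewrite mxE => E; apply/eqP/colP => i; rewrite [RHS]mxE.
have /psumr_eq0P H : \sum_j a^T 0 j * a j 0 = 0 by [].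
have := H (fun j _ => _) i isT; rewrite !mxE => H'.
have /eqP : a i 0 * a i 0 = 0.
  by apply: H' => j; rewrite !mxE -expr2 sqr_ge0.
by rewrite mulf_eq0 orbb => /eqP.
Qed.

(** [Q] is symmetric, its rows lie in ker [a], and it acts on ker [a] as the nonzero scalar [c]; so
    testing [v *m B] against [Q] amounts to testing it against all of ker [a]. *)
Lemma charmx_kerP n (a : 'cV[R]_n) (B : 'M[R]_n) (v : 'rV[R]_n) : a != 0 ->
  v *m charmx a B = 0 <->
  v *m a = 0 /\ forall w : 'rV[R]_n, w *m a = 0 -> v *m B *m w^T = 0.
Proof.
move=> a0; have s0 := sqnorm_neq0 a0; set c := (a^T *m a) 0 0 in s0.
have aa : a^T *m a = c%:M by rewrite [LHS]mx11_scalar.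
set Q := c *: 1%:M - a *m a^T.
have -> : v *m charmx a B = row_mx (v *m a) (v *m B *m Q).
  by rewrite /charmx mul_mx_row mulmxA.
have sQ : Q^T = Q by rewrite /Q raddfB /= linearZ /= trmx1 trmx_mul trmxK.
split=> [|[va H]].
  rewrite -(row_mx0 _ 1 1 n) => /eq_row_mx [va vQ]; split=> // w wa.
  have -> : w^T = c^-1 *: (Q *m w^T).
    rewrite -sQ -trmx_mul /Q mulmxBr mulmxA wa mul0mx subr0 -scalemxAr mulmx1.
    by rewrite linearZ /= scalerA mulVf // scale1r.
  by rewrite -scalemxAr mulmxA vQ mul0mx scaler0.
rewrite va; suff -> : v *m B *m Q = 0 by rewrite row_mx0.
apply/trmx_inj/row_matrixP => i.
rewrite !trmx0 row0 -tr_col; apply/trmx_inj; rewrite trmxK trmx0.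
rewrite colE -mulmxA -colE -sQ -tr_row; apply: H.
rewrite -row_mul /Q mulmxBl -mulmxA aa -scalemxAl mul1mx mul_mx_scalar subrr.
by rewrite row0.
Qed.

(** The left rank is n minus the dimension of the radical, while the rank of the form on ker [a] is
    n - 1 minus that dimension. *)
Lemma charmx_rank n (a : 'cV[R]_n) (B : 'M[R]_n) : a != 0 ->
  \rank (charmx a B) = (\rank (kermx a *m B *m (kermx a)^T)).+1.
Proof.
move=> a0; set K := kermx a.
have E : (kermx (charmx a B) :=: K :&: kermx (B *m K^T))%MS.
  apply/eqmxP/andP; split; apply/rV_subP => v.
    move=> /sub_kermxP /(charmx_kerP _ _ a0) [va H]; rewrite sub_capmx.
    apply/andP; split; first exact/sub_kermxP.
    apply/sub_kermxP; rewrite mulmxA; apply/trmx_inj/row_matrixP => i.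
    rewrite trmx0 row0 -tr_col; apply/trmx_inj; rewrite trmxK trmx0.
    rewrite colE -mulmxA -colE -tr_row; apply: H.
    by rewrite -row_mul mulmx_ker row0.
  rewrite sub_capmx => /andP[/sub_kermxP va /sub_kermxP]; rewrite mulmxA => vB.
  apply/sub_kermxP/(charmx_kerP _ _ a0); split=> // w /sub_kermxP /submxP [y ->].
  by rewrite trmx_mul mulmxA vB mul0mx.
have rK : \rank K = n.-1 by rewrite mxrank_ker -mxrank_tr rank_rV trmx_eq0 a0 subn1.
have := mxrank_mul_ker K (B *m K^T); rewrite mulmxA rK -E mxrank_ker => H.
have n0 : (0 < n)%N by case: (n) a a0 {K E rK H} => // a; rewrite [a]flatmx0 eqxx.
have := rank_leq_row (charmx a B); move: H n0.
move: (\rank _) (\rank _) => x y; lia.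
Qed.

(** Constant matrices [S] and [T] make (C S | T) invertible at [x0], hence nearby. The last k rows
    [F] of the inverse satisfy F C S = 0 and F T = 1, so they form a smooth frame of the kernel
    whose right inverse [T] does not depend on the point. *)
Lemma exists_local_frame m (U : set 'rV[R]_m) q k p
    (C : 'rV[R]_m -> 'M[R]_(q + k, p)) (x0 : 'rV[R]_m) :
  open U -> U x0 -> smooth_on U C -> (forall x, U x -> \rank (C x) = q) ->
  exists (O : set 'rV[R]_m) (F : 'rV[R]_m -> 'M[R]_(k, q + k)) (G : 'M[R]_(q + k, k)),
    [/\ open O, O x0, O `<=` U, smooth_on O F &
      forall x, O x -> F x *m G = 1%:M /\ (F x :=: kermx (C x))%MS].
Proof.
move=> oU Ux0 sC rC.
have [S rS] : exists S : 'M[R]_(p, q), \rank (C x0 *m S) = q.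
  have := rC x0 Ux0; move: (C x0); move: (q + k)%N => n A <-.
  exists (pinvmx (row_base A)).
  have := congr1 (mulmx^~ (pinvmx (row_base A))) (mulmx_base A).
  rewrite -mulmxA mulmxVp ?row_base_free // mulmx1 => <-.
  exact: eqP (col_base_full A).
have [T uT] : exists T : 'M[R]_(q + k, k), row_mx (C x0 *m S) T \in unitmx.
  move: (C x0 *m S) rS => D rD.
  exists (col_ebase D *m col_mx 0 1%:M).
  have -> : row_mx D (col_ebase D *m col_mx 0 1%:M) =
      col_ebase D *m block_mx (row_ebase D) 0 0 1%:M.
    rewrite -{1}(mulmx_ebase D) rD -mulmxA -mul_mx_row block_mxEh; congr (_ *m row_mx _ _).
    have -> : pid_mx q = col_mx 1%:M 0 :> 'M[R]_(q + k, q).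
      by rewrite pid_mx_col.
    by rewrite mul_col_mx mul1mx mul0mx.
  rewrite unitmx_mul col_ebase_unit unitmxE det_ublock det1 mulr1 -unitmxE.
  exact: row_ebase_unit.
pose M x := row_mx (C x *m S) T.
have sM : smooth_on U M.
  apply: smooth_on_row_mx => //; last exact: smooth_on_cst.
  by apply: smooth_on_mulmx => //; exact: smooth_on_cst.
have sdM : smooth_on U (fun x => \det (M x)) by exact: smooth_on_det.
pose O := [set x | U x /\ \det (M x) != 0].
have OU : O `<=` U by move=> x [].
have oO : open O.
  rewrite openE => x [Ux dx].
  have c := smooth_on_continuous sdM Ux.
  have := open_nbhs_nbhs (conj oU Ux).
  apply: filter_app; near=> y => Uy; split => //.
  near: y; apply: (c [set r | r != 0]).
  by apply: open_nbhs_nbhs; split => //; exact: open_neq.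
exists O, (fun x => dsubmx (invmx (M x))), T; split=> //.
- by split => //; move: uT; rewrite unitmxE unitfE.
- have sI : smooth_on O (fun x => invmx (M x)).
    apply: smooth_on_invmx => //; last exact: smooth_on_sub sM.
    by move=> x [_]; rewrite unitmxE unitfE.
  apply: smooth_on_mx => // i j.
  apply: (smooth_on_eq oO (f := fun x => invmx (M x) (rshift q i) j)).
    by move=> x _; rewrite mxE.
  exact: smooth_on_coord.
- move=> x [Ux dx]; have uM : M x \in unitmx by rewrite unitmxE unitfE.
  have E : invmx (M x) *m M x = 1%:M by exact: mulVmx.
  move: E; rewrite -{1}[invmx (M x)]vsubmxK {2}/M mul_col_row scalar_mx_block.
  move=> /eq_block_mx [_ _ FC FT]; split=> //.
  set F := dsubmx _ in FC FT *.
  have rF : \rank F = k.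
    by apply/eqP; rewrite -[_ == _]/(row_free F); apply/row_freeP; exists T.
  have rCS : \rank (C x *m S) = q.
    apply/eqP; rewrite eqn_leq rank_leq_col /=.
    have : \rank (M x)^T = (q + k)%N by rewrite mxrank_unit // unitmx_tr.
    rewrite /M tr_row_mx -addsmxE => H.
    have := mxrank_adds_leqif (C x *m S)^T T^T; rewrite /leqif H mxrank_tr => -[H' _].
    have := rank_leq_row T^T; move: H'; move: (\rank _) (\rank _) => a b; lia.
  (* The constant rank enters here: ker C is contained in ker (C S), and both have dimension k on
     [O], as does the row space of [F]. *)
  have sub1 : (kermx (C x) <= kermx (C x *m S))%MS.
    by apply/sub_kermxP; rewrite mulmxA mulmx_ker mul0mx.
  have sub2 : (F <= kermx (C x *m S))%MS by exact/sub_kermxP.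
  have e1 : (kermx (C x) == kermx (C x *m S))%MS.
    by rewrite -(geq_leqif (mxrank_leqif_eq sub1)) !mxrank_ker rC // rCS.
  have e2 : (F == kermx (C x *m S))%MS.
    by rewrite -(geq_leqif (mxrank_leqif_eq sub2)) mxrank_ker rF rCS addKn.
  by apply: eqmx_trans (eqmxP e2) (eqmx_sym (eqmxP e1)).
Unshelve. all: by end_near. Qed.

End LinearAlgebra.

(** * Forms in coordinates *)

Section FormsInCoordinates.
Variable R : realType.

Definition formcol n (a : 'rV[R]_n -> R) : 'cV[R]_n := \col_i a (delta_mx 0 i).

Definition formmx n (b : 'rV[R]_n -> 'rV[R]_n -> R) : 'M[R]_n :=
  \matrix_(i, j) b (delta_mx 0 i) (delta_mx 0 j).

Lemma scalar_sum n (a : 'rV[R]_n -> R) v : scalar a ->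
  a v = \sum_i v 0 i * a (delta_mx 0 i).
Proof.
move=> la; pose al : {linear 'rV[R]_n -> R} :=
  HB.pack a (GRing.isLinear.Build R 'rV[R]_n R *%R a la).
rewrite -[LHS]/(al v) [in LHS](row_sum_delta v) linear_sum.
by apply: eq_bigr => i _; rewrite linearZ.
Qed.

Lemma formcolE n (a : 'rV[R]_n -> R) v : scalar a -> a v = (v *m formcol a) 0 0.
Proof. by move=> /scalar_sum ->; rewrite mxE; apply: eq_bigr => i _; rewrite mxE. Qed.

Lemma mulmx3E n p (u : 'rV[R]_n) (A : 'M[R]_(n, p)) (v : 'rV[R]_p) :
  (u *m A *m v^T) 0 0 = \sum_i \sum_j u 0 i * v 0 j * A i j.
Proof.
rewrite exchange_big mxE; apply: eq_bigr => j _.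
by rewrite !mxE mulr_suml; apply: eq_bigr => i _; rewrite mulrAC.
Qed.

Lemma extd_skew n (w : 'rV[R]_n -> 'rV[R]_n -> R) x u v :
  extd w x u v = - extd w x v u.
Proof. by rewrite /extd opprB. Qed.

Lemma formmx_skew n (w : 'rV[R]_n -> 'rV[R]_n -> R) x :
  (formmx (extd w x))^T = - formmx (extd w x).
Proof. by apply/matrixP => i j; rewrite !mxE extd_skew. Qed.

Section Form.
Variables (n : nat) (U : set 'rV[R]_n) (w : 'rV[R]_n -> 'rV[R]_n -> R).
Hypotheses (oU : open U) (lw : forall x, U x -> scalar (w x)).
Hypothesis sw : forall v, smooth_on U (fun x => w x v).

Lemma derive_form x u v : U x ->
  'D_u (fun y => w y v) x =
  \sum_i \sum_j u 0 i * v 0 j * 'D_(delta_mx 0 i) (fun y => w y (delta_mx 0 j)) x.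
Proof.
move=> Ux; have dw j : differentiable (fun y => w y (delta_mx 0 j)) x.
  exact: smooth_on_differentiable (sw _) _ Ux.
have -> : 'D_u (fun y => w y v) x =
    'D_u (\sum_j (fun y => v 0 j * w y (delta_mx 0 j))) x.
  apply: near_eq_derive; apply: filterS (open_nbhs_nbhs (conj oU Ux)) => y Uy.
  by rewrite (scalar_sum _ (lw Uy)) fct_sumE.
rewrite derive_sum; last first.
  by move=> j; apply: derivableM; [exact: derivable_cst|exact: diff_derivable].
rewrite exchange_big /=; apply: eq_bigr => j _.
rewrite deriveM; [|exact: derivable_cst|exact: diff_derivable].
rewrite derive_cst scaler0 addr0 deriveE // [in LHS](row_sum_delta u) linear_sum.
rewrite scaler_sumr; apply: eq_bigr => i _.
by rewrite linearZ /= -deriveE // /GRing.scale /= mulrCA mulrA.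
Qed.

Lemma extdE x u v : U x -> extd w x u v = (u *m formmx (extd w x) *m v^T) 0 0.
Proof.
move=> Ux; rewrite /extd !derive_form // [X in _ - X]exchange_big /= -sumrB.
rewrite [RHS]mulmx3E; apply: eq_bigr => i _.
rewrite -sumrB; apply: eq_bigr => j _; rewrite [in RHS]mxE /extd.
move: ('D_(delta_mx 0 i) _ _) ('D_(delta_mx 0 j) _ _) => a b; ring.
Qed.

Lemma smooth_formcol : smooth_on U (fun x => formcol (w x)).
Proof.
apply: smooth_on_mx => // i j.
by apply: (smooth_on_eq oU (f := fun x => w x (delta_mx 0 i))) => // x _; rewrite mxE.
Qed.

Lemma smooth_formmx : smooth_on U (fun x => formmx (extd w x)).
Proof.
apply: smooth_on_mx => // i j.
apply: (smooth_on_eq oU (f := fun x => extd w x (delta_mx 0 i) (delta_mx 0 j))).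
  by move=> x _; rewrite mxE.
by apply: smooth_onB => //; apply: smooth_on_derive.
Qed.

End Form.

Section PullbackMatrices.
Variables (n p : nat) (U : set 'rV[R]_n) (O : set 'rV[R]_p).
Variables (tau : 'rV[R]_n -> 'rV[R]_p).
Variables (w : 'rV[R]_n -> 'rV[R]_n -> R) (w' : 'rV[R]_p -> 'rV[R]_p -> R).
Hypotheses (oU : open U) (oO : open O) (tauU : forall x, U x -> O (tau x)).
Hypotheses (stau : smooth_on U tau) (lw' : forall y, O y -> scalar (w' y)).
Hypothesis sw' : forall v, smooth_on O (fun y => w' y v).
Hypothesis ww' : forall x v, U x -> w x v = w' (tau x) ('d tau x v).

(** Tangent vectors are rows on which the Jacobian acts from the right; hence coefficient columns of
    1-forms transform by J on the left, and Gram matrices by J on the left and its transpose on the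
    right. *)
Lemma pullback_formcol x : U x ->
  formcol (w x) = 'J tau x *m formcol (w' (tau x)).
Proof.
move=> Ux; apply/colP => i; rewrite !mxE ww' // (scalar_sum _ (lw' (tauU Ux))).
by apply: eq_bigr => j _; rewrite !mxE.
Qed.

Lemma pullback_formmx x : U x ->
  formmx (extd w x) = 'J tau x *m formmx (extd w' (tau x)) *m ('J tau x)^T.
Proof.
move=> Ux; apply/matrixP => i j; rewrite mxE.
rewrite (extd_eq _ _ oU Ux (w' := fun y v => w' (tau y) ('d tau y v))); last first.
  by move=> y v Uy; rewrite ww'.
rewrite (extd_pullback oU oO tauU stau lw' sw') //.
rewrite (extdE oO lw' sw' _ _ (tauU Ux)).
have E l : 'd tau x (delta_mx 0 l) = row l ('J tau x).
  by apply/rowP => m; rewrite !mxE.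
rewrite !E tr_row -row_mul [LHS]mxE [RHS]mxE; apply: eq_bigr => l _.
by rewrite [in LHS]mxE; congr (_ * _); rewrite mxE.
Qed.

End PullbackMatrices.

Lemma jacobian_comp n p q (f : 'rV[R]_n -> 'rV[R]_p) (g : 'rV[R]_p -> 'rV[R]_q) x :
  differentiable f x -> differentiable g (f x) ->
  'J (g \o f) x = 'J f x *m 'J g (f x).
Proof.
move=> df dg; apply/row_matrixP => i; rewrite !rowE mulmxA /jacobian !mul_rV_lin1.
by rewrite diff_comp.
Qed.

Lemma diffJ n p (f : 'rV[R]_n -> 'rV[R]_p) x v : 'd f x v = v *m 'J f x.
Proof. by rewrite mul_rV_lin1. Qed.

Lemma jacobian_near n p (f g : 'rV[R]_n -> 'rV[R]_p) x :
  differentiable f x -> (\near x, f x = g x) -> 'J f x = 'J g x.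
Proof.
move=> df fg; have dg := near_eq_differentiable fg df.
have E i h : differentiable h x -> row i ('J h x) = 'D_(delta_mx 0 i) h x.
  by move=> dh; rewrite rowE -diffJ deriveE.
apply/row_matrixP => i; transitivity ('D_(delta_mx 0 i) f x); first exact: E.
transitivity ('D_(delta_mx 0 i) g x); first exact: near_eq_derive.
by symmetry; exact: E.
Qed.

Lemma jacobian_id n (x : 'rV[R]_n) : 'J id x = 1%:M.
Proof.
have d : differentiable (@id 'rV[R]_n) x by exact: ex_diff.
apply/row_matrixP => i; rewrite !rowE -diffJ -deriveE // derive_id mulmx1 //.
Qed.

Lemma smooth_jacobian n p (U : set 'rV[R]_n) (f : 'rV[R]_n -> 'rV[R]_p) : open U ->
  smooth_on U f -> smooth_on U (fun x => 'J f x).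
Proof.
move=> oU sf; apply: smooth_on_mx => // i j.
apply: (smooth_on_eq oU (f := fun x => ('D_(delta_mx 0 i) f x) 0 j)).
  move=> x Ux; rewrite deriveE ?mxE //; exact: smooth_on_differentiable sf _ Ux.
by apply: smooth_on_coord => //; exact: smooth_on_derive.
Qed.

End FormsInCoordinates.

(** * Calculus on a manifold *)

Lemma charmx_congr (R : realType) n (a a' : 'cV[R]_n) (B B' J J' : 'M[R]_n) (v : 'rV[R]_n) :
  a != 0 -> a' != 0 -> a = J *m a' -> B = J *m B' *m J^T -> J' *m J = 1%:M ->
  v *m charmx a B = 0 -> v *m J *m charmx a' B' = 0.
Proof.
move=> a0 a0' aE BE E /(charmx_kerP _ _ a0) [va vB]; apply/(charmx_kerP _ _ a0').
split; first by rewrite -mulmxA -aE.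
(* A test vector of ker a' is carried back by [J'] to one of ker a. *)
move=> w wa; have := vB (w *m J').
rewrite BE aE !mulmxA -(mulmxA w) E mulmx1 => /(_ wa).
by rewrite -mulmxA -trmx_mul -(mulmxA w) E mulmx1.
Qed.

(* These are sealed so that unification does not unfold derivatives. *)
HB.lock Definition Jm (R : realType) (n : nat) (M : manifold R n) (c c' : chart R M n)
  (m : M) : 'M[R]_n := 'J (local_rep id c c') (phi c m).

HB.lock Definition acol (R : realType) (n : nat) (M : manifold R n) (eta : one_form M)
  (c : chart R M n) (m : M) : 'cV[R]_n := formcol (eta c (phi c m)).

HB.lock Definition Bmx (R : realType) (n : nat) (M : manifold R n) (eta : one_form M)
  (c : chart R M n) (m : M) : 'M[R]_n := formmx (extd (eta c) (phi c m)).

HB.lock Definition Cmx (R : realType) (n : nat) (M : manifold R n) (eta : one_form M)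
  (c : chart R M n) (m : M) : 'M[R]_(n, 1 + n) := charmx (acol eta c m) (Bmx eta c m).

Section ManifoldCalculus.
Variables (R : realType) (n : nat) (M : manifold R n).
Implicit Types c : chart R M n.

Lemma open_preimage_on (T T' : topologicalType) (f : T -> T') (A : set T) (B : set T') :
  open A -> (forall x, A x -> {for x, continuous f}) -> open B ->
  open [set x | A x /\ B (f x)].
Proof.
move=> oA cf oB; rewrite openE => x [Ax Bx].
apply: filterI; first exact: open_nbhs_nbhs.
by apply: (cf x Ax); exact: open_nbhs_nbhs.
Qed.

Lemma open_cod_psi c (W : set M) : open W -> open [set x | cod c x /\ W (psi c x)].
Proof. by move=> oW; apply: open_preimage_on => //; [exact: cod_open|exact: psi_cont]. Qed.

Lemma open_dom_phi c (O : set 'rV[R]_n) : open O -> open [set m | dom c m /\ O (phi c m)].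
Proof. by move=> oO; apply: open_preimage_on => //; [exact: dom_open|exact: phi_cont]. Qed.

Lemma open_local_dom_id c c' : open (local_dom id c c').
Proof. by apply: open_cod_psi; exact: dom_open. Qed.

Definition smoothM (W : normedModType R) (U : set M) (h : M -> W) :=
  forall c, atlas M c ->
    smooth_on [set x | cod c x /\ U (psi c x)] (fun x => h (psi c x)).

Section Local.
Variables (W : normedModType R) (U : set M).
Hypothesis oU : open U.

Lemma smoothM_eq (h h' : M -> W) :
  (forall m, U m -> h m = h' m) -> smoothM U h -> smoothM U h'.
Proof.
move=> E sh c ac; apply: smooth_on_eq (sh c ac); first exact: open_cod_psi.
by move=> x [_ Ux]; exact: E.
Qed.

Lemma smoothM_local (h : M -> W) :
  (forall m, U m -> exists2 O, open O /\ O m & smoothM O h) -> smoothM U h.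
Proof.
move=> H c ac; apply: smooth_on_local => x [cx Ux].
have [B [oB Bx] sB] := H _ Ux.
by exists [set y | cod c y /\ B (psi c y)]; [split|exact: sB].
Qed.

Lemma smoothM_sub (U' : set M) (h : M -> W) : U' `<=` U -> smoothM U h -> smoothM U' h.
Proof.
by move=> sU sh c ac; apply: smooth_on_sub (sh c ac) => x [cx Ux]; split=> //; exact: sU.
Qed.

Lemma smoothM_cst (a : W) : smoothM U (fun=> a).
Proof. by move=> c ac; exact: smooth_on_cst. Qed.

Lemma smoothM_sum (I : Type) (r : seq I) (P : pred I) (h : I -> M -> W) :
  (forall i, P i -> smoothM U (h i)) ->
  smoothM U (fun m => \sum_(i <- r | P i) h i m).
Proof.
move=> sh c ac.
apply: (@smooth_on_sum _ _ _ _ _ _ _ (fun i x => h i (psi c x))); first exact: open_cod_psi.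
by move=> i /sh; apply.
Qed.

End Local.

Lemma smoothMM U (h h' : M -> R) : open U ->
  smoothM U h -> smoothM U h' -> smoothM U (fun m => h m * h' m).
Proof.
by move=> oU sh sh' c ac; apply: smooth_onM; [exact: open_cod_psi|exact: sh|exact: sh'].
Qed.

Lemma smoothM_prod U (I : Type) (r : seq I) (P : pred I) (h : I -> M -> R) : open U ->
  (forall i, P i -> smoothM U (h i)) ->
  smoothM U (fun m => \prod_(i <- r | P i) h i m).
Proof.
move=> oU sh c ac.
apply: (@smooth_on_prod _ _ _ _ _ _ (fun i x => h i (psi c x))); first exact: open_cod_psi.
by move=> i /sh; apply.
Qed.

Lemma smoothM_mulmx U p q r (A : M -> 'M[R]_(p, q)) (B : M -> 'M[R]_(q, r)) : open U ->
  smoothM U A -> smoothM U B -> smoothM U (fun m => A m *m B m).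
Proof.
move=> oU sA sB c ac.
by apply: smooth_on_mulmx; [exact: open_cod_psi|exact: sA|exact: sB].
Qed.

Lemma smoothM_trmx U p q (A : M -> 'M[R]_(p, q)) : open U ->
  smoothM U A -> smoothM U (fun m => (A m)^T).
Proof.
by move=> oU sA c ac; apply: smooth_on_trmx; [exact: open_cod_psi|exact: sA].
Qed.

Lemma smoothM_scale U p q (h : M -> R) (A : M -> 'M[R]_(p, q)) : open U ->
  smoothM U h -> smoothM U A -> smoothM U (fun m => h m *: A m).
Proof.
move=> oU sh sA c ac; have oc := open_cod_psi (c := c) oU.
apply: smooth_on_mx => // i j.
apply: (smooth_on_eq oc (f := fun x => h (psi c x) * A (psi c x) i j)).
  by move=> x _; rewrite mxE.
by apply: smooth_onM => //; [exact: sh|apply: smooth_on_coord => //; exact: sA].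
Qed.

Lemma trans_smooth c c' : atlas M c -> atlas M c' ->
  smooth_on (local_dom id c c') (local_rep id c c').
Proof. exact: atlas_compat. Qed.

Section OfChart.
Variables (c' : chart R M n) (ac' : atlas M c') (U : set M) (O : set 'rV[R]_n).
Hypotheses (oU : open U) (oO : open O) (Uc : U `<=` dom c').
Hypothesis UO : forall m, U m -> O (phi c' m).

Let sphi c : atlas M c -> 
  smooth_on [set x | cod c x /\ U (psi c x)] (fun x => phi c' (psi c x)).
Proof.
move=> ac; apply: smooth_on_sub (trans_smooth ac ac') => x [cx Ux].
by split=> //; exact: Uc.
Qed.

(** One chart whose domain contains [U] decides smoothness in all charts, since the transition maps
    are smooth. *)
Lemma smoothM_of_chart p q (g : 'rV[R]_n -> 'M[R]_(p, q)) (h : M -> 'M[R]_(p, q)) :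
  (forall m, U m -> h m = g (phi c' m)) -> smooth_on O g -> smoothM U h.
Proof.
move=> E sg c ac; have oc := open_cod_psi (c := c) oU.
apply: (smooth_on_eq oc (f := fun x => g (phi c' (psi c x)))).
  by move=> x [_ /E].
apply: (smooth_on_comp_mx oc oO _ (sphi ac) sg).
by move=> x [_ /UO].
Qed.

Lemma smoothM_of_chartR (g : 'rV[R]_n -> R) (h : M -> R) :
  (forall m, U m -> h m = g (phi c' m)) -> smooth_on O g -> smoothM U h.
Proof.
move=> E sg c ac; have oc := open_cod_psi (c := c) oU.
apply: (smooth_on_eq oc (f := fun x => g (phi c' (psi c x)))).
  by move=> x [_ /E].
apply: (smooth_on_comp oc _ (sphi ac) sg).
by move=> x [_ /UO].
Qed.

End OfChart.

Lemma smoothM_continuous (W : normedModType R) U (h : M -> W) : open U -> smoothM U h ->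
  forall m, U m -> {for m, continuous h}.
Proof.
move=> oU sh m Um; have [c ac dm] := atlas_cover m.
have cx : cod c (phi c m) /\ U (psi c (phi c m)).
  by rewrite phiK //; split=> //; exact: phi_cod.
have ch := smooth_on_continuous (sh c ac) cx.
have ch' : {for m, continuous ((fun x => h (psi c x)) \o phi c)}.
  by apply: continuous_comp; [exact: phi_cont|exact: ch].
move: ch'; rewrite /prop_for /continuous_at /= phiK //; apply: cvg_trans.
apply: near_eq_cvg; have := open_nbhs_nbhs (conj (@dom_open _ _ _ c) dm).
by apply: filterS => m' dm' /=; rewrite phiK.
Qed.

Lemma Jm_id c m : dom c m -> Jm c c m = 1%:M.
Proof.
move=> dm; rewrite Jm.unlock -(jacobian_id (phi c m)); symmetry; apply: jacobian_near.
  exact: ex_diff.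
have := open_nbhs_nbhs (conj (@cod_open _ _ _ c) (phi_cod dm)).
by apply: filterS => x cx; rewrite /local_rep psiK.
Qed.

Section Jac.
Variables (c c' : chart R M n).
Hypotheses (ac : atlas M c) (ac' : atlas M c').

Lemma local_dom_phi m : dom c m -> dom c' m -> local_dom id c c' (phi c m).
Proof. by move=> dm dm'; split; [exact: phi_cod|rewrite phiK]. Qed.

Lemma trans_phi m : dom c m -> local_rep id c c' (phi c m) = phi c' m.
Proof. by move=> dm; rewrite /local_rep phiK. Qed.

Lemma trans_differentiable m : dom c m -> dom c' m ->
  differentiable (local_rep id c c') (phi c m).
Proof.
by move=> dm dm'; apply: smooth_on_differentiable (trans_smooth ac ac') _ (local_dom_phi dm dm').
Qed.

Lemma Jm_smooth : smoothM (dom c `&` dom c') (Jm c c').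
Proof.
rewrite Jm.unlock; apply: (smoothM_of_chart ac (O := local_dom id c c') _ _ _ _ (g := fun x => 'J (local_rep id c c') x)) => //.
- by apply: openI; exact: dom_open.
- exact: open_local_dom_id.
- by move=> m [dm dm']; exact: local_dom_phi.
- by apply: smooth_jacobian; [exact: open_local_dom_id|exact: trans_smooth].
Qed.

End Jac.

Lemma Jm_comp c c' c'' m : atlas M c -> atlas M c' -> atlas M c'' ->
  dom c m -> dom c' m -> dom c'' m -> Jm c c' m *m Jm c' c'' m = Jm c c'' m.
Proof.
move=> ac ac' ac'' dm dm' dm''; rewrite Jm.unlock.
have d1 := trans_differentiable ac ac' dm dm'.
have d2 := trans_differentiable ac' ac'' dm' dm''.
have d3 := trans_differentiable ac ac'' dm dm''.
transitivity ('J (local_rep id c' c'' \o local_rep id c c') (phi c m)).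
  by rewrite jacobian_comp ?trans_phi.
symmetry; apply: jacobian_near => //.
have := open_nbhs_nbhs (conj (@open_local_dom_id c c') (local_dom_phi dm dm')).
by apply: filterS => x [cx dx]; rewrite /local_rep /= phiK.
Qed.

Lemma Jm_inv c c' m : atlas M c -> atlas M c' -> dom c m -> dom c' m ->
  Jm c c' m *m Jm c' c m = 1%:M.
Proof. by move=> ac ac' dm dm'; rewrite (Jm_comp ac ac' ac) //; exact: Jm_id. Qed.

Section Form.
Variable eta : one_form M.

Notation acol := (acol eta).
Notation Bmx := (Bmx eta).
Notation Cmx := (Cmx eta).

Section Compat.
Variables (c c' : chart R M n) (m : M).
Hypotheses (ac : atlas M c) (ac' : atlas M c') (dm : dom c m) (dm' : dom c' m).

Lemma acol_compat : acol c m = Jm c c' m *m acol c' m.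
Proof.
rewrite acol.unlock Jm.unlock (pullback_formcol (w := eta c) (w' := eta c') (tau := local_rep id c c')
  (U := local_dom id c c') (O := cod c')).
- by rewrite trans_phi.
- by move=> x [cx dx]; exact: phi_cod.
- by move=> y cy; exact: form_linear.
- by move=> x v dx; exact: form_compat.
- exact: local_dom_phi.
Qed.

Lemma Bmx_compat : Bmx c m = Jm c c' m *m Bmx c' m *m (Jm c c' m)^T.
Proof.
rewrite Bmx.unlock Jm.unlock (pullback_formmx (w := eta c) (w' := eta c') (tau := local_rep id c c')
  (U := local_dom id c c') (O := cod c')).
- by rewrite trans_phi.
- exact: open_local_dom_id.
- exact: cod_open.
- by move=> x [cx dx]; exact: phi_cod.
- exact: trans_smooth.
- by move=> y cy; exact: form_linear.
- by move=> v; exact: form_smooth.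
- by move=> x v dx; exact: form_compat.
- exact: local_dom_phi.
Qed.

Lemma Cmx_compat (v : 'rV[R]_n) : acol c m != 0 -> acol c' m != 0 ->
  v *m Cmx c m = 0 -> v *m Jm c c' m *m Cmx c' m = 0.
Proof.
move=> a0 a0'; rewrite Cmx.unlock; apply: charmx_congr => //; first exact: acol_compat.
  exact: Bmx_compat.
exact: Jm_inv.
Qed.

End Compat.

End Form.

End ManifoldCalculus.

(** * The characteristic distribution and a projection onto it *)

(** Every point has a basic open neighbourhood inside some [Q s]. Choosing one such [s] for each
    number of a basic set, and [s0] for the other numbers, leaves a countable cover. *)
Lemma lindelof_nat (T : topologicalType) (S : Type) (Q : S -> set T) (s0 : S) :
  @second_countable T -> (forall t : T, exists s, nbhs t (Q s)) ->
  exists f : nat -> S, forall t : T, exists j, nbhs t (Q (f j)).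
Proof.
move=> [B /countable_injP [g ginj] [Bo Bn]] H.
have /choice [f Hf] : forall j, exists s',
    (exists U s, [/\ B U, g U = j & U `<=` Q s]) ->
    exists U, [/\ B U, g U = j & U `<=` Q s'].
  move=> j.
  have [[U [s [BU gU Us]]]|ne] := pselect (exists U s, [/\ B U, g U = j & U `<=` Q s]).
    by exists s => _; exists U.
  by exists s0.
exists f => t; have [s /Bn [U [BU Ut] Us]] := H t.
have [U' [BU' gU' Uf]] := Hf (g U) (ex_intro _ U (ex_intro _ s (And3 BU erefl Us))).
have UU : U' = U by apply: ginj => //; exact/mem_set.
exists (g U); apply: filterS Uf _; rewrite UU.
by apply: open_nbhs_nbhs; split=> //; exact: Bo.
Qed.

Section Frames.
Variables (R : realType) (n : nat) (M : manifold R n) (eta : one_form M) (q k : nat).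
Hypothesis nqk : n = (q + k)%N.
Hypothesis acol_neq0 : forall c m, atlas M c -> dom c m -> acol eta c m != 0.
Hypothesis Cmx_rank : forall c m, atlas M c -> dom c m -> \rank (Cmx eta c m) = q.

(* [fF] is a frame of the characteristic distribution over [fW], with constant
   left inverse [fG], and [ff] is a smooth function supported in [fK]. *)
Record frame_data := FrameData {
  fc : chart R M n; fW : set M; fK : set M;
  fF : M -> 'M[R]_(k, n); fG : 'M[R]_(n, k); ff : M -> R;
  fc_atlas : atlas M fc;
  fW_open : open fW;
  fW_dom : fW `<=` dom fc;
  fF_smooth : smoothM fW fF;
  fFG : forall m, fW m -> fF m *m fG = 1%:M;
  fF_ker : forall m, fW m -> (fF m :=: kermx (Cmx eta fc m))%MS;
  ff_smooth : smoothM setT ff;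
  fK_closed : closed fK;
  fK_W : fK `<=` fW;
  ff_out : forall m, ~ fK m -> ff m = 0 }.

Lemma Cmx_psi c x : cod c x ->
  Cmx eta c (psi c x) = charmx (formcol (eta c x)) (formmx (extd (eta c) x)).
Proof. by move=> cx; rewrite Cmx.unlock acol.unlock Bmx.unlock psiK. Qed.

Lemma exists_frame_data (m0 : M) :
  exists D : frame_data, nbhs m0 [set m | ff D m = 1].
Proof.
have [c ac dm0] := atlas_cover m0.
pose x0 := phi c m0; have cx0 : cod c x0 by exact: phi_cod.
pose C x := charmx (formcol (eta c x)) (formmx (extd (eta c) x)).
have oc := @cod_open _ _ _ c.
have sC : smooth_on (cod c) C.
  have sa : smooth_on (cod c) (fun x => formcol (eta c x)).
    by apply: smooth_formcol => // v; exact: form_smooth.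
  have sB : smooth_on (cod c) (fun x => formmx (extd (eta c) x)).
    by apply: smooth_formmx => // v; exact: form_smooth.
  have saT : smooth_on (cod c) (fun x => (formcol (eta c x))^T) by exact: smooth_on_trmx.
  apply: smooth_on_row_mx => //; apply: smooth_on_mulmx => //.
  apply: smooth_on_mx => // i j.
  apply: (smooth_on_eq oc (f := fun x =>
    ((formcol (eta c x))^T *m formcol (eta c x)) 0 0 * (1%:M : 'M[R]_n) i j -
    (formcol (eta c x) *m (formcol (eta c x))^T) i j)).
    by move=> x _; rewrite [RHS]mxE [X in _ = X + _]mxE [X in _ = _ + X]mxE.
  apply: smooth_onB => //; last by apply: smooth_on_coord => //; exact: smooth_on_mulmx.
  apply: smooth_onM => //; last exact: smooth_on_cst.
  by apply: smooth_on_coord => //; exact: smooth_on_mulmx.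
have rC x : cod c x -> \rank (C x) = q.
  by move=> cx; rewrite /C -Cmx_psi //; apply: Cmx_rank => //; exact: psi_dom.
have [Ob [F [G [oO Ox0 Oc sF FG]]]] : exists (O : set 'rV[R]_n)
    (F : 'rV[R]_n -> 'M[R]_(k, n)) (G : 'M[R]_(n, k)),
    [/\ open O, O x0, O `<=` cod c, smooth_on O F &
      forall x, O x -> F x *m G = 1%:M /\ (F x :=: kermx (C x))%MS].
  have L n' p (U : set 'rV[R]_n) (C' : 'rV[R]_n -> 'M[R]_(n', p)) :
      n' = (q + k)%N -> open U -> U x0 -> smooth_on U C' ->
      (forall x, U x -> \rank (C' x) = q) ->
      exists (O : set 'rV[R]_n) (F : 'rV[R]_n -> 'M[R]_(k, n')) (G : 'M[R]_(n', k)),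
      [/\ open O, O x0, O `<=` U, smooth_on O F &
        forall x, O x -> F x *m G = 1%:M /\ (F x :=: kermx (C' x))%MS].
    by move=> E; move: C'; rewrite E => C'; exact: exists_local_frame.
  exact: L.
have /nbhs_ballP [e e0 eO] : nbhs x0 Ob by exact: open_nbhs_nbhs.
(* The bump is supported in the closed ball of radius 2r, which must lie in the open ball of radius
   e. *)
pose r := e / 3; have r0 : 0 < r by rewrite divr_gt0.
have [B [sB B1 B0]] := smooth_bump x0 r0.
pose A := [set x | `|x - x0| <= 2 * r].
have AO : A `<=` Ob.
  move=> x Ax; apply: eO; rewrite -ball_normE /= distrC.
  by apply: (le_lt_trans Ax); move: e0; rewrite /r /=; lra.
have cA : compact A.
  apply: bounded_closed_compact.
    exists (2 * r + `|x0|); split; first exact: num_real.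
    move=> t ht x Ax; apply: ltW; apply: le_lt_trans ht.
    by rewrite -[x](subrK x0); apply: (le_trans (ler_normD _ _)); rewrite lerD2r.
  rewrite (_ : A = (fun x => `|x - x0|) @^-1` [set t | t <= 2 * r]) //.
  apply: closed_comp; last exact: closed_le.
  move=> x _; apply: continuous_comp; last exact: norm_continuous.
  exact: (cvgB cvg_id (cvg_cst _)).
(* A compact image, closed because [M] is Hausdorff; the complement of [K] is thus open, and the
   bump extended by zero is smooth on all of [M]. *)
pose K := psi c @` A.
have cK : closed K.
  apply: compact_closed; first exact: manifold_hausdorff.
  apply: continuous_compact => //; apply: continuous_in_subspaceT => x /set_mem Ax.
  by apply: psi_cont; apply: Oc; exact: AO.
pose W := [set m | dom c m /\ Ob (phi c m)].
have KW : K `<=` W.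
  move=> _ [x Ax <-]; have cx := Oc _ (AO _ Ax).
  by split; [exact: psi_dom|rewrite psiK //; exact: AO].
pose f (m : M) := if `[< dom c m >] then B (phi c m) else 0.
have fdom m : dom c m -> f m = B (phi c m) by move=> dm; rewrite /f asboolT.
have fout m : ~ K m -> f m = 0.
  move=> nK; rewrite /f; case: asboolP => // dm; apply: B0.
  rewrite leNgt; apply/negP => /ltW Am; apply: nK.
  by exists (phi c m) => //; exact: phiK.
have sf : smoothM setT f.
  apply: smoothM_local => m _; have [dm|ndm] := pselect (dom c m).
    exists (dom c); first by split=> //; exact: dom_open.
    apply: (smoothM_of_chartR ac (O := setT) _ _ _ _ (g := B)) => //.
    exact: dom_open.
  have nK : ~ K m by move=> /KW [].
  exists (~` K); first by split=> //; exact: closed_openC.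
  apply: (smoothM_eq (closed_openC cK) (h := fun=> 0)); last exact: smoothM_cst.
  by move=> m' /fout ->.
have oW : open W by exact: open_dom_phi.
have Wd : W `<=` dom c by move=> m [].
have sFM : smoothM W (fun m => F (phi c m)).
  apply: (smoothM_of_chart ac (O := Ob) _ _ _ _ (g := F)) => //.
  by move=> m [].
have FGM m : W m -> F (phi c m) *m G = 1%:M by move=> [_ /FG []].
have FK m : W m -> (F (phi c m) :=: kermx (Cmx eta c m))%MS.
  move=> [dm Om]; have [_] := FG _ Om.
  by rewrite /C -Cmx_psi ?phiK //; exact: phi_cod.
exists (FrameData ac oW Wd sFM FGM FK sf cK KW fout) => /=.
have : nbhs m0 [set m | dom c m /\ ball x0 r (phi c m)].
  apply: open_nbhs_nbhs; split; last by split=> //; exact: ballxx.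
  by apply: open_dom_phi; exact: ball_open.
apply: filterS => m [dm bm] /=; rewrite fdom //; apply: B1.
by move: bm; rewrite -ball_normE /= distrC => /ltW.
Qed.

(** * Partition of unity, global projection and dual cocycle *)

Section Partition.
Variables (D : nat -> frame_data) (N : M -> nat).
Hypothesis HD : forall m : M, exists j, nbhs m [set m' | ff (D j) m' = 1].
Hypothesis HN : forall m, ff (D (N m)) m = 1.

(** A partition of unity: the partial sums telescope, and where [ff (D j)] is 1 all later terms
    vanish. By [HD] this happens near every point. *)
Definition rho j (m : M) : R := ff (D j) m * \prod_(i < j) (1 - ff (D i) m).

Lemma sum_rho l m : \sum_(j < l) rho j m = 1 - \prod_(i < l) (1 - ff (D i) m).
Proof.
elim: l => [|l IH]; first by rewrite !big_ord0 subrr.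
by rewrite !big_ord_recr /= IH /rho; ring.
Qed.

Lemma rho_eq0 i j m : ff (D j) m = 1 -> (j < i)%N -> rho i m = 0.
Proof.
move=> fj ji; apply/eqP; rewrite mulf_eq0; apply/orP; right.
by apply/prodf_eq0; exists (Ordinal ji) => //=; rewrite fj subrr.
Qed.

Lemma sum_rho1 j m : ff (D j) m = 1 -> \sum_(i < j.+1) rho i m = 1.
Proof. by move=> fj; rewrite sum_rho big_ord_recr /= fj subrr mulr0 subr0. Qed.

Lemma rho_smooth j : smoothM setT (rho j).
Proof.
have oT : open [set: M] by exact: openT.
apply: smoothMM => //; first exact: ff_smooth.
apply: (@smoothM_prod _ _ _ setT _ _ _ (fun (i : 'I_j) m => 1 - ff (D i) m)) => // i _ c ac.
apply: smooth_onB; [exact: open_cod_psi|exact: smooth_on_cst|exact: ff_smooth].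
Qed.

Lemma rho_out j m : ~ fW (D j) m -> rho j m = 0.
Proof.
move=> nW; rewrite /rho (@ff_out (D j) m) ?mul0r // => Km.
by apply: nW; exact: fK_W.
Qed.

(** Since [fF *m fG = 1], the product [fG *m fF] is a projection onto the span of the j-th frame;
    the Jacobians conjugate it to the chart [c]. *)
Definition Tm j c m : 'M[R]_n :=
  Jm c (fc (D j)) m *m fG (D j) *m fF (D j) m *m Jm (fc (D j)) c m.

(* A smooth projection of the tangent bundle onto the characteristic
   distribution, acting on row vectors in the chart [c]. *)
Definition Pmx c m : 'M[R]_n := \sum_(j < (N m).+1) rho j m *: Tm j c m.

(** The bound [N m] comes from a choice and need not be locally constant; near a point it can be
    replaced by a fixed [j], which is what smoothness requires. *)
Lemma PmxE j c m : ff (D j) m = 1 -> Pmx c m = \sum_(i < j.+1) rho i m *: Tm i c m.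
Proof.
have L i l : ff (D i) m = 1 -> (i.+1 <= l)%N ->
    \sum_(j < l) rho j m *: Tm j c m = \sum_(j < i.+1) rho j m *: Tm j c m.
  move=> fi il; rewrite -!(big_mkord xpredT (fun j => rho j m *: Tm j c m)).
  rewrite (@big_cat_nat _ _ _ i.+1) //= [X in _ + X]big_nat_cond [X in _ + X]big1 ?addr0 //.
  by move=> j'; rewrite andbT => /andP[ij _]; rewrite (rho_eq0 fi) ?scale0r.
move=> fj; rewrite /Pmx.
rewrite -(L j (maxn j.+1 (N m).+1)) ?leq_maxl //.
by rewrite -(L (N m) (maxn j.+1 (N m).+1)) ?leq_maxr.
Qed.

Lemma Pmx_smooth c : atlas M c -> smoothM (dom c) (Pmx c).
Proof.
move=> ac; apply: smoothM_local => m dm.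
have [j Hj] := HD m.
pose O := [set m' | ff (D j) m' = 1]° `&` dom c.
have oO : open O by apply: openI; [exact: open_interior|exact: dom_open].
exists O; first by split.
apply: (smoothM_eq oO (h := fun m => \sum_(i < j.+1) rho i m *: Tm i c m)).
  by move=> m' [/interior_subset fm' _]; rewrite (PmxE _ fm').
apply: smoothM_sub (O) _ _ (_ : smoothM (dom c) _); first by move=> m' [].
apply: (@smoothM_sum _ _ _ _ _ (@dom_open _ _ _ c) _ _ _ (fun (i : 'I_j.+1) m => rho i m *: Tm i c m)) => i _.
apply: smoothM_local => m' dm'; have [Wm'|nWm'] := pselect (fW (D i) m').
  have oW : open (fW (D i) `&` dom c) by apply: openI; [exact: fW_open|exact: dom_open].
  exists (fW (D i) `&` dom c); first by [].
  have sub1 : fW (D i) `&` dom c `<=` dom c `&` dom (fc (D i)).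
    by move=> m'' [W'' d'']; split=> //; exact: fW_dom.
  have sub2 : fW (D i) `&` dom c `<=` dom (fc (D i)) `&` dom c.
    by move=> m'' [W'' d'']; split=> //; exact: fW_dom.
  apply: smoothM_scale => //; first by apply: smoothM_sub (rho_smooth i).
  apply: smoothM_mulmx => //; last first.
    by apply: smoothM_sub sub2 _; apply: Jm_smooth => //; exact: fc_atlas.
  apply: smoothM_mulmx => //; last by apply: smoothM_sub (@fF_smooth (D i)) => m'' [].
  apply: smoothM_mulmx => //; last exact: smoothM_cst.
  by apply: smoothM_sub sub1 _; apply: Jm_smooth => //; exact: fc_atlas.
have nK : ~ fK (D i) m' by move=> /fK_W.
have oK : open (~` fK (D i)) by apply: closed_openC; exact: fK_closed.
exists (~` fK (D i)); first by [].
apply: (smoothM_eq oK (h := fun=> 0)); last exact: smoothM_cst.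
by move=> m'' nK''; rewrite /rho ff_out // mul0r scale0r.
Qed.

Lemma frame_sub j c m : atlas M c -> dom c m -> fW (D j) m ->
  fF (D j) m *m Jm (fc (D j)) c m *m Cmx eta c m = 0.
Proof.
move=> ac dm Wm; have dj := fW_dom Wm; have aj := fc_atlas (D j).
apply/row_matrixP => i; rewrite row0 2!row_mul; apply: Cmx_compat => //.
- exact: acol_neq0.
- exact: acol_neq0.
by rewrite -row_mul (sub_kermxP _) ?row0 //; rewrite (fF_ker Wm).
Qed.

Lemma frame_span j m (v : 'rV[R]_n) : fW (D j) m -> v *m Cmx eta (fc (D j)) m = 0 ->
  v *m fG (D j) *m fF (D j) m = v.
Proof.
move=> Wm /sub_kermxP; rewrite -(fF_ker Wm) => /submxP [y ->].
by rewrite -(mulmxA y) fFG // mulmx1.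
Qed.

Section AtPoint.
Variables (c : chart R M n) (m : M).
Hypotheses (ac : atlas M c) (dm : dom c m).

Lemma Pmx_ker : Pmx c m *m Cmx eta c m = 0.
Proof.
rewrite /Pmx mulmx_suml big1 // => j _; rewrite -scalemxAl.
have [Wm|/rho_out ->] := pselect (fW (D j) m); last by rewrite scale0r.
by rewrite /Tm -!mulmxA (mulmxA (fF _ _)) frame_sub // !mulmx0 scaler0.
Qed.

(** Each local projection fixes the characteristic distribution, and the weights sum to 1. *)
Lemma Pmx_proj (v : 'rV[R]_n) : v *m Cmx eta c m = 0 -> v *m Pmx c m = v.
Proof.
move=> vC; rewrite /Pmx mulmx_sumr -[RHS]scale1r -(sum_rho1 (HN m)) scaler_suml.
apply: eq_bigr => j _; rewrite -scalemxAr.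
have [Wm|/rho_out ->] := pselect (fW (D j) m); last by rewrite !scale0r.
have dj := fW_dom Wm; have aj := fc_atlas (D j).
congr (_ *: _); rewrite /Tm !mulmxA (frame_span Wm); last first.
  by apply: Cmx_compat => //; exact: acol_neq0.
by rewrite -mulmxA Jm_inv // mulmx1.
Qed.

Lemma Pmx_compat c' : atlas M c' -> dom c' m ->
  Pmx c m *m Jm c c' m = Jm c c' m *m Pmx c' m.
Proof.
move=> ac' dm'; rewrite /Pmx mulmx_suml mulmx_sumr; apply: eq_bigr => j _.
rewrite -scalemxAl -scalemxAr.
have [Wm|/rho_out ->] := pselect (fW (D j) m); last by rewrite !scale0r.
have dj := fW_dom Wm; have aj := fc_atlas (D j).
congr (_ *: _); rewrite /Tm -!mulmxA Jm_comp // !mulmxA.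
by rewrite Jm_comp.
Qed.

End AtPoint.

(** The coordinates, in the j-th frame, of the projection of a tangent vector:
    [theta j m *m fF (D j) m] is the projection itself. *)
Definition theta j m : 'M[R]_(n, k) := Pmx (fc (D j)) m *m fG (D j).

(** The untransposed matrix expresses the j-th frame in the i-th one. A covector is given by the row
    of its values on the frame, so these rows transform by the transpose: the cocycle of the dual
    bundle. *)
Definition gmx i j m : 'M[R]_k :=
  (fF (D j) m *m Jm (fc (D j)) (fc (D i)) m *m fG (D i))^T.

Lemma theta_smooth j : smoothM (dom (fc (D j))) (theta j).
Proof.
have od := @dom_open _ _ _ (fc (D j)).
apply: smoothM_mulmx => //; first by apply: Pmx_smooth; exact: fc_atlas.
exact: smoothM_cst.
Qed.

Lemma gmx_smooth i j : smoothM (fW (D i) `&` fW (D j)) (gmx i j).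
Proof.
have oW : open (fW (D i) `&` fW (D j)) by apply: openI; exact: fW_open.
apply: smoothM_trmx => //; apply: smoothM_mulmx => //; last exact: smoothM_cst.
apply: smoothM_mulmx => //; first by apply: smoothM_sub (@fF_smooth (D j)) => m [].
apply: smoothM_sub (Jm_smooth (fc_atlas (D j)) (fc_atlas (D i))) => m [Wi Wj].
by split; exact: fW_dom.
Qed.

Lemma gmx_id i m : fW (D i) m -> gmx i i m = 1%:M.
Proof.
move=> Wi; rewrite /gmx Jm_id; last exact: fW_dom.
by rewrite mulmx1 fFG // trmx1.
Qed.

Lemma gmx_comp i j l m : fW (D i) m -> fW (D j) m -> fW (D l) m ->
  gmx i j m *m gmx j l m = gmx i l m.
Proof.
move=> Wi Wj Wl; have ai := fc_atlas (D i); have aj := fc_atlas (D j).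
have al := fc_atlas (D l); have di := fW_dom Wi; have dj := fW_dom Wj; have dl := fW_dom Wl.
rewrite /gmx -trmx_mul; congr (_^T).
set X := fF (D l) m *m Jm (fc (D l)) (fc (D j)) m.
have XE : X *m fG (D j) *m fF (D j) m = X.
  apply/row_matrixP => a; rewrite 2!row_mul (frame_span Wj) //.
  by rewrite -row_mul frame_sub // row0.
by rewrite !mulmxA XE /X -(mulmxA _ (Jm _ _ _) (Jm _ _ _)) Jm_comp.
Qed.

Lemma fF_theta j m : fW (D j) m -> fF (D j) m *m theta j m = 1%:M.
Proof.
move=> Wj; have dj := fW_dom Wj; have aj := fc_atlas (D j).
rewrite /theta mulmxA -(fFG Wj); congr (_ *m _); apply/row_matrixP => i.
rewrite row_mul Pmx_proj // -row_mul (_ : _ *m _ = 0) ?row0 //.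
by have := frame_sub aj dj Wj; rewrite Jm_id // mulmx1.
Qed.

(** Both sides are the coefficient column of the same 1-form v |-> alpha (p v), with the covector
    alpha written in the i-th and in the j-th frame; this makes the tautological part of the contact
    form well defined. *)
Lemma theta_compat i j m (y : 'rV[R]_k) : fW (D i) m -> fW (D j) m ->
  theta i m *m y^T = Jm (fc (D i)) (fc (D j)) m *m theta j m *m (y *m gmx i j m)^T.
Proof.
move=> Wi Wj; have ai := fc_atlas (D i); have aj := fc_atlas (D j).
have di := fW_dom Wi; have dj := fW_dom Wj.
have E : theta j m *m fF (D j) m = Pmx (fc (D j)) m.
  apply/row_matrixP => a; rewrite /theta 2!row_mul (frame_span Wj) //.
  by rewrite -row_mul Pmx_ker // row0.
rewrite trmx_mul /gmx trmxK.
set J := Jm (fc (D i)) _ m; set J' := Jm (fc (D j)) _ m.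
have -> : J *m theta j m *m (fF (D j) m *m J' *m fG (D i) *m y^T) =
    J *m (theta j m *m fF (D j) m) *m J' *m fG (D i) *m y^T by rewrite !mulmxA.
rewrite E /J -Pmx_compat // -(mulmxA _ (Jm _ _ _)) Jm_inv // mulmx1.
by [].
Qed.

End Partition.
End Frames.

(** * Topology from countably many charts *)

Lemma open_chart_preimage (R : realType) (T : topologicalType) n (c : chart R T n)
    (W : set T) : open W -> open [set x | cod c x /\ W (psi c x)].
Proof. by move=> oW; apply: open_preimage_on => //; [exact: cod_open|exact: psi_cont]. Qed.

Lemma continuous_initial_at (X : topologicalType) (Y : choiceType) (Z : topologicalType)
    (w : Y -> Z) (f : X -> initial_topology w) x :
  {for x, continuous (w \o f)} -> {for x, continuous f}.
Proof.
move=> cf U [?/= [[W oW <-]]] /= Wsfz /filterS; apply; apply: cf.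
exact: open_nbhs_nbhs.
Qed.

Lemma hausdorff_separated (T : topologicalType) :
  (forall x y : T, x <> y -> exists (S : topologicalType) (f : T -> S),
    [/\ hausdorff_space S, continuous f & f x <> f y]) -> hausdorff_space T.
Proof.
move=> H; rewrite open_hausdorff => x y /eqP /H [S [f [hS cf /eqP fxy]]].
move: hS; rewrite open_hausdorff => /(_ _ _ fxy) [[A B] /= [xA yB] [oA oB /eqP AB]].
exists (f @^-1` A, f @^-1` B) => /=.
  by move: xA yB; rewrite !inE.
split; [by apply: open_comp => // z _; exact: cf|by apply: open_comp => // z _; exact: cf|].
by rewrite -preimage_setI AB preimage_set0.
Qed.

Section RationalBoxes.
Variable R : realType.

Definition rat_box N (ab : 'rV[rat]_N * 'rV[rat]_N) : set 'rV[R]_N :=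
  [set x | forall j, ratr (ab.1 0 j) < x 0 j < ratr (ab.2 0 j)].

Lemma rat_box_open N ab : open (@rat_box N ab).
Proof.
rewrite openE => x xab.
have H (j : 'I_N) : nbhs (x 0 j) [set y | ratr (ab.1 0 j) < y < ratr (ab.2 0 j)].
  have /andP[h1 h2] := xab j.
  by near=> y; apply/andP; split; near: y; [exact: lt_nbhsr|exact: lt_nbhsl].
exists (fun _ j => [set y | ratr (ab.1 0 j) < y < ratr (ab.2 0 j)]).
  by move=> i j; rewrite ord1; exact: H.
by move=> y hy j; exact: hy.
Unshelve. all: by end_near. Qed.

Lemma rat_box_basis N (x : 'rV[R]_N) (U : set 'rV[R]_N) : nbhs x U ->
  exists ab, rat_box ab x /\ rat_box ab `<=` U.
Proof.
move=> /nbhs_ballP [e /= e0 eU].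
have Ha j : exists a : rat, x 0 j - e < ratr a < x 0 j.
  have [|a] := @rat_in_itvoo R (x 0 j - e) (x 0 j); first by rewrite gtrBl.
  by rewrite in_itv /= => ?; exists a.
have Hb j : exists b : rat, x 0 j < ratr b < x 0 j + e.
  have [|b] := @rat_in_itvoo R (x 0 j) (x 0 j + e); first by rewrite ltrDl.
  by rewrite in_itv /= => ?; exists b.
have [a ha] := choice Ha; have [b hb] := choice Hb.
exists (\row_j a j, \row_j b j); split=> [j|y hy].
  by rewrite /= !mxE; have /andP[_ ->] := ha j; have /andP[-> _] := hb j.
apply: eU; split=> // i j; rewrite ord1 /ball /= ltr_norml.
have := hy j; rewrite /= !mxE; have := ha j; have := hb j.
move: (ratr _ : R) (ratr _ : R) (x 0 j) (y 0 j) => b' a' x' y'.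
move=> /andP[? ?] /andP[? ?] /andP[? ?]; apply/andP; split; lra.
Qed.

(** The basis consists of the preimages of boxes with rational corners under the countably many
    charts. *)
Lemma second_countable_charts (T : topologicalType) N (C : nat -> chart R T N) :
  (forall t, exists i, dom (C i) t) -> @second_countable T.
Proof.
move=> cov; pose b (z : nat * ('rV[rat]_N * 'rV[rat]_N)) : set T :=
  [set t | dom (C z.1) t /\ rat_box z.2 (phi (C z.1) t)].
exists (range b).
  by apply: card_le_trans (card_image_le _ _) _; exact: countableP.
split=> [_ [[i ab] _ <-]|t U nU].
  by apply: open_preimage_on; [exact: dom_open|exact: phi_cont|exact: rat_box_open].
have [i di] := cov t; pose x := phi (C i) t.
have cx : cod (C i) x by exact: phi_cod.
have nx : nbhs x [set y | cod (C i) y /\ U (psi (C i) y)].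
  apply: filterI; first by apply: open_nbhs_nbhs; split=> //; exact: cod_open.
  by apply: (psi_cont cx); rewrite phiK.
have [ab [xab abU]] := rat_box_basis nx.
exists (b (i, ab)); first by split=> //; exists (i, ab).
by move=> t' [/= dt' bt']; have [_] := abU _ bt'; rewrite phiK.
Qed.

End RationalBoxes.

(** * The total space *)

Section TotalSpace.
Variables (R : realType) (n k : nat) (M : manifold R n).
Variables (c : nat -> chart R M n) (W K : nat -> set M) (f : nat -> M -> R).
Variable g : nat -> nat -> M -> 'M[R]_k.
Hypothesis ac : forall i, atlas M (c i).
Hypothesis oW : forall i, open (W i).
Hypothesis Wdom : forall i, W i `<=` dom (c i).
Hypothesis cK : forall i, closed (K i).
Hypothesis KW : forall i, K i `<=` W i.
Hypothesis sf : forall i, smoothM setT (f i).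
Hypothesis f_out : forall i m, ~ K i m -> f i m = 0.
Hypothesis sg : forall i j, smoothM (W i `&` W j) (g i j).
Hypothesis g_id : forall i m, W i m -> g i i m = 1%:M.
Hypothesis g_comp : forall i j l m, W i m -> W j m -> W l m ->
  g i j m *m g j l m = g i l m.
Hypothesis f_cover : forall m, exists i, f i m != 0.

Variable Q : nat -> M -> 'rV[R]_k -> Prop.
(** [P] is a condition on points of the bundle through their coordinates in a trivialization; [Q]
    cuts out the open neighbourhood of the zero section that becomes the total space. *)
Definition fiber_dom i (P : nat -> M -> 'rV[R]_k -> Prop) : set 'rV[R]_(n + k) :=
  [set x | [/\ cod (c i) (lsubmx x), W i (psi (c i) (lsubmx x)) &
    P i (psi (c i) (lsubmx x)) (rsubmx x)]].
Hypothesis oQ : forall i, open (fiber_dom i Q).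
Hypothesis Q0 : forall i m, W i m -> Q i m 0.
Hypothesis Q_compat : forall i j m y, W i m -> W j m -> Q i m y -> Q j m (y *m g i j m).

Lemma fW_of_neq0 i m : f i m != 0 -> W i m.
Proof.
move=> fm; apply: KW; apply: contrapT => /f_out E.
by move: fm; rewrite E eqxx.
Qed.

Lemma smooth_pull (U : set M) i p q
    (h' : M -> 'M[R]_(p, q)) : open U -> smoothM U h' ->
  smooth_on [set x : 'rV[R]_(n + k) | cod (c i) (lsubmx x) /\ U (psi (c i) (lsubmx x))]
    (fun x => h' (psi (c i) (lsubmx x))).
Proof.
move=> oU sh.
pose A := [set x | cod (c i) x /\ U (psi (c i) x)].
have oA : open A by exact: open_chart_preimage.
have oA' : open ((lsubmx : 'rV[R]_(n + k) -> 'rV[R]_n) @^-1` A).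
  by apply: open_comp => // x _; exact: continuous_lsubmx.
apply: (@smooth_on_comp_mx R _ _ n p q A lsubmx (fun y => h' (psi (c i) y))) => //.
- by apply: smooth_on_lsubmx => //; exact: smooth_on_id.
- exact: sh.
Qed.

(** [g i j] is controlled only over [W j]; the cut-off vanishes off the closed set [K j] inside
    [W j], so the product extends smoothly by zero to [W i]. *)
Lemma smoothM_fg i j : smoothM (W i) (fun m => f j m *: g i j m).
Proof.
apply: smoothM_local => m Wi; have [Wj|nWj] := pselect (W j m).
  have oij : open (W i `&` W j) by exact: openI.
  exists (W i `&` W j); first by [].
  by apply: smoothM_scale => //; apply: smoothM_sub (sf j).
have oKj : open (~` K j) by exact: closed_openC.
exists (~` K j); first by split=> // /KW.
apply: (smoothM_eq oKj (h := fun=> 0)); last exact: smoothM_cst.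
by move=> m' /f_out ->; rewrite scale0r.
Qed.

Definition bundle_pt i m (y : 'rV[R]_k) : M * {ptws nat -> 'rV[R]_k} :=
  (m, fun j => f j m *: (y *m g i j m)).

(* A vector with coordinates [y] over [m] in the [i]-th trivialization is encoded
   by its coordinates in all the trivializations, cut off by the [f j]. *)
Definition total_set : set (M * {ptws nat -> 'rV[R]_k}) :=
  [set e | exists i y, [/\ f i e.1 != 0, Q i e.1 y & e = bundle_pt i e.1 y]].

Definition total : topologicalType := set_type total_set.

Definition tval (e : total) : M * {ptws nat -> 'rV[R]_k} := set_val e.
Definition tbase (e : total) : M := (tval e).1.
Definition tfib (e : total) j : 'rV[R]_k := (tval e).2 j.

Lemma tval_inj : injective tval.
Proof. exact: val_inj. Qed.

Lemma tval_continuous : continuous tval.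
Proof. exact: initial_continuous. Qed.

Lemma tbase_continuous : continuous tbase.
Proof.
move=> e; apply: (@continuous_comp _ _ _ tval fst); first exact: tval_continuous.
exact: cvg_fst.
Qed.

Lemma tfib_continuous j : continuous (tfib ^~ j).
Proof.
move=> e; apply: (@continuous_comp _ _ _ tval (fun p => p.2 j)).
  exact: tval_continuous.
apply: (@continuous_comp _ _ _ snd (fun p : {ptws nat -> 'rV[R]_k} => p j)).
  exact: cvg_snd.
exact: (@proj_continuous nat (fun=> 'rV[R]_k) j).
Qed.

(** Division undoes the cut-off in the i-th component; where [f i] vanishes the value is 0, the
    inverse of 0 being 0. *)
Definition tcoord i (e : total) : 'rV[R]_k := (f i (tbase e))^-1 *: tfib e i.

Lemma total_rep i (e : total) : f i (tbase e) != 0 ->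
  Q i (tbase e) (tcoord i e) /\ tval e = bundle_pt i (tbase e) (tcoord i e).
Proof.
move=> fi; have Wi := fW_of_neq0 fi.
have [l [y [fl Ql E]]] : total_set (tval e) by exact: set_valP.
have Wl := fW_of_neq0 fl.
have yE : tcoord i e = y *m g l i (tbase e).
  rewrite /tcoord /tfib E /= scalerA mulVf ?scale1r //.
rewrite yE; split; first exact: Q_compat.
rewrite E; congr pair; apply/funext => j /=.
have [fj|fj] := eqVneq (f j (tbase e)) 0; first by rewrite -/(tbase e) fj !scale0r.
by rewrite -(mulmxA y) g_comp //; exact: fW_of_neq0.
Qed.

Lemma total_set_pt i m y : f i m != 0 -> Q i m y -> total_set (bundle_pt i m y).
Proof. by move=> fm Qm; exists i, y. Qed.

(** Inverse charts are functions on the whole coordinate space, so points off the total set need a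
    default; the zero over the base point [m0] serves later. *)
Definition tmk (e0 : total) (p : M * {ptws nat -> 'rV[R]_k}) : total :=
  match pselect (total_set p) with
  | left h => exist _ p (mem_set h)
  | right _ => e0
  end.

Lemma tmkK e0 p : total_set p -> tval (tmk e0 p) = p.
Proof. by move=> h; rewrite /tmk; case: pselect. Qed.

Variable m0 : M.

Lemma total_zero m : total_set (m, fun=> 0).
Proof.
have [i fi] := f_cover m; exists i, 0; split=> //=; first exact/Q0/fW_of_neq0.
by congr pair; apply/funext => j; rewrite mul0mx scaler0.
Qed.

Definition tzero (m : M) : total :=
  exist (fun p => p \in total_set) _ (mem_set (total_zero m)).

Definition tphi i (e : total) : 'rV[R]_(n + k) := row_mx (phi (c i) (tbase e)) (tcoord i e).
Definition tpsi i (x : 'rV[R]_(n + k)) : total :=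
  tmk (tzero m0) (bundle_pt i (psi (c i) (lsubmx x)) (rsubmx x)).
(** The i-th trivialization is used only over the locus f_i != 0, a part of [W i], because the
    coordinate is read off by dividing by [f i]. *)
Definition tdom i : set total := [set e | f i (tbase e) != 0].
Definition tcod i : set 'rV[R]_(n + k) := fiber_dom i Q `&`
  [set x | cod (c i) (lsubmx x) /\ f i (psi (c i) (lsubmx x)) != 0].

Lemma f_open i : open [set m | f i m != 0].
Proof.
have oT : open [set: M] by exact: openT.
rewrite (_ : mkset _ = [set m | setT m /\ [set r : R | r != 0] (f i m)]); last first.
  by apply/seteqP; split=> m //= [].
apply: open_preimage_on; [exact: oT| |exact: open_neq].
by move=> m _; apply: (smoothM_continuous oT).
Qed.

Lemma tdom_open i : open (tdom i).
Proof.
apply: (@open_comp _ _ tbase [set m | f i m != 0]); last exact: f_open.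
by move=> e _; exact: tbase_continuous.
Qed.

Lemma open_lsub (i : nat) (U : set M) : open U ->
  open [set x : 'rV[R]_(n + k) | cod (c i) (lsubmx x) /\ U (psi (c i) (lsubmx x))].
Proof.
move=> oU; apply: (@open_comp _ _ (lsubmx : 'rV[R]_(n + k) -> 'rV[R]_n)
  [set x | cod (c i) x /\ U (psi (c i) x)]); last exact: open_chart_preimage.
by move=> x _; exact: continuous_lsubmx.
Qed.

Lemma tcod_open i : open (tcod i).
Proof. by apply: openI; [exact: oQ|exact: (@open_lsub i _ (@f_open i))]. Qed.

Lemma tcod_pt i x : tcod i x ->
  total_set (bundle_pt i (psi (c i) (lsubmx x)) (rsubmx x)).
Proof. by move=> [[_ _ Qx] [_ fx]]; exact: total_set_pt. Qed.

Lemma tpsi_val i x : tcod i x ->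
  tval (tpsi i x) = bundle_pt i (psi (c i) (lsubmx x)) (rsubmx x).
Proof. by move=> /tcod_pt; exact: tmkK. Qed.

Lemma tphi_cod i e : tdom i e -> tcod i (tphi i e).
Proof.
move=> de; have We := fW_of_neq0 de; have dm := Wdom We.
have [Qe _] := total_rep de.
rewrite /tcod /fiber_dom /tphi /= row_mxKl row_mxKr phiK //.
by split; split=> //; exact: phi_cod.
Qed.

Lemma tpsi_dom i x : tcod i x -> tdom i (tpsi i x).
Proof. by move=> cx; rewrite /tdom /= /tbase tpsi_val //=; case: cx => _ []. Qed.

Lemma tcoord_pt i e j m y : tval e = bundle_pt i m y -> f j m != 0 ->
  tcoord j e = y *m g i j m.
Proof.
by move=> E fj; rewrite /tcoord /tbase /tfib E /= scalerA mulVf // scale1r.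
Qed.

Lemma tphiK i e : tdom i e -> tpsi i (tphi i e) = e.
Proof.
move=> de; apply: tval_inj; rewrite tpsi_val; last exact: tphi_cod.
have [_ ->] := total_rep de.
by rewrite /tphi row_mxKl row_mxKr phiK //; exact/Wdom/fW_of_neq0.
Qed.

Lemma tpsiK i x : tcod i x -> tphi i (tpsi i x) = x.
Proof.
move=> cx; have E := tpsi_val cx; have [[cl Wx Qx] [_ fx]] := cx.
rewrite /tphi (tcoord_pt E fx) g_id // mulmx1 /tbase E /= psiK //.
exact: hsubmxK.
Qed.

Lemma continuous_row_mx_at (T : topologicalType) p q (a : T -> 'rV[R]_p)
    (b : T -> 'rV[R]_q) t : {for t, continuous a} -> {for t, continuous b} ->
  {for t, continuous (fun t => row_mx (a t) (b t))}.
Proof.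
move=> ca cb; apply/cvgrPdist_lt => e e0.
have /cvgrPdist_lt /(_ e e0) na := ca.
have /cvgrPdist_lt /(_ e e0) nb := cb.
near=> s.
have ha : `|a t - a s| < e by near: s.
have hb : `|b t - b s| < e by near: s.
rewrite opp_row_mx add_row_mx ltNge; apply/negP => /(mx_norm_attained e0) [i [j]].
rewrite ord1 leNgt => /negP; apply.
case: (split_ordP j) => l ->; rewrite ?row_mxEl ?row_mxEr;
  by apply: le_lt_trans (ler_mx_norm _ _ _) _.
Unshelve. all: by end_near. Qed.

Lemma tphi_cont i e : tdom i e -> {for e, continuous (tphi i)}.
Proof.
move=> de; have dm := Wdom (fW_of_neq0 de).
have cb := @tbase_continuous e.
apply: continuous_row_mx_at.
  by apply: (@continuous_comp _ _ _ tbase (phi (c i))) => //; exact: phi_cont.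
have cfi : f i (tbase e') @[e' --> e] --> f i (tbase e).
  apply: (@continuous_comp _ _ _ tbase (f i)) => //.
  by apply: (smoothM_continuous openT (sf i)).
exact: (cvgZ (cvgV de cfi) (@tfib_continuous i e)).
Qed.

Lemma smooth_fib i j : smooth_on
  [set x : 'rV[R]_(n + k) | cod (c i) (lsubmx x) /\ W i (psi (c i) (lsubmx x))]
  (fun x => rsubmx x *m (f j (psi (c i) (lsubmx x)) *: g i j (psi (c i) (lsubmx x)))).
Proof.
have oU := @open_lsub i _ (oW i).
apply: smooth_on_mulmx => //.
  apply: (@smooth_on_lin _ _ _ _ _ (rsubmx : {linear 'rV[R]_(n + k) -> 'rV[R]_k}) id) => //.
    exact: continuous_rsubmx.
  exact: smooth_on_id.
exact: (@smooth_pull _ i k k (fun m => f j m *: g i j m) (oW i) (@smoothM_fg i j)).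
Qed.

Lemma tpsi_cont i x : tcod i x -> {for x, continuous (tpsi i)}.
Proof.
move=> cx; apply: (@continuous_initial_at _ _ _ (@set_val _ total_set) (tpsi i)).
have E := tpsi_val cx; have [[cl Wx Qx] [_ fx]] := cx.
have nE : \near x, bundle_pt i (psi (c i) (lsubmx x)) (rsubmx x) = (tval \o tpsi i) x.
  apply: filterS (open_nbhs_nbhs (conj (@tcod_open i) cx)) => y cy.
  by rewrite /= tpsi_val.
rewrite /prop_for /continuous_at [X in _ --> X]E.
apply: (cvg_trans (near_eq_cvg nE)).
have cl' := @continuous_lsubmx R 1 n k x.
set m := psi (c i) (lsubmx x).
apply: (@cvg_pair _ _ _ (nbhs x) (nbhs m)
  (nbhs ((fun j => f j m *: (rsubmx x *m g i j m)) : {ptws nat -> 'rV[R]_k})) _ _ _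
  (fun y => psi (c i) (lsubmx y))
  (fun y => (fun j => f j (psi (c i) (lsubmx y)) *:
    (rsubmx y *m g i j (psi (c i) (lsubmx y)))) : {ptws nat -> 'rV[R]_k})).
  by apply: (@continuous_comp _ _ _ lsubmx (psi (c i))) => //; exact: psi_cont.
(* The fibre component lives in a countable power with pointwise convergence, so continuity is
   checked for each cut-off coordinate separately. *)
apply/pointwise_cvgP => j.
have H := smooth_on_continuous (@smooth_fib i j) (conj cl Wx).
have Eh : (fun x => rsubmx x *m (f j (psi (c i) (lsubmx x)) *: g i j (psi (c i) (lsubmx x)))) =
    (fun x : 'rV[R]_(n + k) => f j (psi (c i) (lsubmx x)) *:
      (rsubmx x *m g i j (psi (c i) (lsubmx x)))).
  by apply/funext => y; rewrite -scalemxAr.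
by move: H; rewrite Eh.
Qed.

Definition tchart i : chart R total (n + k) :=
  Chart (@tdom_open i) (@tcod_open i) (@tphi_cod i) (@tpsi_dom i) (@tphiK i)
    (@tpsiK i) (@tphi_cont i) (@tpsi_cont i).

Lemma tchart_cover e : exists i, dom (tchart i) e.
Proof. by have [i fi] := f_cover (tbase e); exists i. Qed.

(** Distinct points differ in the base or in one of the cut-off coordinates, and all of these are
    continuous with Hausdorff values. *)
Lemma total_hausdorff : hausdorff_space total.
Proof.
apply: hausdorff_separated => x y xy.
have [b|nb] := pselect (tbase x = tbase y); last first.
  exists M, tbase; split=> //; [exact: manifold_hausdorff|exact: tbase_continuous].
have [fb|/existsNP [j nf]] := pselect (forall j, tfib x j = tfib y j).
  exfalso; apply: xy; apply: tval_inj.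
  rewrite [tval x]surjective_pairing [tval y]surjective_pairing.
  by congr pair => //; apply/funext.
exists 'rV[R]_k, (tfib ^~ j); split; [exact: (@norm_hausdorff R 'rV[R]_k)|exact: tfib_continuous|exact: nf].
Qed.

Definition ttrans i j (x : 'rV[R]_(n + k)) : 'rV[R]_(n + k) :=
  row_mx (local_rep id (c i) (c j) (lsubmx x)) (rsubmx x *m g i j (psi (c i) (lsubmx x))).

Definition ttrans_dom i j : set 'rV[R]_(n + k) :=
  [set x | cod (c i) (lsubmx x) /\ (W i `&` W j) (psi (c i) (lsubmx x))].

Lemma ttrans_dom_open i j : open (ttrans_dom i j).
Proof. by apply: open_lsub; exact: openI. Qed.

Lemma ttrans_smooth i j : smooth_on (ttrans_dom i j) (ttrans i j).
Proof.
have oU := @ttrans_dom_open i j.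
have oij : open (W i `&` W j) by exact: openI.
apply: smooth_on_row_mx => //.
  apply: (smooth_on_comp_mx (O := local_dom id (c i) (c j)) (f := lsubmx)) => //.
  - exact: open_local_dom_id.
  - by move=> x [cx [_ Wx]]; split=> //; exact: Wdom.
  - by apply: smooth_on_lsubmx => //; exact: smooth_on_id.
  - exact: trans_smooth.
apply: smooth_on_mulmx => //.
  apply: (@smooth_on_lin _ _ _ _ _ (rsubmx : {linear 'rV[R]_(n + k) -> 'rV[R]_k}) id) => //.
    exact: continuous_rsubmx.
  exact: smooth_on_id.
exact: (@smooth_pull _ i k k (g i j) oij (sg i j)).
Qed.

Lemma tchart_local_dom i j x : local_dom id (tchart i) (tchart j) x ->
  [/\ ttrans_dom i j x, tcod i x & f j (psi (c i) (lsubmx x)) != 0].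
Proof.
move=> [/= cx]; rewrite /tdom /= /tbase tpsi_val //= => fj.
by split=> //; have [[cl Wx _] _] := cx; split=> //; split=> //; exact: fW_of_neq0.
Qed.

Lemma tchart_trans i j x : local_dom id (tchart i) (tchart j) x ->
  local_rep id (tchart i) (tchart j) x = ttrans i j x.
Proof.
move=> /tchart_local_dom [_ cx fj]; rewrite /local_rep /= /tphi /ttrans.
have E := tpsi_val cx; rewrite (tcoord_pt E fj).
by rewrite /tbase E.
Qed.

Lemma tchart_compat i j :
  smooth_on (local_dom id (tchart i) (tchart j)) (local_rep id (tchart i) (tchart j)).
Proof.
apply: (@smooth_on_eq _ _ _ _ (ttrans i j)).
- by apply: open_chart_preimage; exact: dom_open.
- by move=> x dx; rewrite tchart_trans.
- apply: smooth_on_sub (@ttrans_smooth i j) => x dx.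
  by have [] := tchart_local_dom dx.
Qed.

Lemma total_cover e : exists2 C, range tchart C & dom C e.
Proof. by have [i di] := tchart_cover e; exists (tchart i) => //; exists i. Qed.

Lemma total_compat C C' : range tchart C -> range tchart C' ->
  smooth_on (local_dom id C C') (local_rep id C C').
Proof. by move=> [i _ <-] [j _ <-]; exact: tchart_compat. Qed.

Definition total_manifold : manifold R (n + k) :=
  @Manifold R (n + k) total total_hausdorff
    (second_countable_charts tchart_cover) (range tchart) total_cover total_compat.

End TotalSpace.

(** * The contact form on the total space *)

Lemma near_eq_diff (R : realType) (V W : normedModType R) (f g : V -> W) x v :
  differentiable f x -> (\near x, f x = g x) -> 'd f x v = 'd g x v.
Proof.
move=> df fg; have dg := near_eq_differentiable fg df.
by rewrite -(deriveE v df) -(deriveE v dg); exact: near_eq_derive.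
Qed.

Lemma derive_lsubmx (R : realType) n k (W : normedModType R) (h : 'rV[R]_n -> W)
    (x v : 'rV[R]_(n + k)) : differentiable h (lsubmx x) ->
  'D_v (fun y : 'rV[R]_(n + k) => h (lsubmx y)) x = 'D_(lsubmx v) h (lsubmx x).
Proof.
move=> dh; have dl := @differentiable_lsubmx R 1 n k x.
have dc : differentiable (h \o (lsubmx : 'rV[R]_(n + k) -> 'rV[R]_n)) x.
  exact: differentiable_comp.
rewrite (deriveE v dc) (deriveE _ dh) diff_comp //=.
by rewrite (@diff_lin _ _ _ (lsubmx : {linear 'rV[R]_(n + k) -> 'rV[R]_n})) //;
  exact: continuous_lsubmx.
Qed.

Lemma lsubmx_diff (R : realType) n k p (h : 'rV[R]_p -> 'rV[R]_(n + k)) (x v : 'rV[R]_p) :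
  differentiable h x -> lsubmx ('d h x v) = 'd (fun y => lsubmx (h y)) x v.
Proof.
move=> dh; have dl := @differentiable_lsubmx R 1 n k (h x).
have -> : 'd (fun y => lsubmx (h y)) x = 'd (lsubmx : 'rV[R]_(n + k) -> 'rV[R]_n) (h x) \o 'd h x :> (_ -> _).
  exact: (diff_comp (f := h) (g := lsubmx)).
by rewrite /= (@diff_lin _ _ _ (lsubmx : {linear 'rV[R]_(n + k) -> 'rV[R]_n})) //;
  exact: continuous_lsubmx.
Qed.

(** * Nondegeneracy along the zero section *)

Section ZeroSection.
Variables (R : realType) (n k : nat) (a : 'cV[R]_n) (B : 'M[R]_n).
Variables (th : 'M[R]_(n, k)) (F : 'M[R]_(k, n)).
Hypotheses (a0 : a != 0) (sB : B^T = - B) (Fth : F *m th = 1%:M).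
Hypothesis FC : (F :=: kermx (charmx a B))%MS.

Lemma frame_annihilates (u : 'rV[R]_n) : u *m a = 0 -> u *m B *m F^T = 0 /\ F *m a = 0.
Proof.
move=> ua; have FCi i : row i F *m charmx a B = 0.
  by apply/sub_kermxP; rewrite -FC row_sub.
split; last first.
  apply/row_matrixP => i; rewrite row0 row_mul.
  by have [-> _] := (charmx_kerP _ _ a0).1 (FCi i).
apply: trmx_inj; rewrite !trmx_mul trmxK trmx0 sB mulNmx mulmxN.
apply/eqP; rewrite oppr_eq0; apply/eqP/row_matrixP => i; rewrite row0 row_mul mulmxA.
by have [_ H] := (charmx_kerP _ _ a0).1 (FCi i); exact: H.
Qed.

(** Multiplication by [F^T] kills the terms with [B] and [a] and turns [th^T] into the identity.
    Arbitrary [s] serves invertibility, [s = 0] coisotropy. *)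
Lemma zero_section_normal (u : 'rV[R]_n) (w : 'rV[R]_k) (s : R) : u *m a = 0 ->
  u *m B + w *m th^T = s *: a^T -> w = 0.
Proof.
move=> ua E; have [uF Fa] := frame_annihilates ua.
have := congr1 (mulmx^~ F^T) E; rewrite mulmxDl uF add0r -mulmxA -trmx_mul Fth trmx1 mulmx1.
by rewrite -scalemxAl -trmx_mul Fa trmx0 scaler0.
Qed.

Lemma zero_section_aug :
  augmx (col_mx a 0) (block_mx B (- th) th^T 0 : 'M[R]_(n + k)) \in unitmx.
Proof.
apply/augmx_unitP => X s; rewrite -[X]hsubmxK; move: (lsubmx X) (rsubmx X) => u w.
rewrite mul_row_block mul_row_col !mulmx0 !addr0 tr_col_mx trmx0 scale_row_mx scaler0.
move=> /eq_row_mx [E1 E2] ua.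
have w0 := zero_section_normal ua E1.
move: E1; rewrite w0 mul0mx addr0 => uB.
have uth : u *m th = 0 by apply/eqP; rewrite -oppr_eq0 -mulmxN E2.
(* With [w = 0] the vector [u] is in the radical, so u = y F, and u th = 0 reads y = 0; the
   remaining equation s a^T = 0 gives s = 0. *)
have : (u <= F)%MS.
  rewrite FC; apply/sub_kermxP/(charmx_kerP _ _ a0); split=> // w' wa.
  by rewrite uB -scalemxAl -trmx_mul wa trmx0 scaler0.
move=> /submxP [y uE]; have y0 : y = 0 by rewrite -[y]mulmx1 -Fth mulmxA -uE.
have u0 : u = 0 by rewrite uE y0 mul0mx.
split; first by rewrite u0 row_mx0.
move: uB; rewrite u0 mul0mx => /esym/eqP; rewrite scaler_eq0 trmx_eq0 (negPf a0) orbF.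
by move/eqP.
Qed.

End ZeroSection.

(** * The form in bundle coordinates *)

Section BundleForm.
Variables (R : realType) (n k : nat) (M : manifold R n) (eta : one_form M).
Variables (c : nat -> chart R M n) (W : nat -> set M).
Variables (g : nat -> nat -> M -> 'M[R]_k) (th : nat -> M -> 'M[R]_(n, k)).
Hypothesis ac : forall i, atlas M (c i).
Hypothesis oW : forall i, open (W i).
Hypothesis Wdom : forall i, W i `<=` dom (c i).
Hypothesis sg : forall i j, smoothM (W i `&` W j) (g i j).
Hypothesis g_id : forall i m, W i m -> g i i m = 1%:M.
Hypothesis g_comp : forall i j l m, W i m -> W j m -> W l m ->
  g i j m *m g j l m = g i l m.
Hypothesis sth : forall i, smoothM (W i) (th i).
Hypothesis th_compat : forall i j m (y : 'rV[R]_k), W i m -> W j m ->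
  th i m *m y^T = Jm (c i) (c j) m *m th j m *m (y *m g i j m)^T.

(* The form [pi^* eta + p^* lambda], with [lambda] the tautological form of
   the dual of the characteristic distribution and [p] a projection onto it. *)
Definition bform i (x v : 'rV[R]_(n + k)) : R :=
  eta (c i) (lsubmx x) (lsubmx v) +
  (lsubmx v *m th i (psi (c i) (lsubmx x)) *m (rsubmx x)^T) 0 0.

Definition bdom i : set 'rV[R]_(n + k) :=
  [set x | cod (c i) (lsubmx x) /\ W i (psi (c i) (lsubmx x))].

Lemma bdom_open i : open (bdom i).
Proof. exact: (@open_lsub R n k M c i _ (oW i)). Qed.

Lemma bform_linear i x : bdom i x -> scalar (bform i x).
Proof.
move=> [cx Wx] r u v; rewrite /bform !linearP /= (form_linear eta (ac i) cx).
rewrite !mulmxDl -!scalemxAl [X in _ + X]mxE [X in _ + (X + _)]mxE.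
by rewrite mulrDr addrACA.
Qed.

Lemma smooth_lsub (U : set 'rV[R]_(n + k)) : open U -> smooth_on U (lsubmx : _ -> 'rV[R]_n).
Proof. by move=> oU; apply: smooth_on_lsubmx => //; exact: smooth_on_id. Qed.

Lemma smooth_rsub (U : set 'rV[R]_(n + k)) : open U -> smooth_on U (rsubmx : _ -> 'rV[R]_k).
Proof.
move=> oU.
apply: (@smooth_on_lin _ _ _ _ _ (rsubmx : {linear 'rV[R]_(n + k) -> 'rV[R]_k}) id) => //.
  exact: continuous_rsubmx.
exact: smooth_on_id.
Qed.

Lemma bform_smooth i v : smooth_on (bdom i) (fun x => bform i x v).
Proof.
have oU := @bdom_open i; apply: smooth_onD => //.
  apply: (smooth_on_comp (f := lsubmx) (O := cod (c i))
    (h := fun y => eta (c i) y (lsubmx v))) => //.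
  - by move=> x [].
  - exact: smooth_lsub.
  - exact: form_smooth.
apply: smooth_on_coord => //; apply: smooth_on_mulmx => //; last first.
  by apply: smooth_on_trmx => //; exact: smooth_rsub.
apply: smooth_on_mulmx => //; first exact: smooth_on_cst.
have H := @smooth_pull R n k M c ac (W i) i n k (th i) (oW i) (sth i).
exact: H.
Qed.

Local Notation trans := (ttrans c g).
Local Notation trans_dom := (ttrans_dom (k := k) c W).

Lemma ttrans_smooth_on i j : smooth_on (trans_dom i j) (trans i j).
Proof. exact: (@ttrans_smooth R n k M c W g ac oW Wdom sg). Qed.

Lemma trans_dom_open i j : open (trans_dom i j).
Proof. exact: (@ttrans_dom_open R n k M c W oW). Qed.

Lemma trans_bdom i j x : trans_dom i j x -> bdom j (trans i j x).
Proof.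
move=> [cx [Wi Wj]]; rewrite /bdom /ttrans /= row_mxKl; split.
  by apply: phi_cod; exact: Wdom.
by rewrite phiK //; exact: Wdom.
Qed.

Lemma bform_compat i j x v : trans_dom i j x ->
  bform i x v = bform j (trans i j x) ('d (trans i j) x v).
Proof.
move=> dx; have [cx [Wi Wj]] := dx; set m := psi (c i) (lsubmx x) in Wi Wj.
have di := Wdom Wi; have dj := Wdom Wj.
have xE : lsubmx x = phi (c i) m by rewrite psiK.
have dtr := smooth_on_differentiable (@ttrans_smooth_on i j) dx.
have dloc : local_dom id (c i) (c j) (lsubmx x) by split.
have dl : differentiable (local_rep id (c i) (c j)) (lsubmx x).
  exact: smooth_on_differentiable (trans_smooth (ac i) (ac j)) _ dloc.
have E : lsubmx ('d (trans i j) x v) = 'd (local_rep id (c i) (c j)) (lsubmx x) (lsubmx v).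
  rewrite lsubmx_diff //.
  have -> : (fun y => lsubmx (trans i j y)) =
      (fun y : 'rV[R]_(n + k) => local_rep id (c i) (c j) (lsubmx y)).
    by apply/funext => y; rewrite /ttrans row_mxKl.
  rewrite -deriveE; last first.
    apply: (differentiable_comp (f := lsubmx) (g := local_rep id (c i) (c j))) => //.
    exact: differentiable_lsubmx.
  by rewrite derive_lsubmx // deriveE.
rewrite /bform E /ttrans row_mxKl row_mxKr -/m.
rewrite (form_compat eta (ac i) (ac j) dloc) /local_pullback; congr (_ + _).
have -> : psi (c j) (local_rep id (c i) (c j) (lsubmx x)) = m by rewrite xE trans_phi // phiK.
rewrite -mulmxA (th_compat _ Wi Wj) diffJ Jm.unlock -xE.
by rewrite !mulmxA.
Qed.

(** Nondegeneracy of the form at the point with coordinates [y] over [m]. Taken as the definition of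
    the neighbourhood, it turns the contact property into part of membership. *)
Definition bQ i m (y : 'rV[R]_k) : Prop :=
  augmx (formcol (bform i (row_mx (phi (c i) m) y)))
    (formmx (extd (bform i) (row_mx (phi (c i) m) y))) \in unitmx.

Lemma bdom_pt i m y : W i m -> bdom i (row_mx (phi (c i) m) y).
Proof.
move=> Wi; have di := Wdom Wi.
by rewrite /bdom /= row_mxKl phiK //; split=> //; exact: phi_cod.
Qed.

Lemma trans_pt i j m y : W i m -> 
  trans i j (row_mx (phi (c i) m) y) = row_mx (phi (c j) m) (y *m g i j m).
Proof. by move=> /Wdom di; rewrite /ttrans row_mxKl row_mxKr trans_phi // phiK. Qed.

Lemma trans_dom_pt i j m y : W i m -> W j m -> trans_dom i j (row_mx (phi (c i) m) y).
Proof. by move=> Wi Wj; have [cx Wx] := bdom_pt y Wi; split=> //; split=> //; rewrite row_mxKl phiK //; exact: Wdom. Qed.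

Lemma trans_jacobian_inv i j x : trans_dom i j x ->
  'J (trans i j) x *m 'J (trans j i) (trans i j x) = 1%:M.
Proof.
move=> dx; have [cx [Wi Wj]] := dx.
have d1 := smooth_on_differentiable (@ttrans_smooth_on i j) dx.
have dx' : trans_dom j i (trans i j x).
  have [cy Wy] := trans_bdom dx; split=> //; split=> //.
  by rewrite /ttrans row_mxKl phiK //; exact: Wdom.
have d2 := smooth_on_differentiable (@ttrans_smooth_on j i) dx'.
rewrite -jacobian_comp // -(jacobian_id x); apply: jacobian_near.
  exact: differentiable_comp.
apply: filterS (open_nbhs_nbhs (conj (@trans_dom_open i j) dx)) => y [cy [Wiy Wjy]].
have yE : y = row_mx (phi (c i) (psi (c i) (lsubmx y))) (rsubmx y).
  by rewrite psiK // hsubmxK.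
rewrite yE /= !trans_pt // -mulmxA g_comp // g_id // mulmx1.
by [].
Qed.

(** The form is compatible with the transition map, so the two augmented matrices are congruent
    through its invertible Jacobian. *)
Lemma bQ_compat i j m y : W i m -> W j m -> bQ i m y -> bQ j m (y *m g i j m).
Proof.
move=> Wi Wj; rewrite /bQ -trans_pt //; set x := row_mx _ y.
have dx : trans_dom i j x by exact: trans_dom_pt.
have lj y' : bdom j y' -> scalar (bform j y') by exact: bform_linear.
have sj v : smooth_on (bdom j) (fun y => bform j y v) by exact: bform_smooth.
have co x' v : trans_dom i j x' -> bform i x' v = bform j (trans i j x') ('d (trans i j) x' v).
  exact: bform_compat.
rewrite (pullback_formcol (@trans_bdom i j) lj co dx).
rewrite (pullback_formmx (@trans_dom_open i j) (@bdom_open j) (@trans_bdom i j)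
  (@ttrans_smooth_on i j) lj sj co dx).
have uJ : 'J (trans i j) x \in unitmx by have /mulmx1_unit [uJ _] := trans_jacobian_inv dx; exact: uJ.
have key p (J B : 'M[R]_p) (a : 'cV[R]_p) : J \in unitmx ->
    augmx (J *m a) (J *m B *m J^T) \in unitmx -> augmx a B \in unitmx.
  by move=> u; rewrite augmx_congr.
by move=> H; exact: (key _ _ _ _ uJ H).
Qed.

Lemma bQ_psi i x : cod (c i) (lsubmx x) -> bQ i (psi (c i) (lsubmx x)) (rsubmx x) =
  (augmx (formcol (bform i x)) (formmx (extd (bform i) x)) \in unitmx).
Proof.
move=> cx; have E : row_mx (phi (c i) (psi (c i) (lsubmx x))) (rsubmx x) = x.
  by rewrite psiK // hsubmxK.
by rewrite /bQ E; reflexivity.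
Qed.

Lemma bQ_open i : open (fiber_dom c W i bQ).
Proof.
have oU := @bdom_open i.
have lj y' : bdom i y' -> scalar (bform i y') by exact: bform_linear.
have sj v : smooth_on (bdom i) (fun y => bform i y v) by exact: bform_smooth.
have sa := smooth_formcol oU sj.
have sB := smooth_formmx oU sj.
have sA : smooth_on (bdom i)
    (fun x => augmx (formcol (bform i x)) (formmx (extd (bform i) x))).
  apply: smooth_on_col_mx => //; apply: smooth_on_row_mx => //; last exact: smooth_on_cst.
  apply: (smooth_on_eq oU (f := fun x => (-1%:M) *m (formcol (bform i x))^T)).
    by move=> x _; rewrite mulNmx mul1mx.
  apply: smooth_on_mulmx => //; first exact: smooth_on_cst.
  exact: smooth_on_trmx.
have sd := smooth_on_det oU sA.
rewrite (_ : fiber_dom c W i bQ = [set x | bdom i x /\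
  [set r : R | r != 0] (\det (augmx (formcol (bform i x)) (formmx (extd (bform i) x))))]).
  by apply: open_preimage_on; [exact: oU|exact: smooth_on_continuous sd|exact: open_neq].
apply/seteqP; split=> x /=.
  by move=> [cx Wx]; rewrite bQ_psi // unitmxE unitfE.
by move=> [[cx Wx] /=]; rewrite -unitfE -unitmxE -bQ_psi // => ?; split.
Qed.

Lemma bform_zero_formcol i m : W i m ->
  formcol (bform i (row_mx (phi (c i) m) 0)) = col_mx (acol eta (c i) m) 0.
Proof.
move=> Wi; have di := Wdom Wi.
apply/colP => l; rewrite mxE /bform row_mxKl row_mxKr trmx0 mulmx0 [X in _ + X]mxE addr0.
case: (split_ordP l) => a ->.
  rewrite col_mxEu acol.unlock mxE; congr (eta _ _ _).
  by apply/rowP => b; rewrite !mxE /= eq_lshift.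
rewrite col_mxEd mxE.
have -> : lsubmx (delta_mx 0 (rshift n a) : 'rV[R]_(n + k)) = 0.
  by apply/rowP => b; rewrite !mxE /= eq_lrshift.
have lin := form_linear eta (ac i) (phi_cod di).
by have := lin (-1) 0 0; rewrite scaler0 addr0 mulN1r addNr.
Qed.

(** The derivative of [th] appears multiplied by the fibre coordinate, which is 0 on the zero
    section; of the tautological part only the derivative of that coordinate remains. *)
Lemma derive_bform_zero i m (u v : 'rV[R]_(n + k)) : W i m ->
  'D_u (fun y => bform i y v) (row_mx (phi (c i) m) 0) =
  'D_(lsubmx u) (fun y => eta (c i) y (lsubmx v)) (phi (c i) m) +
  (lsubmx v *m th i m *m (rsubmx u)^T) 0 0.
Proof.
move=> Wi; have di := Wdom Wi; set x := row_mx _ _.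
have dx : bdom i x by exact: bdom_pt.
have oU := @bdom_open i.
have xl : lsubmx x = phi (c i) m by rewrite row_mxKl.
have d1 : differentiable (fun y => eta (c i) y (lsubmx v)) (lsubmx x).
  rewrite xl; apply: smooth_on_differentiable (form_smooth eta (ac i) _) _ _.
  exact: phi_cod.
have d1' : differentiable (fun y : 'rV[R]_(n + k) => eta (c i) (lsubmx y) (lsubmx v)) x.
  apply: (differentiable_comp (f := lsubmx) (g := fun y => eta (c i) y (lsubmx v))) => //.
  exact: differentiable_lsubmx.
pose al l (y : 'rV[R]_(n + k)) := (lsubmx v *m th i (psi (c i) (lsubmx y))) 0 l.
have sal l : smooth_on (bdom i) (al l).
  apply: smooth_on_coord => //; apply: smooth_on_mulmx => //; first exact: smooth_on_cst.
  have H := @smooth_pull R n k M c ac (W i) i n k (th i) (oW i) (sth i).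
  exact: H.
have srs l : smooth_on (bdom i) (fun y : 'rV[R]_(n + k) => (rsubmx y) 0 l).
  by apply: smooth_on_coord => //; exact: smooth_rsub.
have da l : differentiable (al l) x := smooth_on_differentiable (sal l) dx.
have dr l : differentiable (fun y : 'rV[R]_(n + k) => (rsubmx y) 0 l) x :=
  smooth_on_differentiable (srs l) dx.
have -> : 'D_u (fun y => bform i y v) x =
    'D_u ((fun y : 'rV[R]_(n + k) => eta (c i) (lsubmx y) (lsubmx v)) +
      \sum_l (fun y => al l y * (rsubmx y) 0 l)) x.
  congr ('D_u _ x); apply/funext => y; rewrite fctE fct_sumE /bform; congr (_ + _).
  by rewrite mxE; apply: eq_bigr => l _; rewrite [X in _ * X = _]mxE.
have dm l : derivable (fun y => al l y * (rsubmx y) 0 l) x u.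
  by apply: derivableM; exact: diff_derivable.
rewrite deriveD; [|exact: diff_derivable|exact: derivable_sum].
rewrite (derive_lsubmx (h := fun y => eta (c i) y (lsubmx v)) u d1) xl; congr (_ + _).
rewrite derive_sum // mxE; apply: eq_bigr => l _.
rewrite deriveM; [|exact: diff_derivable|exact: diff_derivable].
have -> : 'D_u (fun y : 'rV[R]_(n + k) => (rsubmx y) 0 l) x = (rsubmx u) 0 l.
  have dR := @differentiable_rsubmx R 1 n k x.
  rewrite -(derive_coord _ _ dR) (deriveE _ dR).
  by rewrite (@diff_lin _ _ _ (rsubmx : {linear 'rV[R]_(n + k) -> 'rV[R]_k})) //;
    exact: continuous_rsubmx.
rewrite row_mxKr [in X in _ + X]mxE scale0r addr0 /al xl phiK //.
by rewrite [X in _ = _ * X]mxE.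
Qed.

Lemma bform_zero_formmx i m : W i m ->
  formmx (extd (bform i) (row_mx (phi (c i) m) 0)) =
  block_mx (Bmx eta (c i) m) (- th i m) (th i m)^T 0.
Proof.
move=> Wi; apply/matrixP => a b; rewrite mxE /extd !derive_bform_zero //.
have L (l : 'I_n) : lsubmx (delta_mx 0 (lshift k l) : 'rV[R]_(n + k)) = delta_mx 0 l.
  by apply/rowP => z; rewrite !mxE /= eq_lshift.
have L' (l : 'I_k) : lsubmx (delta_mx 0 (rshift n l) : 'rV[R]_(n + k)) = 0.
  by apply/rowP => z; rewrite !mxE /= eq_lrshift.
have Rr (l : 'I_k) : rsubmx (delta_mx 0 (rshift n l) : 'rV[R]_(n + k)) = delta_mx 0 l.
  by apply/rowP => z; rewrite !mxE /= eq_rshift.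
have R' (l : 'I_n) : rsubmx (delta_mx 0 (lshift k l) : 'rV[R]_(n + k)) = 0.
  by apply/rowP => z; rewrite !mxE /= eq_rlshift.
have M00 : (0 : 'M[R]_1) 0 0 = 0 by rewrite mxE.
have D0 (h : 'rV[R]_n -> R) : 'D_0 h (phi (c i) m) = 0 by exact: derive0.
have deltaE p q (A : 'M[R]_(p, q)) (x : 'I_p) (y : 'I_q) :
    ((delta_mx 0 x : 'rV[R]_p) *m A *m (delta_mx 0 y : 'rV[R]_q)^T) 0 0 = A x y.
  by rewrite -rowE trmx_delta -colE !mxE.
have Z u : 'D_u (fun y => eta (c i) y 0) (phi (c i) m) = 0.
  have di := Wdom Wi.
  rewrite (near_eq_derive (g := cst 0)) ?derive_cst //.
  apply: filterS (open_nbhs_nbhs (conj (@cod_open _ _ _ (c i)) (phi_cod di))) => y cy.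
  by have := form_linear eta (ac i) cy (-1) 0 0; rewrite scaler0 addr0 mulN1r addNr.
case: (split_ordP a) => a' ->; case: (split_ordP b) => b' ->;
  rewrite ?block_mxEul ?block_mxEur ?block_mxEdl ?block_mxEdr ?L ?L' ?Rr ?R' ?trmx0
    ?mulmx0 ?mul0mx ?D0 ?Z.
- by rewrite Bmx.unlock [in RHS]mxE /extd !mxE !addr0.
- by rewrite M00 addr0 !add0r deltaE [RHS]mxE.
- by rewrite M00 addr0 subr0 add0r deltaE [RHS]mxE.
- by rewrite M00 !addr0 subrr [RHS]mxE.
Qed.

End BundleForm.

(** * The embedding as zero section *)

Section Construction.
Variables (R : realType) (n k : nat) (M : manifold R n) (eta : one_form M).
Hypothesis acol_neq0 : forall c m, atlas M c -> dom c m -> acol eta c m != 0.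
Variables (D : nat -> frame_data eta k) (N : M -> nat) (m0 : M).
Hypothesis HD : forall m : M, exists j, nbhs m [set m' | ff (D j) m' = 1].
Hypothesis HN : forall m, ff (D (N m)) m = 1.

Definition ec i := fc (D i).
Definition eW i := fW (D i).
Definition eg := gmx D.
Definition eth := theta D N.

Lemma ec_atlas i : atlas M (ec i). Proof. exact: fc_atlas. Qed.
Lemma eW_open i : open (eW i). Proof. exact: fW_open. Qed.
Lemma eW_dom i : eW i `<=` dom (ec i). Proof. exact: fW_dom. Qed.
Lemma eK_closed i : closed (fK (D i)). Proof. exact: fK_closed. Qed.
Lemma eK_W i : fK (D i) `<=` eW i. Proof. exact: fK_W. Qed.
Lemma ef_smooth i : smoothM setT (ff (D i)). Proof. exact: ff_smooth. Qed.
Lemma ef_out i m : ~ fK (D i) m -> ff (D i) m = 0. Proof. exact: ff_out. Qed.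
Lemma eg_smooth i j : smoothM (eW i `&` eW j) (eg i j). Proof. exact: gmx_smooth. Qed.
Lemma eg_id i m : eW i m -> eg i i m = 1%:M. Proof. exact: gmx_id. Qed.
Lemma eg_comp i j l m : eW i m -> eW j m -> eW l m -> eg i j m *m eg j l m = eg i l m.
Proof. exact: (gmx_comp acol_neq0). Qed.
Lemma ef_cover m : exists i, ff (D i) m != 0.
Proof. by exists (N m); rewrite HN oner_eq0. Qed.
Lemma eth_smooth i : smoothM (eW i) (eth i).
Proof. apply: smoothM_sub (theta_smooth HD HN i); exact: fW_dom. Qed.
Lemma eth_compat i j m (y : 'rV[R]_k) : eW i m -> eW j m ->
  eth i m *m y^T = Jm (ec i) (ec j) m *m eth j m *m (y *m eg i j m)^T.
Proof. exact: (theta_compat acol_neq0). Qed.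

Definition eF i := bform eta ec eth i.
Definition eQ := bQ eta ec eth.

Lemma eQ_open i : open (fiber_dom ec eW i eQ).
Proof. exact: (bQ_open ec_atlas eW_open eth_smooth). Qed.

Lemma eB_skew i m : (Bmx eta (ec i) m)^T = - Bmx eta (ec i) m.
Proof. by rewrite Bmx.unlock formmx_skew. Qed.

Lemma ea_neq0 i m : eW i m -> acol eta (ec i) m != 0.
Proof. by move=> /eW_dom; apply: acol_neq0; exact: ec_atlas. Qed.

Lemma eF_theta i m : eW i m -> fF (D i) m *m eth i m = 1%:M.
Proof. exact: (fF_theta acol_neq0 HN). Qed.

Lemma eF_ker i m : eW i m ->
  (fF (D i) m :=: kermx (charmx (acol eta (ec i) m) (Bmx eta (ec i) m)))%MS.
Proof. by move=> /fF_ker; rewrite Cmx.unlock. Qed.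

Lemma eQ_zero i m : eW i m -> eQ i m 0.
Proof.
move=> Wi; rewrite /eQ /bQ.
have E1 := bform_zero_formcol eta eth ec_atlas eW_dom Wi.
have E2 := bform_zero_formmx eta ec_atlas eW_open eW_dom eth_smooth Wi.
rewrite E1 E2.
exact: (zero_section_aug (ea_neq0 Wi) (eB_skew i m) (eF_theta Wi) (eF_ker Wi)).
Qed.

Lemma eQ_compat i j m y : eW i m -> eW j m -> eQ i m y -> eQ j m (y *m eg i j m).
Proof.
exact: (bQ_compat ec_atlas eW_open eW_dom eg_smooth eg_id eg_comp eth_smooth eth_compat).
Qed.

Definition etotal : manifold R (n + k) :=
  total_manifold ec_atlas eW_open eW_dom eK_closed eK_W ef_smooth ef_out eg_smooth
    eg_id eg_comp ef_cover eQ_open eQ_zero eQ_compat m0.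

Definition echart i : chart R etotal (n + k) :=
  tchart ec_atlas eW_open eW_dom eK_closed eK_W ef_smooth ef_out eg_smooth
    eg_id eg_comp ef_cover eQ_open eQ_zero eQ_compat m0 i.

(** A 1-form takes charts, while [eF] takes indices; an index is recovered by choice, and the
    compatibility of [eF] between any two indices covers whichever one is chosen. *)
Definition eidx (C : chart R etotal (n + k)) : nat := xget 0%N [set i | echart i = C].

Lemma eidxK C : atlas etotal C -> echart (eidx C) = C.
Proof. by move=> [i _ E]; apply: (@xgetPex _ 0%N [set i | echart i = C]); exists i. Qed.

Lemma echart_cod i x : cod (echart i) x -> bdom ec eW i x.
Proof. by move=> [[cx Wx _] _]. Qed.

Lemma echart_local_dom i j x : local_dom id (echart i) (echart j) x -> ttrans_dom ec eW i j x.
Proof. by move=> dx; have [] := tchart_local_dom dx. Qed.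

Lemma echart_trans i j x : local_dom id (echart i) (echart j) x ->
  local_rep id (echart i) (echart j) x = ttrans ec eg i j x.
Proof. exact: tchart_trans. Qed.

Lemma eform_linear C x : atlas etotal C -> cod C x -> scalar (eF (eidx C) x).
Proof.
move=> /eidxK E; rewrite -{1}E => /echart_cod cx.
exact: (bform_linear eta eth ec_atlas cx).
Qed.

Lemma eform_smooth C : atlas etotal C ->
  forall v, smooth_on (cod C) (fun x => eF (eidx C) x v).
Proof.
move=> /eidxK E v; rewrite -{1}E.
apply: smooth_on_sub (bform_smooth eta ec_atlas eW_open eth_smooth (eidx C) v).
exact: echart_cod.
Qed.

Lemma eform_compat C C' : atlas etotal C -> atlas etotal C' ->
  forall x, local_dom id C C' x ->
  forall v, eF (eidx C) x v = local_pullback id C C' (eF (eidx C')) x v.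
Proof.
move=> /eidxK + /eidxK; move: (eidx C) (eidx C') => i j <- <- x dx v.
have tx := echart_local_dom dx.
have oT : open (local_dom id (echart i) (echart j)).
  by apply: open_chart_preimage; exact: dom_open.
have sT : smooth_on (local_dom id (echart i) (echart j))
    (local_rep id (echart i) (echart j)).
  exact: tchart_compat.
have Ed : 'd (local_rep id (echart i) (echart j)) x v = 'd (ttrans ec eg i j) x v.
  apply: near_eq_diff; first exact: smooth_on_differentiable sT _ dx.
  apply: filterS (open_nbhs_nbhs (conj oT dx)) => y dy.
  exact: echart_trans.
rewrite /local_pullback Ed (echart_trans dx).
exact: (bform_compat eta ec_atlas eW_open eW_dom eg_smooth eth_compat v tx).
Qed.

Definition eform : one_form etotal := OneForm eform_linear eform_smooth eform_compat.

Lemma eform_aug C x : atlas etotal C -> cod C x ->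
  augmx (formcol (eform C x)) (formmx (ext_d eform C x)) \in unitmx.
Proof.
move=> /eidxK E; rewrite -{1}E => -[[cx Wx Qx] _].
have := Qx; rewrite /eQ bQ_psi //.
Qed.

Definition ezero (m : M) : etotal := tzero eg eK_W ef_out ef_cover eQ_zero m.

Lemma ezero_rep (c' : chart R M n) i :
  local_rep ezero c' (echart i) = fun x => row_mx (local_rep id c' (ec i) x) 0.
Proof.
apply/funext => x; rewrite /local_rep /=.
by rewrite /tphi /tcoord /tfib /= scaler0.
Qed.

Lemma ezero_dom (c' : chart R M n) i x : local_dom ezero c' (echart i) x ->
  cod c' x /\ eW i (psi c' x).
Proof. by move=> [cx fx]; split=> //; exact: (fW_of_neq0 eK_W ef_out fx). Qed.

Lemma ezero_continuous : continuous ezero.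
Proof.
move=> m; apply: (@continuous_initial_at _ _ _ (@set_val _ (total_set _ _ _)) ezero).
apply: (@cvg_pair _ _ _ (nbhs m) (nbhs m)
  (nbhs ((fun=> 0) : {ptws nat -> 'rV[R]_k})) _ _ _ id (fun=> fun=> 0)).
  exact: cvg_id.
exact: cvg_cst.
Qed.

Section AtPoint.
Variables (c' : chart R M n) (i : nat) (x : 'rV[R]_n).
Hypotheses (ac' : atlas M c') (dx : local_dom ezero c' (echart i) x).
Local Notation m := (psi c' x).
Local Notation L := (local_rep ezero c' (echart i)).

Lemma ezero_base : [/\ dom c' m, dom (ec i) m, eW i m, phi c' m = x &
  local_dom id c' (ec i) x].
Proof.
have [cx Wi] := ezero_dom dx.
by split=> //; [exact: psi_dom|exact: eW_dom|exact: psiK|split=> //; exact: eW_dom].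
Qed.

Lemma ezero_smooth_at : exists2 O, O x & smooth_on O L.
Proof.
have [_ _ _ _ lx] := ezero_base.
exists (local_dom id c' (ec i)) => //; rewrite ezero_rep.
apply: smooth_on_row_mx; [exact: open_local_dom_id| |exact: smooth_on_cst].
by apply: trans_smooth => //; exact: ec_atlas.
Qed.

Lemma ezero_differentiable : differentiable L x.
Proof. by have [B Bx sB] := ezero_smooth_at; exact: smooth_on_differentiable sB _ Bx. Qed.

Lemma ezero_diff v : 'd L x v = row_mx (v *m Jm c' (ec i) m) 0.
Proof.
have dL := ezero_differentiable; have [dm di Wi xE lx] := ezero_base.
rewrite -[LHS]hsubmxK; congr row_mx.
  rewrite lsubmx_diff // ezero_rep.
  have -> : (fun y => lsubmx (row_mx (local_rep id c' (ec i) y) (0 : 'rV[R]_k))) =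
      local_rep id c' (ec i) by apply/funext => y; rewrite row_mxKl.
  by rewrite diffJ Jm.unlock xE.
apply/rowP => j; rewrite mxE -(deriveE v dL) (derive_coord _ _ dL) ezero_rep.
rewrite (_ : (fun y => _) = cst 0) ?derive_cst ?mxE //.
by apply/funext => y; rewrite row_mxEr mxE.
Qed.

Lemma ezero_repE : L x = row_mx (phi (ec i) m) 0.
Proof. by rewrite ezero_rep. Qed.

End AtPoint.

Lemma ezero_embedding : embedding ezero.
Proof.
split.
- split; first exact: ezero_continuous.
  move=> c C ac /eidxK <-; apply: smooth_on_local => x dx.
  exact: ezero_smooth_at.
- by move=> m m' E; have : tbase (ezero m) = tbase (ezero m') by rewrite E.
(* The bundle projection is a continuous left inverse of the zero section, so it recovers [U] from
   an open set of the total space. *)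
- move=> U oU; exists (@tbase R n k M (fun i => ff (D i)) eg eQ @^-1` U) => //.
  by apply: open_comp => // e _; exact: tbase_continuous.
- move=> c C x ac /eidxK <- dx v v' E.
  have [dm di Wi xE lx] := ezero_base dx.
  have := E; rewrite !ezero_diff // => /eq_row_mx [E' _].
  have J := Jm_inv ac (ec_atlas (eidx C)) dm di.
  by rewrite -[v]mulmx1 -[v']mulmx1 -J !mulmxA E'.
Qed.

Lemma ezero_pullback : is_pullback ezero eform eta.
Proof.
move=> c C ac aC x; rewrite /local_pullback /=; move: (eidxK aC) => {aC}.
move: (eidx C) => i <- dx v.
have [dm di Wi xE lx] := ezero_base dx.
rewrite ezero_diff // ezero_repE /eF /bform row_mxKl row_mxKl row_mxKr.
rewrite trmx0 mulmx0 [X in _ + X]mxE addr0.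
rewrite (form_compat eta ac (ec_atlas i) lx) /local_pullback.
by rewrite diffJ Jm.unlock xE.
Qed.

Lemma ezero_coisotropic : coisotropic_image eform ezero.
Proof.
move=> c C ac aC x dxC; have E := eidxK aC.
have dx : local_dom ezero c (echart (eidx C)) x by rewrite E.
have [dm di Wi xE lx] := ezero_base dx.
set i := eidx C in dx Wi di lx *; set m := psi c x in dm di Wi xE.
have bx : bdom ec eW i (row_mx (phi (ec i) m) (0 : 'rV[R]_k)) by exact: (bdom_pt eW_dom _ Wi).
have lw y : bdom ec eW i y -> scalar (eF i y).
  by move=> By; exact: (bform_linear eta eth ec_atlas By).
have sw v : smooth_on (bdom ec eW i) (fun y => eF i y v).
  exact: (bform_smooth eta ec_atlas eW_open eth_smooth i v).
have oB : open (bdom (k := k) ec eW i) by exact: bdom_open eW_open i.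
have Ji := Jm_inv (ec_atlas i) ac di dm.
have LE : local_rep ezero c C x = row_mx (phi (ec i) m) (0 : 'rV[R]_k).
  by rewrite -ezero_repE E.
have dE v : 'd (local_rep ezero c C) x v = row_mx (v *m Jm c (ec i) m) (0 : 'rV[R]_k).
  by rewrite -(ezero_diff ac dx) E.
rewrite LE => T X [X1 X2].
have [u [w XE]] : exists u w, X = row_mx u w by exists (lsubmx X), (rsubmx X); rewrite hsubmxK.
have ua : u *m acol eta (ec i) m = 0.
  have X1' : eF i (row_mx (phi (ec i) m) 0) X = 0 := X1.
  apply/matrixP => a b; rewrite !ord1 [RHS]mxE -X1' (formcolE _ (lw _ bx)).
  rewrite (bform_zero_formcol eta eth ec_atlas eW_dom Wi) XE mul_row_col mulmx0 addr0.
  by [].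
(* Orthogonality is tested on the horizontal basis vectors, which are tangent to the zero section:
   they are the images of the rows of the Jacobian from [ec i] to [c]. *)
have uB : u *m Bmx eta (ec i) m + w *m (eth i m)^T = 0 *: (acol eta (ec i) m)^T.
  rewrite scale0r; apply/rowP => j; rewrite [RHS]mxE.
  have := X2 (row_mx (delta_mx 0 j) 0); rewrite -[ext_d _ _ _ _ _]/(extd (eF i) _ _ _).
  rewrite (extdE oB lw sw _ _ bx).
  rewrite (bform_zero_formmx eta ec_atlas eW_open eW_dom eth_smooth Wi) XE.
  rewrite mul_row_block mulmx0 addr0 tr_row_mx mul_row_col trmx0 mulmx0 addr0.
  rewrite trmx_delta -colE mxE; apply.
  exists (delta_mx 0 j *m Jm (ec i) c m) => //.
  by rewrite dE -mulmxA Ji mulmx1.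
have w0 := zero_section_normal (ea_neq0 Wi) (eB_skew i m) (eF_theta Wi) (eF_ker Wi) ua uB.
exists (u *m Jm (ec i) c m) => //.
by rewrite dE -mulmxA Ji mulmx1 XE w0.
Qed.

End Construction.

(** * Existence of the embedding and count of dimensions *)

Lemma exists_coisotropic_embedding (R : realType) (n k q : nat) (M : manifold R n)
    (eta : one_form M) (m0 : M) : n = (q + k)%N ->
  (forall c m, atlas M c -> dom c m -> acol eta c m != 0) ->
  (forall c m, atlas M c -> dom c m -> \rank (Cmx eta c m) = q) ->
  exists (Mt : manifold R (n + k)) (etat : one_form Mt) (i : M -> Mt),
    [/\ forall C x, atlas Mt C -> cod C x ->
          augmx (formcol (etat C x)) (formmx (ext_d etat C x)) \in unitmx,
        embedding i, is_pullback i etat eta & coisotropic_image etat i].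
Proof.
move=> nqk a0 rC.
have ex := exists_frame_data nqk rC.
have [D0 _] := ex m0.
have [D HD] := lindelof_nat D0 (@manifold_second_countable _ _ M) ex.
have HD1 m : exists j, ff (D j) m = 1.
  by have [j /nbhs_singleton fj] := HD m; exists j.
have [N HN] := choice HD1.
exists (etotal a0 m0 HD HN), (eform a0 m0 HD HN), (ezero a0 m0 HD HN); split.
- exact: eform_aug.
- exact: ezero_embedding.
- exact: ezero_pullback.
- exact: ezero_coisotropic.
Qed.

(** For empty [M] all conditions are vacuous. The general construction uses a point, as a default
    value for inverse charts and to see that the rank [r] is even. *)
Lemma empty_manifold_embedding (R : realType) (d : nat) (M : manifold R (d * 2).+1)
    (eta : one_form M) : (M -> False) ->
  [/\ contact eta, embedding (id : M -> M), is_pullback id eta eta &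
    coisotropic_image eta (id : M -> M)].
Proof.
move=> nM; split.
- by move=> c x _ _; have := nM (psi c x).
- split.
  + split; first by move=> m; have := nM m.
    by move=> c c' ac ac'; exact: atlas_compat.
  + by move=> m; have := nM m.
  + by move=> U oU; exists U.
  + by move=> c c' x; have := nM (psi c x).
- by move=> c c' _ _ x; have := nM (psi c x).
- by move=> c c' _ _ x; have := nM (psi c x).
Qed.

Theorem theorem5p12 (R : realType) (d : nat) (M : manifold R (d * 2).+1)
    (eta : one_form M) (precontact_eta : precontact eta) :
  exists (n : nat) (Mt : manifold R (n * 2).+1) (etat : one_form Mt)
         (i : M -> Mt),
    [/\ contact etat, embedding i, is_pullback i etat eta &
        coisotropic_image etat i].
Proof.
have [[m0 _]|nM] := pselect (exists m : M, True); last first.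
  exists d, M, eta, id; apply: empty_manifold_embedding => m.
  by apply: nM; exists m.
move: precontact_eta => [nv [r rk]].
have a0 c m : atlas M c -> dom c m -> acol eta c m != 0.
  move=> ac dm; rewrite acol.unlock; have cx := phi_cod dm.
  have [v] := nv c _ ac cx; apply: contraNneq => E.
  by rewrite (formcolE _ (form_linear eta ac cx)) E mulmx0 mxE.
have rC c m : atlas M c -> dom c m -> \rank (Cmx eta c m) = r.+1.
  move=> ac dm; rewrite Cmx.unlock charmx_rank; last exact: a0.
  by rewrite acol.unlock Bmx.unlock -(rk c _ ac (phi_cod dm)).
have [c ac dm0] := atlas_cover m0.
have rE := rk c _ ac (phi_cod dm0).
have sB := formmx_skew (eta c) (phi c m0).
have er : ~~ odd r.
  have skew_congr p (K B : 'M[R]_p) : B^T = - B -> (K *m B *m K^T)^T = - (K *m B *m K^T).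
    by move=> sB'; rewrite !trmx_mul trmxK sB' mulNmx mulmxN mulmxA.
  by rewrite -rE; apply: skew_rank_even; exact: skew_congr sB.
have rd : (r <= d * 2)%N.
  have := rC c m0 ac dm0; have := rank_leq_row (Cmx eta c m0).
  by move=> + E; rewrite E.
(* [k] is the rank of the characteristic distribution, even since [r] is; adding k = 2h fibre
   dimensions to 2d + 1 gives 2(d + h) + 1. *)
pose k := (d * 2 - r)%N; pose h := k./2.
have kh : k = (h * 2)%N.
  by rewrite /h muln2 even_halfK // /k oddB // muln2 odd_double.
have nqk : (d * 2).+1 = (r.+1 + k)%N by rewrite /k addSn subnKC.
have E : ((d * 2).+1 + k = ((d + h) * 2).+1)%N by rewrite kh mulnDl addSn.
have : exists (Mt : manifold R ((d + h) * 2).+1) (etat : one_form Mt) (i : M -> Mt),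
    [/\ forall C x, atlas Mt C -> cod C x ->
          augmx (formcol (etat C x)) (formmx (ext_d etat C x)) \in unitmx,
        embedding i, is_pullback i etat eta & coisotropic_image etat i].
  by rewrite -E; exact: (exists_coisotropic_embedding m0 nqk a0 rC).
move=> [Mt [etat [i [aug emb pul coi]]]].
exists (d + h)%N, Mt, etat, i; split=> // C x aC cx.
have lw y : cod C y -> scalar (etat C y) by exact: form_linear.
have sw v : smooth_on (cod C) (fun y => etat C y v) by exact: form_smooth.
apply: (contact_augmx (A := formcol (etat C x)) (B := formmx (ext_d etat C x))).
- by move=> v; apply: formcolE; exact: lw.
- by move=> u v; apply: (extdE (@cod_open _ _ _ C) lw sw).
- exact: formmx_skew.
- exact: aug.
Qed.
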